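(* Let $\mathbb{K}$ be a field, let $\Gamma=A_n$ or $D_n$, and assume $\mathrm{char}(\mathbb{K})\neq2$ if $\Gamma=D_n$. Then there exists a quasi-isomorphism of DG-algebras $$LCA^*(\Lambda_\Gamma)\simeq\mathscr{G}_\Gamma.$$ Furthermore, if $\mathrm{char}(\mathbb{K})=2$ and $\Gamma=D_n$, then $LCA^*(\Lambda_\Gamma)$ and $\mathscr{G}_\Gamma$ are not quasi-isomorphic.
   Context: Let $\Gamma$ be a finite tree with vertex set $\Gamma_0$. Choose a root and orient all edges away from the root; $\Gamma_1$ is the resulting set of arrows, and $g_{wv}$ denotes an arrow from $v$ to $w$. Let $\mathrm{k}=\bigoplus_{v\in\Gamma_0}\mathbb{K}e_v$ with $e_v^2=e_v$, $e_ve_w=0$ for $v\ne w$. Paths are multiplied from right to left. All DG-algebras are cohomologically graded (differential of degree $+1$) and satisfy $d(a_2a_1)=(da_2)a_1+(-1)^{|a_2|}a_2(da_1)$. Ginzburg DG-algebra $\mathscr{G}_\Gamma$: let $\widehat\Gamma$ be the quiver with vertices $\Gamma_0$ and arrows: the arrows $g\in\Gamma_1$ in bidegree $(1,-1)$; the opposite arrows $g^*$, $g\in\Gamma_1$, in bidegree $(1,-1)$; loops $h_v$ at each $v\in\Gamma_0$ in bidegree $(1,-2)$. Then $\mathscr{G}_\Gamma$ is the path algebra $\mathbb{K}\widehat\Gamma$ over $\mathrm{k}$ with the $\mathrm{k}$-linear derivation $d$ of bidegree $(1,0)$ given by $dg=dg^*=0$ and $dh=\sum_{g\in\Gamma_1}(g^*g-gg^*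 )$, where $h=\sum_vh_v$. In bidegree $(r,s)$, $r$ is the path length, $s$ the internal degree, and the DG-degree is $r+s$. $LCA^*(\Lambda_\Gamma)$ is the cohomologically graded Chekanov–Eliashberg (Legendrian cohomology) DG-algebra of the Legendrian link $\Lambda_\Gamma=\bigcup_v\Lambda_v$ in standard form whose components are Legendrian unknots linked (plumbed) according to $\Gamma$. Explicitly: fix a linear order on the set of children of each vertex (from a planar embedding of the rooted tree). It is the tensor algebra over $\mathrm{k}$ on generators $c_v=e_vc_ve_v$ ($v\in\Gamma_0$) of degree $-1$ and $c_{wv}=e_wc_{wv}e_v$, $c_{vw}=e_vc_{vw}e_w$ of degree $0$ for every pair of adjacent vertices $v,w$. Its differential $D$ satisfies $Dc_{wv}=0$ for all adjacent $v,w$ and $$D(c_v)=-\sum_{u:\ g_{vu}\in\Gamma_1}c_{vu}c_{uv}+\sum_{i\ge1}\ \sum_{\substack{w_1<\cdots<w_i\\ g_{w_jv}\in\Gamma_1}}c_{vw_1}c_{w_1v}\cdots c_{vw_i}c_{w_iv},$$ extended by the graded Leibniz rule. *)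

(* Defs.v *)
From HB Require Import structures.
From mathcomp Require Import all_boot all_order all_algebra.
From mathcomp Require Import finmap.
From mathcomp.multinomials Require Import monalg.

Set Implicit Arguments.
Unset Strict Implicit.
Unset Printing Implicit Defensive.

Import GRing.Theory.
Local Open Scope ring_scope.

(* DG-algebras over the semisimple ring k = \bigoplus_(v : V) K e_v, with the *)
(* cohomological convention (differential of degree +1).  The k-algebra       *)
(* structure is given by the images [dg_idem v] of the idempotents e_v, and   *)
(* [dg_homog i] is the degree i summand of the internal Z-grading.  By the    *)
(* Leibniz rule, [dg_diff_idem] says that the differential is k-bilinear.     *)
Record dgAlg (K : fieldType) (V : finType) := DGAlg {
  dg_sort :> algType K;
  dg_idem : V -> dg_sort;
  dg_homog : int -> dg_sort -> Prop;
  dg_diff : {linear dg_sort -> dg_sort};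
  dg_idemM : forall v w,
    dg_idem v * dg_idem w = if v == w then dg_idem v else 0;
  dg_idem_sum : \sum_v dg_idem v = 1;
  dg_homog0 : forall i, dg_homog i 0;
  dg_homogP : forall i a x y,
    dg_homog i x -> dg_homog i y -> dg_homog i (a *: x + y);
  dg_homog_span : forall x, exists (s : seq int) (c : int -> dg_sort),
    (forall i, dg_homog i (c i)) /\ x = \sum_(i <- s) c i;
  dg_homog_indep : forall (s : seq int) (c : int -> dg_sort),
    uniq s -> (forall i, dg_homog i (c i)) -> \sum_(i <- s) c i = 0 ->
    forall i, i \in s -> c i = 0;
  dg_homog_idem : forall v, dg_homog 0 (dg_idem v);
  dg_homogM : forall i j x y,
    dg_homog i x -> dg_homog j y -> dg_homog (i + j) (x * y);
  dg_diff_homog : forall i x, dg_homog i x -> dg_homog (i + 1) (dg_diff x);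
  dg_diffK : forall x, dg_diff (dg_diff x) = 0;
  dg_diff_idem : forall v, dg_diff (dg_idem v) = 0;
  dg_leibniz : forall i x y, dg_homog i x ->
    dg_diff (x * y) = dg_diff x * y + (-1) ^+ `|i|%N * (x * dg_diff y)
}.

Arguments dg_idem {K V d0} v : rename.
Arguments dg_homog {K V d0} i x : rename.
Arguments dg_diff {K V d0} : rename.

Section Quasi_isomorphisms.
Variables (K : fieldType) (V : finType).
Implicit Types A B C : dgAlg K V.

Definition dg_morphism A B (f : {lrmorphism A -> B}) : Prop :=
  [/\ forall v, f (dg_idem v) = dg_idem v,
      forall i x, dg_homog i x -> dg_homog i (f x)
    & forall x, f (dg_diff x) = dg_diff (f x)].

Definition dg_cocycle A (i : int) (x : A) : Prop :=
  dg_homog i x /\ dg_diff x = 0.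

Definition dg_coboundary A (i : int) (x : A) : Prop :=
  exists2 y : A, dg_homog (i - 1) y & x = dg_diff y.

(* f induces isomorphisms H^i(A) -> H^i(B) for all i *)
Definition quasi_iso A B (f : {lrmorphism A -> B}) : Prop :=
  [/\ dg_morphism f,
      forall i x, dg_cocycle i x -> dg_coboundary i (f x) -> dg_coboundary i x
    & forall i y, dg_cocycle i y ->
        exists2 x : A, dg_cocycle i x & dg_coboundary i (y - f x)].

(* Two DG-algebras are quasi-isomorphic when they are connected by a finite   *)
(* zigzag of quasi-isomorphisms.                                              *)
Inductive quasi_isomorphic A : dgAlg K V -> Prop :=
| quasi_isomorphic_refl : quasi_isomorphic A A
| quasi_isomorphic_fwd B C (f : {lrmorphism B -> C}) :
    quasi_isomorphic A B -> quasi_iso f -> quasi_isomorphic A C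
| quasi_isomorphic_bwd B C (f : {lrmorphism C -> B}) :
    quasi_isomorphic A B -> quasi_iso f -> quasi_isomorphic A C.

End Quasi_isomorphisms.

(* Graded quivers.  Nonemptiness makes the path algebra a nonzero ring, as    *)
(* required by [algType].                                                     *)
Record gquiver (V : finType) := GQuiver {
  arrow : finType;
  asrc : arrow -> V;
  atgt : arrow -> V;
  adeg : arrow -> int;
  gquiver_gt0 : (0 < #|V|)%N
}.

Section Paths.
Variables (V : finType) (Q : gquiver V).

(* The pair (v, [:: a_m; ...; a_1]) stands for the path a_m ... a_1 starting  *)
(* at v: words are read from right to left.                                   *)
Definition word_tgt (v : V) (s : seq (arrow Q)) : V :=
  if s is a :: _ then atgt a else v.

Fixpoint is_word (v : V) (s : seq (arrow Q)) : bool :=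
  if s is a :: s' then (asrc a == word_tgt v s') && is_word v s' else true.

Record qpath := QPath {
  qpath_val : V * seq (arrow Q);
  _ : is_word qpath_val.1 qpath_val.2
}.

HB.instance Definition _ := [isSub for qpath_val].
HB.instance Definition _ := [Choice of qpath by <:].

Definition psrc (p : qpath) : V := (val p).1.
Definition pword (p : qpath) : seq (arrow Q) := (val p).2.
Definition ptgt (p : qpath) : V := word_tgt (psrc p) (pword p).
Definition pdeg (p : qpath) : int := \sum_(a <- pword p) adeg a.

Lemma qpathP p : is_word (psrc p) (pword p).
Proof. by case: p. Qed.

Lemma is_word_cat v s t :
  is_word v t -> is_word (word_tgt v t) s -> is_word v (s ++ t).
Proof.
move=> vt; elim: s => //= a s IHs /andP[/eqP -> /IHs ->]; rewrite andbT.
by case: s {IHs}.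
Qed.

Lemma word_tgt_cat v s t : word_tgt v (s ++ t) = word_tgt (word_tgt v t) s.
Proof. by case: s. Qed.

End Paths.

Definition pathalg (K : fieldType) (V : finType) (Q : gquiver V) : Type :=
  {malg K[qpath Q]}.

HB.instance Definition _ (K : fieldType) (V : finType) (Q : gquiver V) :=
  GRing.Lmodule.on (pathalg K Q).

(* linear extension of a function defined on the basis of paths *)
HB.lock Definition lext (K : fieldType) (V : finType) (Q : gquiver V)
    (M : lmodType K) (h : qpath Q -> M) (x : pathalg K Q) : M :=
  \sum_(p <- msupp x) x@_p *: h p.

Section PathBasis.
Variables (K : fieldType) (V : finType) (Q : gquiver V).
Local Notation P := (qpath Q).
Local Notation A := (pathalg K Q).

Lemma lextw (M : lmodType K) (h : P -> M) (x : A) (d : {fset P}) :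
  (msupp x `<=` d)%fset -> lext h x = \sum_(p <- d) x@_p *: h p.
Proof.
move=> le; rewrite lext.unlock (big_fset_incl _ le) // => p _ /mcoeff_outdom ->.
by rewrite scale0r.
Qed.

Fact lext_linear (M : lmodType K) (h : P -> M) : linear (lext h).
Proof.
move=> a x y; pose d := (msupp x `|` msupp y)%fset.
have lx : (msupp x `<=` d)%fset by apply: fsubsetUl.
have ly : (msupp y `<=` d)%fset by apply: fsubsetUr.
have lxy : (msupp (a *: x + y : {malg K[P]}) `<=` d)%fset.
  apply: fsubset_trans (msuppD_le _ _) _.
  exact: fsetSU (msuppZ_le _ _).
rewrite (lextw h lx) (lextw h ly) (lextw h lxy) scaler_sumr -big_split /=.
by apply: eq_bigr => p _; rewrite mcoeffD mcoeffZ scalerDl scalerA.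
Qed.
HB.instance Definition _ (M : lmodType K) (h : P -> M) :=
  GRing.isLinear.Build K A M _ (lext h) (lext_linear h).

Definition pbase (p : P) : A := << p >>.

Lemma lextU (M : lmodType K) (h : P -> M) p : lext h (pbase p) = h p.
Proof.
rewrite (@lextw _ h _ [fset p]%fset) ?msuppU_le //.
by rewrite big_seq_fset1 mcoeffUU scale1r.
Qed.

Lemma pathalgE (x : A) : x = \sum_(p <- msupp x) x@_p *: pbase p.
Proof.
rewrite {1}[x]monalgE; apply: eq_bigr => p _.
apply/malgP => k; rewrite mcoeffZ /pbase !mcoeffU.
by case: eqP; rewrite ?mulr1 ?mulr0.
Qed.

Lemma pathalg_ext (M : lmodType K) (f g : {linear A -> M}) :
  (forall p, f (pbase p) = g (pbase p)) -> f =1 g.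
Proof.
move=> fg x; rewrite [x]pathalgE !linear_sum; apply: eq_bigr => p _.
by rewrite !linearZ /= fg.
Qed.

(* the word s, read as a path starting at v, and 0 if it is not a path *)
Definition wbase (v : V) (s : seq (arrow Q)) : A :=
  if insub (v, s) is Some p then pbase p else 0.

Lemma wbase_val p : wbase (psrc p) (pword p) = pbase p.
Proof. by rewrite /wbase /psrc /pword -surjective_pairing valK. Qed.

Lemma wbaseE v s (vs : is_word v s) : wbase v s = pbase (@QPath V Q (v, s) vs).
Proof. by rewrite /wbase insubT. Qed.

Lemma wbase0 v s : ~~ is_word v s -> wbase v s = 0.
Proof. by move=> vs; rewrite /wbase insubN. Qed.

Definition pmul (p q : P) : A :=
  if psrc p == ptgt q then wbase (psrc q) (pword p ++ pword q) else 0.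

End PathBasis.

(* bilinear extension of the concatenation of paths *)
HB.lock Definition pamul (K : fieldType) (V : finType) (Q : gquiver V)
    (x y : pathalg K Q) : pathalg K Q :=
  lext (fun p => lext (pmul K p) y) x.

HB.lock Definition paone (K : fieldType) (V : finType) (Q : gquiver V) :
    pathalg K Q := \sum_v wbase K v [::].

Section PathAlgebra.
Variables (K : fieldType) (V : finType) (Q : gquiver V).
Local Notation A := (pathalg K Q).
Local Notation wbase := (wbase K).
Local Notation paone := (paone K Q).
Local Notation pamul := (@pamul K V Q).

Definition parmul (y x : A) : A := pamul x y.

Fact pamul_linear x : linear (pamul x).
Proof.
move=> a y z; rewrite pamul.unlock !(lextw _ (fsubset_refl _)).
rewrite scaler_sumr -big_split.
by apply: eq_bigr => p _ /=; rewrite linearP scalerDr !scalerA mulrC.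
Qed.
HB.instance Definition _ x :=
  GRing.isLinear.Build K A A _ (pamul x) (pamul_linear x).

Fact parmul_linear y : linear (parmul y).
Proof. by move=> a x z; rewrite /parmul pamul.unlock linearP. Qed.
HB.instance Definition _ y :=
  GRing.isLinear.Build K A A _ (parmul y) (parmul_linear y).

Lemma pamulUU (p q : qpath Q) : pamul (pbase K p) (pbase K q) = pmul K p q.
Proof. by rewrite pamul.unlock !lextU. Qed.

Lemma pamul_word v (s : seq (arrow Q)) w (t : seq (arrow Q)) :
  is_word v s -> is_word w t ->
  pamul (wbase v s) (wbase w t) =
  if v == word_tgt w t then wbase w (s ++ t) else 0.
Proof. by move=> vs wt; rewrite (wbaseE K vs) (wbaseE K wt) pamulUU. Qed.

Lemma pamulA : associative pamul.
Proof.
move=> x y z.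
pose f1 : {linear A -> A} := parmul (pamul y z).
pose g1 : {linear A -> A} := (parmul z \o parmul y).
apply: (pathalg_ext (f := f1) (g := g1)) => p /= {x f1 g1}.
pose f2 : {linear A -> A} := (pamul (pbase K p) \o parmul z).
pose g2 : {linear A -> A} := (parmul z \o pamul (pbase K p)).
apply: (pathalg_ext (f := f2) (g := g2) _ y) => q /= {y f2 g2}.
pose f3 : {linear A -> A} := (pamul (pbase K p) \o pamul (pbase K q)).
pose g3 : {linear A -> A} := pamul (pamul (pbase K p) (pbase K q)).
apply: (pathalg_ext (f := f3) (g := g3) _ z) => r /= {z f3 g3}.
have L0 u : pamul 0 u = 0 by apply: (linear0 (parmul u)).
have R0 u : pamul u 0 = 0 by apply: linear0.
rewrite /parmul -(wbase_val K p) -(wbase_val K q) -(wbase_val K r).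
move: (qpathP p) (qpathP q) (qpathP r).
move: (psrc p) (pword p) (psrc q) (pword q) (psrc r) (pword r).
move=> {p q r} u s v t w r us vt wr.
rewrite (pamul_word vt wr) (pamul_word us vt).
case: eqP => [v_eq|/eqP v_ne]; case: eqP => [u_eq|/eqP u_ne].
- rewrite (pamul_word us) ?is_word_cat -?v_eq //.
  rewrite pamul_word ?is_word_cat -?u_eq // word_tgt_cat -v_eq -u_eq eqxx.
  by rewrite eqxx catA.
- rewrite (pamul_word us) ?is_word_cat -?v_eq // word_tgt_cat -v_eq.
  by rewrite (negPf u_ne) L0.
- by rewrite pamul_word ?is_word_cat -?u_eq // (negPf v_ne) R0.
- by rewrite L0 R0.
Qed.

Lemma pamul1 : left_id paone pamul.
Proof.
apply: (pathalg_ext (f := pamul paone) (g := idfun)) => p /=.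
rewrite -(wbase_val K p); move: (qpathP p).
move: (psrc p) (pword p) => {p} v s vs; rewrite -/(parmul _ _).
rewrite paone.unlock linear_sum (bigD1 (word_tgt v s)) //= /parmul.
rewrite pamul_word // eqxx big1 ?addr0 // => w /negPf w_ne.
by rewrite pamul_word // w_ne.
Qed.

Lemma pamulr1 : right_id paone pamul.
Proof.
apply: (pathalg_ext (f := parmul paone) (g := idfun)) => p /=.
rewrite /parmul -(wbase_val K p); move: (qpathP p).
move: (psrc p) (pword p) => {p} v s vs.
rewrite paone.unlock (linear_sum (pamul _)) (bigD1 v) //=.
rewrite pamul_word // eqxx cats0 big1 ?addr0 // => w w_ne.
by rewrite pamul_word //= eq_sym (negPf w_ne).
Qed.

Lemma pamulDl : left_distributive pamul +%R.
Proof. by move=> x y z; apply: (linearD (parmul z)). Qed.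
Lemma pamulDr : right_distributive pamul +%R.
Proof. by move=> x y z; apply: linearD. Qed.

Lemma paone_neq0 : paone != 0.
Proof.
have /card_gt0P[v _] := gquiver_gt0 Q.
apply/eqP => one0; have := pamul1 (wbase v [::]); rewrite one0.
rewrite -/(parmul _ _) linear0 wbaseE // => /malgP.
move/(_ (@QPath V Q (v, [::]) isT)).
by rewrite mcoeff0 mcoeffUU => /eqP; rewrite eq_sym oner_eq0.
Qed.

HB.instance Definition _ := GRing.Zmodule_isNzRing.Build A
  pamulA pamul1 pamulr1 pamulDl pamulDr paone_neq0.

Fact pascaleAl a (x y : A) : a *: (x * y) = a *: x * y.
Proof. exact: esym (linearZ_LR (parmul y) a x). Qed.
Fact pascaleAr a (x y : A) : a *: (x * y) = x * (a *: y).
Proof. exact: esym (linearZ_LR (pamul x) a y). Qed.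
HB.instance Definition _ := GRing.Lmodule_isLalgebra.Build K A pascaleAl.
HB.instance Definition _ := GRing.Lalgebra_isAlgebra.Build K A pascaleAr.

End PathAlgebra.

Lemma absz_signM (R : pzRingType) (i j : int) :
  (-1) ^+ absz (i + j) = (-1) ^+ `|i|%N * (-1) ^+ `|j|%N :> R.
Proof.
have sgE (k : int) : (-1) ^ k = (-1) ^+ `|k|%N :> rat.
  by case: k => // n; rewrite NegzE -exprnN invr_sign abszN.
have := @exprzDr rat (-1) isT i j; rewrite !sgE => h.
rewrite -exprD in h; rewrite -exprD -[LHS]signr_odd -[RHS]signr_odd.
congr (_ ^+ nat_of_bool _).
by move: h; rewrite -[LHS]signr_odd -[RHS]signr_odd; do 2!case: odd => // /eqP.
Qed.

Lemma sign_mulA (R : pzRingType) n (x y : R) :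
  x * ((-1) ^+ n * y) = (-1) ^+ n * (x * y).
Proof. by rewrite -signr_odd; case: odd; rewrite ?mulN1r ?mul1r ?mulrN. Qed.

Section QuasiFree.
Variables (K : fieldType) (V : finType) (Q : gquiver V).
Local Notation A := (pathalg K Q).
Implicit Types (v w : V) (s t : seq (arrow Q)) (a : arrow Q) (x y : A).

Definition pidem v : A := wbase K v [::].
Definition pgen a : A := wbase K (asrc a) [:: a].

(* x is a combination of paths of degree i *)
Definition pahomog (i : int) x : Prop :=
  forall p, p \in msupp x -> pdeg p = i.

Lemma wbaseM v s w t : is_word v s -> is_word w t ->
  wbase K v s * wbase K w t =
  if v == word_tgt w t then wbase K w (s ++ t) else 0.
Proof. exact: pamul_word. Qed.

Lemma wbase_cons v a s : is_word v (a :: s) ->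
  wbase K v (a :: s) = pgen a * wbase K v s.
Proof. by move=> /= /andP[/eqP e vs]; rewrite wbaseM //= e eqxx // eqxx. Qed.

Lemma pidemM v w : pidem v * pidem w = if v == w then pidem v else 0.
Proof. by rewrite wbaseM //=; case: eqP => // ->. Qed.

Lemma pidem_sum : \sum_v pidem v = 1.
Proof. by rewrite -[1]/(paone K Q) paone.unlock. Qed.

Lemma pidem_wbase v s : pidem (word_tgt v s) * wbase K v s = wbase K v s.
Proof.
have [vs|/wbase0->] := boolP (is_word v s); last by rewrite mulr0.
by rewrite wbaseM // eqxx.
Qed.

Lemma wbase_pidem v s : wbase K v s * pidem v = wbase K v s.
Proof.
have [vs|/wbase0->] := boolP (is_word v s); last by rewrite mul0r.
by rewrite wbaseM // eqxx cats0.
Qed.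

Lemma pathalg_ind (S : A -> Prop) :
  S 0 -> (forall c x y, S x -> S y -> S (c *: x + y)) ->
  (forall v s, is_word v s -> S (wbase K v s)) -> forall x, S x.
Proof.
move=> S0 SP Sw x; rewrite [x]pathalgE.
elim/big_rec: _ => // p y _ Sy; apply: SP => //.
by rewrite -wbase_val; apply/Sw/qpathP.
Qed.

Lemma pahomogP i x : pahomog i x <-> forall p, x@_p != 0 -> pdeg p = i.
Proof. by split=> h p; have := h p; rewrite mcoeff_neq0. Qed.

Lemma pahomog0 i : pahomog i 0.
Proof. by move=> p; rewrite msupp0. Qed.

Lemma pahomogL i c x y : pahomog i x -> pahomog i y -> pahomog i (c *: x + y).
Proof.
move=> /pahomogP hx /pahomogP hy; apply/pahomogP => p.
rewrite mcoeffD mcoeffZ; have [/eqP x0|/hx//] := boolP (x@_p == 0).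
by rewrite x0 mulr0 add0r => /hy.
Qed.

Lemma pahomogD i x y : pahomog i x -> pahomog i y -> pahomog i (x + y).
Proof. by move=> hx hy; rewrite -[x]scale1r; apply: pahomogL. Qed.

Lemma pahomogZ i c x : pahomog i x -> pahomog i (c *: x).
Proof. by move=> hx; rewrite -[_ *: _]addr0; apply/pahomogL/pahomog0. Qed.

Lemma pahomogN i x : pahomog i x -> pahomog i (- x).
Proof. by move=> hx; rewrite -scaleN1r; apply: pahomogZ. Qed.

Lemma pahomog_sign i n x : pahomog i x -> pahomog i ((-1) ^+ n * x).
Proof.
by rewrite -signr_odd; case: odd; rewrite ?mulN1r ?mul1r //; apply: pahomogN.
Qed.

Lemma pahomog_sum (I : Type) (r : seq I) (P : pred I) (F : I -> A) i :
  (forall j, P j -> pahomog i (F j)) -> pahomog i (\sum_(j <- r | P j) F j).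
Proof. exact: (big_ind _ (pahomog0 i) (@pahomogD i)). Qed.

Lemma pahomog_wbase v s : pahomog (\sum_(a <- s) adeg a) (wbase K v s).
Proof.
have [vs|/wbase0->] := boolP (is_word v s); last exact: pahomog0.
move=> p; rewrite (wbaseE K vs) => /(fsubsetP msuppU_le).
by rewrite inE => /eqP ->.
Qed.

Lemma pahomog_span x : exists (r : seq int) (c : int -> A),
  (forall i, pahomog i (c i)) /\ x = \sum_(i <- r) c i.
Proof.
exists (undup [seq pdeg p | p <- msupp x]).
exists (fun i => \sum_(p <- msupp x | pdeg p == i) x@_p *: pbase K p); split.
  move=> i; apply: pahomog_sum => p /eqP <-; apply: pahomogZ.
  by rewrite -wbase_val; apply: pahomog_wbase.
rewrite (exchange_big_dep predT) //= {1}[x]pathalgE.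
apply: eq_big_seq => p px; rewrite -big_filter.
rewrite (_ : [seq _ <- _ | _] = [:: pdeg p]) ?big_seq1 //.
apply: perm_small_eq => //; apply: uniq_perm => //.
  by rewrite filter_uniq ?undup_uniq.
move=> i; rewrite mem_filter mem_undup mem_seq1.
apply/andP/(@eqP int) => [[/(@eqP int)->]|->] //.
by split; [apply: eqxx | apply: map_f].
Qed.

Lemma pahomog_indep (r : seq int) (c : int -> A) :
  uniq r -> (forall i, pahomog i (c i)) -> \sum_(i <- r) c i = 0 ->
  forall i, i \in r -> c i = 0.
Proof.
move=> ur hc c0 i ir; apply/malgP => p; rewrite mcoeff0.
have hc' j : (c j)@_p != 0 -> pdeg p = j by have /pahomogP/(_ p) := hc j.
have [->//|/hc' pi] := eqVneq (c i)@_p 0.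
move/malgP/(_ p): c0; rewrite mcoeff0 raddf_sum (bigD1_seq i) //=.
rewrite big1 ?addr0 //.
move=> j ji; have [//|/hc' pj] := eqVneq (c j)@_p 0.
by rewrite -pj pi eqxx in ji.
Qed.

Lemma pahomogM i j x y : pahomog i x -> pahomog j y -> pahomog (i + j) (x * y).
Proof.
move=> hx hy; rewrite [x]pathalgE [y]pathalgE mulr_suml.
rewrite big_seq; apply: pahomog_sum => p /hx pi.
rewrite mulr_sumr big_seq; apply: pahomog_sum => q /hy qj.
rewrite -scalerAl -scalerAr; apply: pahomogZ; apply: pahomogZ.
rewrite -!wbase_val wbaseM ?qpathP //; case: ifP => _; last exact: pahomog0.
by rewrite -pi -qj -big_cat /=; apply: pahomog_wbase.
Qed.

Lemma pahomog_pidem v : pahomog 0 (pidem v).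
Proof. by have := @pahomog_wbase v [::]; rewrite big_nil. Qed.

Lemma pahomog_pgen a : pahomog (adeg a) (pgen a).
Proof. by have := @pahomog_wbase (asrc a) [:: a]; rewrite big_seq1. Qed.

(* The differential extending delta : arrow Q -> A by the Leibniz rule. *)
Variable delta : arrow Q -> A.

Fixpoint dword v s : A :=
  if s is a :: s' then
    delta a * wbase K v s' + (-1) ^+ `|adeg a|%N * (pgen a * dword v s')
  else 0.

Definition qfree_diff : A -> A := lext (fun p => dword (psrc p) (pword p)).
HB.instance Definition _ := GRing.Linear.on qfree_diff.
Local Notation D := qfree_diff.

Lemma qfree_diff_word v s : is_word v s -> D (wbase K v s) = dword v s.
Proof. by move=> vs; rewrite (wbaseE K vs) /D lextU. Qed.

Lemma qfree_diff_pidem v : D (pidem v) = 0.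
Proof. by rewrite qfree_diff_word. Qed.

(* Conditions under which this defines a DG-algebra over k. *)
Definition delta_bimod : Prop :=
  forall a, pidem (atgt a) * delta a * pidem (asrc a) = delta a.
Definition delta_deg : Prop := forall a, pahomog (adeg a + 1) (delta a).
Definition delta_square : Prop := forall a, D (delta a) = 0.

Hypothesis deltaE : delta_bimod.

Lemma qfree_diff_pgen a : D (pgen a) = delta a.
Proof.
rewrite qfree_diff_word /= ?eqxx // mulr0 mulr0 addr0 -[in LHS]deltaE.
by rewrite -mulrA pidemM eqxx deltaE.
Qed.

Lemma delta_l a : pidem (atgt a) * delta a = delta a.
Proof. by rewrite -deltaE !mulrA pidemM eqxx. Qed.

Lemma dword_l v s : pidem (word_tgt v s) * dword v s = dword v s.
Proof.
case: s => [|a s] /=; first by rewrite mulr0.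
have gen_l : pidem (atgt a) * pgen a = pgen a.
  exact: (pidem_wbase (asrc a) [:: a]).
rewrite mulrDr sign_mulA (mulrA _ (delta a)) delta_l.
by rewrite (mulrA _ (pgen a)) gen_l.
Qed.

Lemma dword_r v s : dword v s * pidem v = dword v s.
Proof.
elim: s => [|a s IHs] /=; first by rewrite mul0r.
by rewrite mulrDl -!mulrA wbase_pidem IHs.
Qed.

Lemma dword_cat v s t : is_word v t -> is_word (word_tgt v t) s ->
  dword v (s ++ t) = dword (word_tgt v t) s * wbase K v t +
    (-1) ^+ absz (\sum_(a <- s) adeg a) *
      (wbase K (word_tgt v t) s * dword v t).
Proof.
move=> vt; elim: s => [|a s IHs] /=.
  by move=> _; rewrite big_nil expr0 mul1r mul0r add0r dword_l.
move=> /andP[/eqP src_a us]; rewrite IHs // big_cons absz_signM.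
rewrite wbase_cons /= ?src_a ?eqxx // mulrDl -[RHS]addrA -!mulrA.
rewrite wbaseM // eqxx; congr (_ + _).
by rewrite mulrDr mulrDr sign_mulA.
Qed.

Lemma qfree_leibniz i x y : pahomog i x ->
  D (x * y) = D x * y + (-1) ^+ `|i|%N * (x * D y).
Proof.
move=> hx; rewrite [x]pathalgE mulr_suml !linear_sum mulr_suml.
rewrite [in RHS]mulr_suml mulr_sumr -big_split /=; apply: eq_big_seq => p /hx <-.
rewrite -!scalerAl -scalerAr !linearZ_LR -scalerAl -scalerDr; congr (_ *: _).
rewrite /pdeg -wbase_val; move: (qpathP p); move: (psrc p) (pword p) => u s us.
elim/pathalg_ind: y => [|c y z IHy IHz|v t vt].
- by rewrite !(linear0, mulr0) addr0.
- rewrite mulrDr -scalerAr !linearP /= IHy IHz !mulrDr -!scalerAr scalerDr.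
  by rewrite addrACA.
rewrite wbaseM //= !qfree_diff_word //; case: eqP => [u_eq|/eqP u_ne].
  by rewrite qfree_diff_word ?is_word_cat -?u_eq // dword_cat -?u_eq.
rewrite linear0 -dword_r -(dword_l v t) -!mulrA -(pidem_wbase v t).
rewrite [pidem u * _]mulrA pidemM (negPf u_ne) mul0r mulr0 add0r.
rewrite -wbase_pidem -mulrA [pidem u * _]mulrA pidemM (negPf u_ne).
by rewrite mul0r !mulr0.
Qed.

Lemma qfree_diff_mul0 x y :
  pahomog 0 x -> D x = 0 -> D y = 0 -> D (x * y) = 0.
Proof.
by move=> hx dx dy; rewrite (qfree_leibniz _ hx) dx dy mul0r !mulr0 addr0.
Qed.

Hypothesis delta_hom : delta_deg.

Lemma pahomog_dword v s : pahomog (\sum_(a <- s) adeg a + 1) (dword v s).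
Proof.
elim: s => [|a s IHs]; first exact: pahomog0.
rewrite big_cons /=; apply: pahomogD.
  by rewrite addrAC; apply/pahomogM/pahomog_wbase/delta_hom.
by rewrite -addrA; apply/pahomog_sign/pahomogM/IHs/pahomog_pgen.
Qed.

Lemma qfree_diff_homog i x : pahomog i x -> pahomog (i + 1) (D x).
Proof.
move=> hx; rewrite [x]pathalgE linear_sum big_seq; apply: pahomog_sum => p px.
rewrite linearZ_LR; apply: pahomogZ.
rewrite -wbase_val /= qfree_diff_word ?qpathP //.
by rewrite -(hx p px); apply: pahomog_dword.
Qed.

Hypothesis delta_sq : delta_square.

Lemma qfree_diffK x : D (D x) = 0.
Proof.
elim/pathalg_ind: x => [|c x y Dx Dy|v s vs]; first by rewrite !linear0.
  by rewrite !linearP /= Dx Dy scaler0 addr0.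
rewrite qfree_diff_word //; elim: s vs => [|a s IHs]; first by rewrite linear0.
move=> /andP[_ vs]; rewrite /= linearD /= (qfree_leibniz _ (@delta_hom a)).
rewrite delta_sq mul0r add0r qfree_diff_word //.
have sgn z : D ((-1) ^+ `|adeg a|%N * z) = (-1) ^+ `|adeg a|%N * D z.
  by rewrite -signr_odd; case: odd; rewrite ?mulN1r ?mul1r ?linearN.
rewrite sgn (qfree_leibniz _ (@pahomog_pgen a)) qfree_diff_pgen IHs // !mulr0.
by rewrite addr0 absz_signM mulrN1 mulNr addNr.
Qed.

(* The path algebra of Q with the k-linear derivation sending a to delta a. *)
Definition qfree : dgAlg K V :=
  DGAlg pidemM pidem_sum pahomog0 pahomogL pahomog_span pahomog_indep
    pahomog_pidem pahomogM qfree_diff_homog qfree_diffK qfree_diff_pidem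
    qfree_leibniz.

End QuasiFree.

Section RootedTree.
Variables (V : finType) (adj : rel V) (r : V).

(* In a tree with root r, the edge between v and w is oriented from v to w    *)
(* exactly when v is still connected to r after the removal of w.             *)
Definition away (v w : V) : bool :=
  adj v w && connect [rel x y | [&& adj x y, x != w & y != w]] r v.

(* The element (v, w) of Gamma_1 is the arrow g_wv from v to w. *)
Definition tree_arrow : finType := {p : V * V | away p.1 p.2}.

(* For each v, lt v is a strict linear order on the children of v. *)
Definition child_order (lt : V -> rel V) : Prop :=
  forall v, [/\ {in away v, irreflexive (lt v)},
                {in away v & &, transitive (lt v)}
              & {in away v &, forall w w', w != w' -> lt v w w' || lt v w' w}].

Fact root_gt0 : (0 < #|V|)%N.
Proof. by apply/card_gt0P; exists r. Qed.

Section Ginzburg.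
Variable K : fieldType.

(* inl (inl g), inl (inr g) and inr v stand for g, g^* and h_v *)
Definition ginz_arrow : finType := (tree_arrow + tree_arrow + V)%type.

Definition ginz_src (a : ginz_arrow) : V :=
  match a with
  | inl (inl g) => (val g).1
  | inl (inr g) => (val g).2
  | inr v => v
  end.

Definition ginz_tgt (a : ginz_arrow) : V :=
  match a with
  | inl (inl g) => (val g).2
  | inl (inr g) => (val g).1
  | inr v => v
  end.

(* (path length, internal degree); the DG-degree is the sum of the two *)
Definition ginz_bideg (a : ginz_arrow) : int * int :=
  match a with
  | inl _ => (1, -1)
  | inr _ => (1, -2)
  end.

Definition ginz_quiver : gquiver V :=
  GQuiver ginz_src ginz_tgt
    (fun a => (ginz_bideg a).1 + (ginz_bideg a).2) root_gt0.

Local Notation A := (pathalg K ginz_quiver).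

Definition ginz_g (g : tree_arrow) : A := @pgen K V ginz_quiver (inl (inl g)).
Definition ginz_g' (g : tree_arrow) : A := @pgen K V ginz_quiver (inl (inr g)).

(* the differential of h = \sum_v h_v *)
Definition ginz_dh : A :=
  \sum_(g : tree_arrow) (ginz_g' g * ginz_g g - ginz_g g * ginz_g' g).

(* d is k-bilinear and h_v = e_v h e_v *)
Definition ginz_delta (a : arrow ginz_quiver) : A :=
  match a : ginz_arrow with
  | inl _ => 0
  | inr v => pidem K ginz_quiver v * ginz_dh * pidem K ginz_quiver v
  end.

Lemma ginz_delta_bimod : delta_bimod ginz_delta.
Proof.
case=> [a|v]; first by rewrite mulr0 mul0r.
by rewrite /= !mulrA pidemM eqxx -mulrA pidemM eqxx.
Qed.

Lemma ginz_dh_homog : pahomog 0 ginz_dh.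
Proof.
have hM (x y : A) : pahomog 0 x -> pahomog 0 y -> pahomog 0 (x * y).
  by move=> hx hy; rewrite -[0]addr0; apply: pahomogM.
have hg g : pahomog 0 (ginz_g g) by apply: (@pahomog_pgen K V ginz_quiver).
have hg' g : pahomog 0 (ginz_g' g) by apply: (@pahomog_pgen K V ginz_quiver).
by apply: pahomog_sum => g _; apply/pahomogD/pahomogN; apply: hM.
Qed.

Lemma ginz_delta_deg : delta_deg ginz_delta.
Proof.
case=> [a|v]; first exact: pahomog0.
rewrite -[X in pahomog X]/(0 + 0 + 0 : int).
by apply/pahomogM/pahomog_pidem/pahomogM/ginz_dh_homog/pahomog_pidem.
Qed.

Lemma ginz_delta_square : delta_square ginz_delta.
Proof.
case=> [a|v]; first exact: linear0.
have dE := ginz_delta_bimod.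
have hg g : pahomog 0 (ginz_g g) by apply: (@pahomog_pgen K V ginz_quiver).
have hg' g : pahomog 0 (ginz_g' g) by apply: (@pahomog_pgen K V ginz_quiver).
have dg g : qfree_diff ginz_delta (ginz_g g) = 0 by apply: qfree_diff_pgen.
have dg' g : qfree_diff ginz_delta (ginz_g' g) = 0 by apply: qfree_diff_pgen.
have he := @pahomog_pidem K V ginz_quiver v.
have de := qfree_diff_pidem ginz_delta v.
apply: qfree_diff_mul0 => //.
  by rewrite -[0]/(0 + 0 : int); apply/pahomogM/ginz_dh_homog/he.
apply: qfree_diff_mul0 => //; rewrite linear_sum big1 // => g _.
by rewrite linearB /= !qfree_diff_mul0 // subr0.
Qed.

Definition Ginzburg : dgAlg K V :=
  qfree ginz_delta_bimod ginz_delta_deg ginz_delta_square.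

End Ginzburg.

Section LCA.
Variables (K : fieldType) (lt : V -> rel V).

(* inl v stands for c_v and inr (w, v) for c_wv = e_w c_wv e_v *)
Definition lca_arrow : finType := (V + {p : V * V | adj p.1 p.2})%type.

Definition lca_src (a : lca_arrow) : V :=
  match a with inl v => v | inr p => (val p).2 end.

Definition lca_tgt (a : lca_arrow) : V :=
  match a with inl v => v | inr p => (val p).1 end.

Definition lca_deg (a : lca_arrow) : int :=
  match a with inl _ => -1 | inr _ => 0 end.

Definition lca_quiver : gquiver V :=
  GQuiver lca_src lca_tgt lca_deg root_gt0.

Local Notation A := (pathalg K lca_quiver).

(* c_wv, or 0 if w and v are not adjacent *)
Definition lca_c (w v : V) : A :=
  if insub (w, v) is Some p then @pgen K V lca_quiver (inr p) else 0.

(* A sequence w_1 < ... < w_i of children of v has length i <= #|V|. *)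
Definition lca_D (v : V) : A :=
  - \sum_(u | away u v) lca_c v u * lca_c u v +
  \sum_(1 <= i < #|V|.+1)
    \sum_(w : i.-tuple V | sorted (lt v) w && all (away v) w)
      \prod_(x <- w) (lca_c v x * lca_c x v).

Definition lca_delta (a : arrow lca_quiver) : A :=
  match a : lca_arrow with inl v => lca_D v | inr _ => 0 end.

Local Notation e v := (pidem K lca_quiver v).

Lemma lca_c_l w v : e w * lca_c w v = lca_c w v.
Proof.
rewrite /lca_c; case: insubP => [p _ pE|_]; last by rewrite mulr0.
have -> : w = (val p).1 by rewrite pE.
exact: (@pidem_wbase K V lca_quiver (val p).2 [:: inr p]).
Qed.

Lemma lca_c_r w v : lca_c w v * e v = lca_c w v.
Proof.
rewrite /lca_c; case: insubP => [p _ pE|_]; last by rewrite mul0r.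
have -> : v = (val p).2 by rewrite pE.
exact: (@wbase_pidem K V lca_quiver (val p).2 [:: inr p]).
Qed.

Lemma lca_prod_lr v (w : seq V) : (0 < size w)%N ->
  e v * (\prod_(x <- w) (lca_c v x * lca_c x v)) * e v =
  \prod_(x <- w) (lca_c v x * lca_c x v).
Proof.
case: w => // x w _; rewrite big_cons !mulrA lca_c_l.
elim: w x => [|y w IHw] x; first by rewrite big_nil mulr1 -mulrA lca_c_r.
by rewrite big_cons -!mulrA; congr (_ * (_ * _)); rewrite !mulrA IHw.
Qed.

Lemma lca_delta_bimod : delta_bimod lca_delta.
Proof.
case=> [v|p] /=; last by rewrite mulr0 mul0r.
rewrite /lca_D mulrDr mulrDl mulrN mulNr; congr (- _ + _).
  rewrite mulr_sumr mulr_suml; apply: eq_bigr => u _.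
  by rewrite mulrA lca_c_l -mulrA lca_c_r.
rewrite mulr_sumr mulr_suml; apply: eq_big_nat => i /andP[i_gt0 _].
rewrite mulr_sumr mulr_suml; apply: eq_bigr => w _.
by rewrite lca_prod_lr // size_tuple.
Qed.

Lemma lca_c_homog w v : pahomog 0 (lca_c w v).
Proof.
rewrite /lca_c; case: insubP => [p _ _|_]; last exact: pahomog0.
exact: (@pahomog_pgen K V lca_quiver).
Qed.

Lemma lca_cc_homog w v : pahomog 0 (lca_c w v * lca_c v w).
Proof. by rewrite -[0]/(0 + 0 : int); apply: pahomogM; apply: lca_c_homog. Qed.

Lemma lca_prod_homog v (w : seq V) :
  pahomog 0 (\prod_(x <- w) (lca_c v x * lca_c x v)).
Proof.
elim: w => [|x w IHw].
  rewrite big_nil -(pidem_sum K lca_quiver).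
  by apply: pahomog_sum => u _; apply: pahomog_pidem.
rewrite big_cons -[0]/(0 + 0 : int).
by apply/pahomogM/IHw/lca_cc_homog.
Qed.

Lemma lca_delta_deg : delta_deg lca_delta.
Proof.
case=> [v|p]; last exact: pahomog0.
apply: pahomogD; first apply: pahomogN; apply: pahomog_sum => i _.
  exact: lca_cc_homog.
by apply: pahomog_sum => w _; apply: lca_prod_homog.
Qed.

Lemma lca_c_closed w v : qfree_diff lca_delta (lca_c w v) = 0.
Proof.
rewrite /lca_c; case: insubP => [p _ _|_]; last exact: linear0.
by rewrite qfree_diff_pgen //; apply: lca_delta_bimod.
Qed.

Lemma lca_cc_closed w v : qfree_diff lca_delta (lca_c w v * lca_c v w) = 0.
Proof.
by apply: qfree_diff_mul0; rewrite ?lca_c_closed //;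
  [apply: lca_delta_bimod | apply: lca_c_homog].
Qed.

Lemma lca_delta_square : delta_square lca_delta.
Proof.
case=> [v|p]; last exact: linear0.
rewrite linearD linearN !linear_sum !big1 ?oppr0 ?addr0 // => i _.
  rewrite linear_sum big1 // => w _.
  elim: {w}(val w) => [|x w IHw].
    rewrite big_nil -(pidem_sum K lca_quiver) linear_sum big1 // => u _.
    exact: qfree_diff_pidem.
  rewrite big_cons; apply: qfree_diff_mul0 IHw; first exact: lca_delta_bimod.
    exact: lca_cc_homog.
  exact: lca_cc_closed.
by rewrite /= lca_cc_closed oppr0.
Qed.

Definition LCA : dgAlg K V :=
  qfree lca_delta_bimod lca_delta_deg lca_delta_square.

End LCA.

End RootedTree.

(* The Dynkin graphs on {0, ..., n-1}: A_n is the path 0 - 1 - ... - (n-1),   *)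
(* and D_n is the path 0 - ... - (n-2) with n-1 attached to n-3.              *)
Definition Dynkin_A (n : nat) : rel 'I_n :=
  fun i j => ((i.+1 == j :> nat) || (j.+1 == i :> nat))%N.

Definition Dynkin_D (n : nat) : rel 'I_n :=
  let edge (i j : 'I_n) :=
    (((i.+1 == j :> nat) && (j.+1 < n))
     || ((i.+2 == j :> nat) && (j.+1 == n)))%N in
  fun i j => edge i j || edge j i.

Arguments Dynkin_A : clear implicits.
Arguments Dynkin_D : clear implicits.

(* Main.v *)
From HB Require Import structures.
From Stdlib Require Import Ncring Ncring_tac.
Require Import Defs.
From mathcomp Require Import all_boot all_order all_algebra.
From mathcomp Require Import zify finmap boolp generic_quotient.
From mathcomp.multinomials Require Import monalg.
Set Implicit Arguments.
Unset Strict Implicit.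
Unset Printing Implicit Defensive.
Import GRing.Theory Num.Theory Order.Theory.
Local Open Scope ring_scope.

(** In both DG-algebras the generators have degrees 0 and -1, so H^0 is the
algebra generated by the arrows of degree 0, one in each direction along every
edge, modulo one relation per vertex v, the coboundary of the generator of
degree -1 at v.  Write l_w for the closed path v -> w -> v.  In the Ginzburg
algebra the relation says that the sum of the l_w over the children w of v is
l_u for the parent u (0 if v is the root).  In LCA the sum is replaced by the
circle product x o y = x + y + xy over the ordered children: the product of
the 1 + l_w is 1 + l_u.  A Boolean q switches between the two laws, so that
[circ q], [bigcirc q] and the vertex relation [vrel q] treat both at once.

The quasi-isomorphism rests on three facts.  First, in types A and D the
relations force the arrows to generate a nilpotent ideal ([A_nil], [D_nil]):
along an arm each closed path is controlled by the preceding one, and at the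
trivalent vertex there are closed paths a, b, c with a^2 = b^2 = 0, c nilpotent
and a o b o c = 0, which suffices ([tri_nil]).  Hence all long paths of degree
0 are coboundaries, and then all cocycles made of long paths are coboundaries
([acyclic_deep]).  Secondly, H^0 of the Ginzburg algebra contains elements that
agree with the arrows up to products of two arrows and satisfy the relations of
LCA ([typeA_deform], [typeD_deform]).  In type A the substitution l/(1 - l) on
one side of the root is enough; at a trivalent vertex one uses that Cayley
transforms turn sums into products ([cayley_triple]), which requires 1/2.
Thirdly, lifting these elements yields a DG-morphism from LCA to the Ginzburg
algebra that maps each generator to its counterpart plus longer paths
([lca_ginz_quasi_iso]).  Such a map is bijective modulo arbitrarily long paths,
and these are cohomologically negligible, so it is a quasi-isomorphism
([f_inj_coh], [f_surj_coh]).

In characteristic 2 and type D a zigzag of quasi-isomorphisms would give an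
isomorphism between the two H^0 compatible with the idempotents
([quasi_isomorphic_corr]), hence elements X w v of the Ginzburg algebra that
satisfy the LCA relations and have nonzero coefficients along the arrows
([corr_deform]).  But there the Ginzburg H^0 carries a linear form [tr] with
tr (x y) = tr (y x), which counts the closed paths of length 4 around the
trivalent vertex t that visit two distinct neighbours of t.  The relations at
the neighbours show that [tr] kills each closed path X t w * X w t, and the
quadratic part of the relation at t shows that these closed paths have the same
leading coefficient p.  Applied to the relation at t, the form returns p^2 for
each pair of children of t; as t has two or three children, the number of pairs
is odd, and p = 0 follows, a contradiction ([obstruction]). *)

(** * The circle operation and nilpotency *)

Section NonCommutativeRing.
Variable H : pzRingType.

(** Makes [non_commutative_ring] applicable to every [pzRingType]. *)
#[export] Instance pzRing_ops :
  @Ring_ops H 0 1 +%R *%R (fun x y => x - y) -%R (@eq H) := {}.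

#[export] Instance pzRing_ncring : Ring (Ro := pzRing_ops).
Proof.
constructor; try exact _.
- exact: add0r.
- exact: addrC.
- exact: addrA.
- exact: mul1r.
- exact: mulr1.
- exact: mulrA.
- by move=> x y z; apply: mulrDl.
- by move=> x y z; apply: mulrDr.
- by [].
- exact: subrr.
Qed.
End NonCommutativeRing.

Ltac ncring := non_commutative_ring.

Section Circle.
Variables (H : pzRingType) (q : bool).
Implicit Types (x y z : H) (S l : seq H).

(** For q = true this is the multiplication of the 1 + x, transported to x; for
q = false it is the addition. *)
Definition circ x y : H := x + y + x * y *+ q.

Lemma circA : associative circ.
Proof. by rewrite /circ; case: q => x y z /=; rewrite ?mulr0n ?mulr1n; ncring. Qed.
Lemma circ0r : left_id 0 circ.
Proof. by move=> x; rewrite /circ mul0r mul0rn add0r addr0. Qed.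
Lemma circr0 : right_id 0 circ.
Proof. by move=> x; rewrite /circ mulr0 mul0rn !addr0. Qed.

Definition nilelt x : Prop := exists n, x ^+ n = 0.

(** Factors may be repeated: this is the nilpotency of the nonunital ring
generated by S, see [nil_aug]. *)
Definition nilS S : Prop :=
  exists N, forall l, size l = N -> {subset l <= S} -> \prod_(x <- l) x = 0.

(** The nonunital subring generated by S. *)
Inductive aug S : H -> Prop :=
| aug_gen x : x \in S -> aug S x
| aug0 : aug S 0
| augD x y : aug S x -> aug S y -> aug S (x + y)
| augN x : aug S x -> aug S (- x)
| augM x y : aug S x -> aug S y -> aug S (x * y).

Lemma aug_sum S (I : Type) (r : seq I) (P : pred I) (F : I -> H) :
  (forall i, P i -> aug S (F i)) -> aug S (\sum_(i <- r | P i) F i).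
Proof. exact: (big_ind _ (aug0 S) (@augD S)). Qed.

Lemma augX S x n : aug S x -> aug S (x ^+ n.+1).
Proof. by move=> Sx; elim: n => // n IHn; rewrite exprS; apply: augM. Qed.

Lemma augMn S x n : aug S x -> aug S (x *+ n).
Proof.
move=> Sx; elim: n => [|n IHn]; first by rewrite mulr0n; apply: aug0.
by rewrite mulrS; apply: augD.
Qed.

Lemma aug_circ S x y : aug S x -> aug S y -> aug S (circ x y).
Proof. by move=> Sx Sy; apply/augD/augMn/augM => //; apply: augD. Qed.

Lemma aug_trans S T x : (forall y, y \in S -> aug T y) -> aug S x -> aug T x.
Proof.
move=> ST; elim=> {x} [x /ST//||x y _ Tx _ Ty|x _ Tx|x y _ Tx _ Ty].
- exact: aug0.
- exact: augD.
- exact: augN.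
- exact: augM.
Qed.

(** A product of elements of [aug S] is expanded from the right.  Below, [Z k y]
says that y is killed on the left by all products of k elements of S; each new
factor from [aug S] lowers k by one. *)
Lemma nil_aug S T : nilS S -> (forall x, x \in T -> aug S x) -> nilS T.
Proof.
case=> N nS TS; exists N => l sl lT.
pose Z k y := forall m, size m = k -> {subset m <= S} -> (\prod_(s <- m) s) * y = 0.
have Zmono k y : Z k y -> Z k.+1 y.
  move=> Zy [|s m]//= [sm] mS; rewrite big_cons -mulrA Zy ?mulr0 //.
  by move=> u um; apply: mS; rewrite inE um orbT.
have Zaug k x y : aug S x -> Z k.+1 y -> Z k (x * y).
  move=> Sx; elim: Sx k y => {x}.
  - move=> x Sx k y Zy m sm mS; rewrite mulrA.
    have := Zy (rcons m x); rewrite -cats1 big_cat big_seq1 => -> //.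
      by rewrite size_cat sm addn1.
    by move=> u; rewrite mem_cat inE => /orP[/mS|/eqP->].
  - by move=> k y _ m _ _; rewrite mul0r mulr0.
  - move=> x x' _ Zx _ Zx' k y Zy m sm mS.
    have h1 := Zx k y Zy m sm mS; have h2 := Zx' k y Zy m sm mS.
    by rewrite mulrDl mulrDr h1 h2 addr0.
  - by move=> x _ Zx k y Zy m sm mS; have h1 := Zx k y Zy m sm mS; rewrite mulNr mulrN h1 oppr0.
  - move=> x x' _ Zx _ Zx' k y Zy; rewrite -mulrA; apply: Zx.
    by apply/Zmono/Zx'.
have Z1 : Z N 1 by move=> m sm mS; rewrite nS ?mul0r.
suff: forall k, (k <= N)%N -> forall l', size l' = k -> {subset l' <= T} ->
    Z (N - k)%N (\prod_(x <- l') x).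
  move/(_ N (leqnn N) l sl lT); rewrite subnn => /(_ [::] erefl).
  by rewrite big_nil mul1r; apply.
elim=> [_ [|//] _ _|k IHk kN [//|x l'] [sl'] l'T].
  by rewrite big_nil subn0.
rewrite big_cons; apply: (Zaug (N - k.+1)%N); first by apply/TS/l'T/mem_head.
rewrite subnSK //; apply: IHk => //; first exact: ltnW.
by move=> u ul; apply: l'T; rewrite inE ul orbT.
Qed.

Lemma nilS_nilelt S x : nilS S -> aug S x -> nilelt x.
Proof.
move=> nS Sx; have [N nx] : nilS [:: x].
  by apply: nil_aug nS _ => y; rewrite inE => /eqP->.
exists N; have := nx (nseq N x); rewrite size_nseq big_nseq iter_mulr_1; apply=> //.
by move=> y /nseqP[-> _]; apply: mem_head.
Qed.

Lemma nilelt_nil x : nilelt x -> nilS [:: x].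
Proof.
case=> N xN; exists N => l sl lx.
have -> : l = nseq N x.
  by rewrite -sl; apply/all_pred1P/allP => y /lx; rewrite inE.
by rewrite big_nseq iter_mulr_1.
Qed.

Lemma nilelt_aug x y : nilelt x -> aug [:: x] y -> nilelt y.
Proof. by move=> /nilelt_nil; apply: nilS_nilelt. Qed.

Lemma nileltN x : nilelt x -> nilelt (- x).
Proof. by move/nilelt_aug; apply; apply/augN/aug_gen/mem_head. Qed.

Lemma nilelt_geom x n : x ^+ n = 0 ->
  (1 - x) * (\sum_(i < n) x ^+ i) = 1 /\ (\sum_(i < n) x ^+ i) * (1 - x) = 1.
Proof.
move=> xn; have e : (1 - x) * (\sum_(i < n) x ^+ i) = 1.
  by rewrite -opprB mulNr -subrX1 xn sub0r opprK.
split=> //; rewrite -[RHS]e mulr_suml mulr_sumr; apply: eq_bigr => i _.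
by rewrite mulrBl mulrBr mul1r mulr1 -exprS -exprSr.
Qed.

(** For q = true: 1 + x is a unit, and the geometric series for its inverse is
1 plus an element of the nonunital ring generated by x. *)
Lemma circ_inv x : nilelt x ->
  exists y, [/\ circ x y = 0, circ y x = 0 & aug [:: x] y].
Proof.
have ax : aug [:: x] x by apply/aug_gen/mem_head.
case=> n xn; case q_eq: q; last first.
  exists (- x); rewrite /circ q_eq !mulr0n !addr0 subrr addNr.
  by split=> //; apply: augN.
pose G := \sum_(i < n) (- x) ^+ i.
have [e1 e2] : (1 - - x) * G = 1 /\ G * (1 - - x) = 1.
  by apply: nilelt_geom; rewrite exprNn xn mulr0.
have GE : G = 1 + (- x * G).
  by rewrite -[X in X + _]e1; ncring.
exists (- x * G); rewrite /circ q_eq !mulr1n; split.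
- transitivity ((1 - - x) * (1 + (- x * G)) - 1); first by ncring.
  by rewrite -GE e1 subrr.
- transitivity ((1 + (- x * G)) * (1 - - x) - 1); first by ncring.
  by rewrite -GE e2 subrr.
rewrite mulr_sumr; apply: aug_sum => i _; rewrite -exprS.
by apply/augX/augN.
Qed.

Lemma circ_inv_uniq x y z : circ x y = 0 -> circ y z = 0 -> x = z.
Proof. by move=> xy yz; rewrite -[LHS]circr0 -yz circA xy circ0r. Qed.

Lemma circ_nil x y : nilelt x -> circ x y = 0 ->
  [/\ nilelt y, aug [:: x] y & aug [:: y] x].
Proof.
move=> nx xy; have [z [xz zx az]] := circ_inv nx.
have zy := circ_inv_uniq zx xy; rewrite {z}zy in xz zx az.
have ny : nilelt y by apply: nilelt_aug az.
split=> //; have [t [yt ty at_]] := circ_inv ny.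
by rewrite (circ_inv_uniq xy yt).
Qed.

(** The relation at a vertex of valence two, in terms of its two closed paths.
Which case occurs depends on the orientation and on the order of the children. *)
Definition linked x y := [\/ x = y, circ x y = 0 | circ y x = 0].

Lemma linked_nil x y : nilelt x -> linked x y ->
  [/\ nilelt y, aug [:: x] y & aug [:: y] x].
Proof.
move=> nx [<-|/(circ_nil nx)//|yx].
  by split=> //; apply/aug_gen/mem_head.
have [z [xz zx az]] := circ_inv nx.
by apply: (circ_nil nx); rewrite (circ_inv_uniq yx xz).
Qed.

(** Here a and b are the two arrows of an edge that ends in a leaf, so that in a
nonzero word every a but a final one is followed by b, and every b but an
initial one is preceded by a.  Up to its ends, the word is thus a word in a * b
and S, of at least half the length. *)
Lemma nil_peel S a b :
    a * a = 0 -> b * b = 0 -> {in S, forall s, a * s = 0 /\ s * b = 0} ->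
  nilS (a * b :: S) -> nilS (a :: b :: S).
Proof.
move=> aa bb Sab [N nS]; pose T := a * b :: S.
pose Z k u := forall m, size m = k -> {subset m <= T} ->
  u * \prod_(x <- m) x = 0.
have ZS k u s : s \in T -> Z k.+1 u -> Z k (u * s).
  move=> Ts Zu m sm mT; have := Zu (s :: m); rewrite /= sm big_cons mulrA.
  by apply=> // t; rewrite inE => /predU1P[->|/mT].
have consP s l : {subset s :: l <= [:: a, b & S]} ->
    [\/ s = a, s = b | s \in S] /\ {subset l <= [:: a, b & S]}.
  move=> h; split=> [|u ul]; last by apply: h; rewrite inE ul orbT.
  have := h s (mem_head _ _); rewrite !inE => /or3P[/eqP|/eqP|]; by constructor.
have main : forall k u l, Z k u -> {subset l <= [:: a, b & S]} ->
    (k.*2 < size l)%N -> head 0 l != b -> u * \prod_(x <- l) x = 0.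
  elim=> [|k IHk] u l Zu lS.
    by have := Zu [::] erefl; rewrite big_nil mulr1 => -> //; rewrite mul0r.
  case: l lS => [//|x l] /consP[xS lS] /= sl xb.
  case: l lS sl => [|y l] // yS sl.
  rewrite !big_cons; case: xS => [xa|/eqP|xS].
  - have [[ya|yb|{}yS] lS] := consP _ _ yS.
    + by rewrite xa ya (mulrA a) aa mul0r mulr0.
    + rewrite xa yb (mulrA a) mulrA.
      have [/eqP hl|hl] := boolP (head 0 l == b); last first.
        apply: IHk hl => //; first by apply: ZS Zu; apply: mem_head.
      case: l {IHk yS lS sl} hl => [|z l] /= hl; last first.
        by rewrite big_cons hl -mulrA -(mulrA a) (mulrA b) bb mul0r !mulr0.
      by rewrite -hl !mulr0 mul0r.
    + by rewrite xa (mulrA a) (Sab _ yS).1 mul0r mulr0.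
  - by rewrite (negPf xb).
  have [/eqP hl|hl] := boolP (y == b).
    by rewrite hl (mulrA x) (Sab _ xS).2 mul0r mulr0.
  rewrite mulrA -[y * _](big_cons _ _ y l predT id).
  apply: IHk => //; first by apply: ZS Zu; rewrite inE xS orbT.
  exact: ltnW.
have Z1 : Z N 1 by move=> m sm mT; rewrite nS ?mulr0.
exists N.+1.*2 => -[|x l] // /eqP; rewrite /= eqSS => /eqP sl xlS.
have [_ lS] := consP _ _ xlS.
have [xb|xb] := eqVneq x b; last first.
  by rewrite -[LHS]mul1r; apply: (main N 1 (x :: l) Z1) => //=; rewrite sl ltnS leqnSn.
rewrite big_cons; have [lb|lb] := eqVneq (head 0 l) b; last first.
  by rewrite -[X in _ * X]mul1r (main N 1 l Z1) ?mulr0 // sl.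
case: l sl {xlS lS} lb => [|y l] // _ /= ->.
by rewrite big_cons xb mulrA bb mul0r.
Qed.

End Circle.

(** * Vertex relations *)

Section Shapes.
Variables (H : pzRingType) (q : bool).
Notation circ := (circ q).

Definition bigcirc (s : seq H) : H := foldr circ 0 s.

(** The relation at a vertex with closed paths f w; when par holds, the head of
s is the parent, otherwise s consists of children. *)
Definition vrel (T : Type) (f : T -> H) (s : seq T) (par : bool) : Prop :=
  if par then (if s is u :: s' then bigcirc (map f s') = f u else False)
  else bigcirc (map f s) = 0.

Lemma vrel1 (T : eqType) (f : T -> H) s par u :
  perm_eq s [:: u] -> vrel f s par -> f u = 0.
Proof.
move/(@perm_small_eq _ _ [:: u] isT)->; case: par => //=.
by rewrite circr0.
Qed.

Lemma perm2_cases (T : eqType) (s : seq T) a b : perm_eq s [:: a; b] ->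
  s = [:: a; b] \/ s = [:: b; a].
Proof.
move=> sp; have := perm_size sp; case: s sp => [|x [|y []]] //= sp _.
have : x \in [:: a; b] by rewrite -(perm_mem sp) mem_head.
rewrite !inE => /orP[] /eqP xE; rewrite xE in sp *.
  by left; move: sp; rewrite perm_cons => /(@perm_small_eq _ _ [:: b] isT)->.
right; move: sp; rewrite (perm_sym _ [:: a; b]) (perm_catC [:: a] [:: b]) /=.
by rewrite perm_sym perm_cons => /(@perm_small_eq _ _ [:: a] isT)->.
Qed.

Lemma vrel2 (T : eqType) (f : T -> H) s par u w :
  perm_eq s [:: u; w] -> vrel f s par -> linked q (f u) (f w).
Proof.
case/perm2_cases=> ->; case: par => /=; rewrite ?circr0 => h.
- exact: Or31.
- exact: Or32.
- exact: Or31.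
- exact: Or33.
Qed.

Definition rots (T : Type) (x y z : T) :=
  [:: [:: x; y; z]; [:: y; z; x]; [:: z; x; y]].

Lemma perm3_rots (T : eqType) (s : seq T) x y z : perm_eq s [:: x; y; z] ->
  s \in rots x y z \/ s \in rots y x z.
Proof.
move=> sp; have := perm_size sp; case: s sp => [|u s] //= sp _.
have : u \in [:: x; y; z] by rewrite -(perm_mem sp) mem_head.
have p1 : perm_eq [:: x; y; z] [:: y; z; x] by rewrite (perm_catC [:: x]).
have p2 : perm_eq [:: x; y; z] [:: z; x; y] by rewrite (perm_catC [:: x; y]).
rewrite !inE => /or3P[] /eqP uE; rewrite {u}uE in sp *.
- move: sp; rewrite perm_cons => /perm2_cases[]->; rewrite !eqxx ?orbT; first [by left | by right].
- move: (perm_trans sp p1).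
  rewrite perm_cons => /perm2_cases[]->; rewrite !eqxx ?orbT; first [by left | by right].
- move: (perm_trans sp p2).
  rewrite perm_cons => /perm2_cases[]->; rewrite !eqxx ?orbT; first [by left | by right].
Qed.

(** A relation l_u = l_1 o l_2 with parent u also reads l_u^-1 o l_1 o l_2 = 0.
Replacing the closed path of the parent by its circle inverse brings the
relation at a trivalent vertex into a form that does not depend on the position
of the parent. *)
Definition tilde (T : eqType) (f fi : T -> H) (s : seq T) (par : bool) w : H :=
  if par && (w == head w s) then fi w else f w.

(** A circle product of invertible factors that equals 0 may be rotated. *)
Lemma vrel_tilde (T : eqType) (f fi : T -> H) s par x y z :
    uniq [:: x; y; z] -> s \in rots x y z ->
    (forall w, w \in [:: x; y; z] ->
       [/\ nilelt (f w), circ (f w) (fi w) = 0 & circ (fi w) (f w) = 0]) ->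
  let g := tilde f fi s par in
  vrel f s par <-> circ (g x) (circ (g y) (g z)) = 0.
Proof.
rewrite /= !inE negb_or => /and3P[/andP[xy xz] yz _] sR hf.
have [nx xi ix] := hf x (mem_head _ _).
have [ny yi iy] : [/\ nilelt (f y), circ (f y) (fi y) = 0 & circ (fi y) (f y) = 0].
  by apply: hf; rewrite !inE eqxx orbT.
have [nz zi iz] : [/\ nilelt (f z), circ (f z) (fi z) = 0 & circ (fi z) (f z) = 0].
  by apply: hf; rewrite !inE eqxx !orbT.
have par_iff u ui v w : circ u ui = 0 -> circ ui u = 0 ->
    circ v w = u <-> circ ui (circ v w) = 0.
  move=> ui0 iu0; split=> [->//|h].
  by rewrite -[LHS](circ0r q) -ui0 -circA h circr0.
have rotE u ui v : circ u ui = 0 -> circ ui u = 0 ->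
    circ u v = 0 <-> circ v u = 0.
  move=> ui0 iu0; split=> h.
    by have -> : v = ui by rewrite -[v](circ0r q) -iu0 -circA h circr0.
  by have -> : v = ui by rewrite -[v](circr0 q) -ui0 circA h circ0r.
move: sR => /or3P[] /eqP ->; rewrite /tilde /= ?eqxx.
- rewrite !(negPf xy, negPf xz, eq_sym y, eq_sym z) !andbF andbT.
  by case: par => //=; rewrite circr0 //; apply: par_iff.
- rewrite (negPf xy) (eq_sym z) (negPf yz) !andbF andbT.
  rewrite (rotE _ _ _ _ xi ix) -circA.
  by case: par => //=; rewrite circr0 //; apply: par_iff.
rewrite (negPf xz) (negPf yz) !andbF andbT circA.
case: par => //=; rewrite circr0 //.
  by rewrite -(rotE _ _ _ _ iz zi); apply: par_iff.
by rewrite -(rotE _ _ _ _ zi iz).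
Qed.

Lemma circN (x : H) : x * x = 0 -> circ x (- x) = 0 /\ circ (- x) x = 0.
Proof. by rewrite /circ mulrN mulNr => ->; rewrite oppr0 mul0rn !addr0 subrr addNr. Qed.

Lemma sq0_nilelt (x : H) : x * x = 0 -> nilelt x.
Proof. by exists 2. Qed.

(** Put s = A o B and z = AB + BA.  As A^2 = B^2 = 0, z commutes with A and B,
and s^2 = z (1 + q s).  Since s is the circle inverse of C, it is nilpotent;
hence 1 + q s is a unit and z is nilpotent.  Nonzero words in A and B alternate,
and ABA = zA, BAB = zB, so long words are divisible by high powers of z. *)
Lemma tri_nil (A B C : H) : A * A = 0 -> B * B = 0 -> nilelt C ->
  circ A (circ B C) = 0 -> nilS [:: A; B].
Proof.
move=> AA BB nC; rewrite circA; set s := circ A B => sC.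
have sE : s = A + B + A * B *+ q by [].
have ns : nilelt s.
  have [C' [CC' C'C aC]] := circ_inv q nC.
  by apply: nilelt_aug nC _; rewrite (circ_inv_uniq sC CC').
have [z zE] : exists z, z = A * B + B * A by eexists.
have ABA : A * B * A = z * A.
  by rewrite zE mulrDl -[B * A * A]mulrA AA mulr0 addr0.
have BAB : B * A * B = z * B.
  by rewrite zE mulrDl -[A * B * B]mulrA BB mulr0 add0r.
have Az : A * z = z * A by rewrite -ABA zE mulrDr !mulrA AA mul0r add0r.
have Bz : B * z = z * B by rewrite -BAB zE mulrDr !mulrA BB mul0r addr0.
pose u := 1 + s *+ q.
have ss : s * s = z * u.
  rewrite /u sE; case: (q); rewrite ?mulr0n ?mulr1n.
    transitivity (A * A * (1 + B) + (1 + A) * (B * B) + z + A * B * A + B * A * B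
        + A * B * A * B); first by rewrite zE; ncring.
    by rewrite AA BB ABA BAB !(mul0r, mulr0); ncring.
  transitivity (A * A + B * B + z); first by rewrite zE; ncring.
  by rewrite AA BB; ncring.
have [v uv] : exists v, u * v = 1.
  rewrite /u; case: (q); last by exists 1; rewrite mulr0n addr0 mulr1.
  case: (nileltN ns) => n /nilelt_geom [h _]; move: h; rewrite opprK => h.
  by exists (\sum_(i < n) (- s) ^+ i); rewrite mulr1n.
have zs : GRing.comm z s.
  rewrite /GRing.comm sE !mulrDl !mulrDr -Az -Bz mulrnAl mulrnAr; congr (_ + _ *+ _).
  by rewrite mulrA -[RHS]mulrA Bz mulrA Az.
have zu : GRing.comm z u.
  by apply: commrD; [apply: commr1 | apply: commrMn].
have [m zm] : nilelt z.
  have [m sm] := ns; exists m; have : (z * u) ^+ m * v ^+ m = 0.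
    by rewrite -ss -expr2 -exprM mulnC exprM sm expr2 !mul0r.
  rewrite (exprMn_comm _ zu) -mulrA.
  suff -> : forall k, u ^+ k * v ^+ k = 1 by rewrite mulr1.
  elim=> [|k IHk]; first by rewrite !expr0 mulr1.
  by rewrite exprSr exprS mulrA -(mulrA _ u) uv mulr1.
exists (m.*2).+1 => l sl lS.
suff [r ->] : exists r, \prod_(x <- l) x = z ^+ m * r by rewrite zm mul0r.
elim: m l sl lS {zm} => [|m IHm] l sl lS; first by exists (\prod_(x <- l) x); rewrite mul1r.
case: l sl lS => [|x [|y [|w l]]] // [sl] lS.
have [||r rE] := IHm (w :: l); first by rewrite /= sl.
  by move=> i il; apply: lS; rewrite !inE in il *; rewrite il !orbT.
have xS : x \in [:: A; B] by apply: lS; rewrite !inE eqxx.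
have yS : y \in [:: A; B] by apply: lS; rewrite !inE eqxx !orbT.
have wS : w \in [:: A; B] by apply: lS; rewrite !inE eqxx !orbT.
rewrite !inE in xS yS wS.
have [xy|xy] := eqVneq x y.
  exists 0; rewrite !big_cons mulrA -xy mulr0.
  by case/orP: xS => [] /eqP->; rewrite ?AA ?BB mul0r.
have [yw|yw] := eqVneq y w.
  exists 0; rewrite !big_cons (mulrA y) -yw mulr0.
  by case/orP: yS => [] /eqP->; rewrite ?AA ?BB mul0r mulr0.
exists r; rewrite exprS -mulrA -rE !big_cons !mulrA; congr (_ * _).
move: xy yw.
by case/orP: xS=> /eqP->; case/orP: yS=> /eqP->; case/orP: wS=> /eqP->; rewrite ?eqxx.
Qed.

End Shapes.

(** * Nilpotency of the arrows in types A and D *)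

Section ArrowsFrom.
Variables (H : pzRingType) (n : nat) (c : nat -> nat -> H).

Definition arrows_from k : seq H :=
  [seq c i j | i <- iota k (n - k), j <- iota k (n - k)].

Lemma arrows_fromP k x : reflect (exists i j, [/\ (k <= i < n)%N, (k <= j < n)%N & x = c i j])
  (x \in arrows_from k).
Proof.
have mI i : (i \in iota k (n - k)) = (k <= i < n)%N.
  rewrite mem_iota; case: (leqP k i) => //= ki; case: (leqP k n) => kn.
    by rewrite subnKC.
  by rewrite (_ : n - k = 0)%N ?addn0; lia.
apply: (iffP allpairsP) => [[[i j] /= [ik jk ->]]|[i [j [ik jk ->]]]].
  by exists i, j; rewrite -!mI.
by exists (i, j); rewrite /= !mI.
Qed.

End ArrowsFrom.

Section Arm.
Variables (H : pzRingType) (q : bool) (n t : nat) (c : nat -> nat -> H).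
Hypothesis c_orth : forall i j k l, j <> k -> c i j * c k l = 0.
Hypothesis c_arm : forall k j, (k < t)%N -> (k <= j)%N -> j <> k.+1 ->
  c k j = 0 /\ c j k = 0.

Definition loop i j : H := c i j * c j i.

Hypothesis end0 : (0 < t)%N -> loop 0 1 = 0.
Hypothesis mid_linked : forall j, (0 < j < t)%N ->
  linked q (loop j j.-1) (loop j j.+1).

Lemma expr_swap (x y : H) k : (y * x) ^+ k.+1 = y * (x * y) ^+ k * x.
Proof.
elim: k => [|k IHk]; first by rewrite expr1 expr0 mulr1.
by rewrite exprS IHk (exprS _ k) !mulrA.
Qed.

Lemma nilelt_swap (x y : H) : nilelt (x * y) -> nilelt (y * x).
Proof. by case=> k xk; exists k.+1; rewrite expr_swap xk mulr0 mul0r. Qed.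

(** The closed path at the end of the arm vanishes.  Nilpotency passes across an
edge, because (yx)^(k+1) = y (xy)^k x, and across a vertex of valence two by its
relation. *)
Lemma arm_nil j : (j < t)%N -> nilelt (loop j j.+1) /\ nilelt (loop j.+1 j).
Proof.
elim: j => [|j IHj] jt.
  have u0 : nilelt (loop 0 1) by exists 1; rewrite end0.
  by split=> //; apply: nilelt_swap.
have [_ nl] := IHj (ltnW jt).
have [nu _ _] := linked_nil nl (mid_linked (j := j.+1) jt).
by split=> //; apply: nilelt_swap.
Qed.

(** Vertices are removed one by one with [nil_peel].  The removal of m leaves the
closed path at m.+1 through m, which lies in the ring generated by the remaining
arrows, being linked to the closed path on the other side of m.+1. *)
Lemma arm_peel : (t < n)%N -> nilS (arrows_from n c t) ->
    ((0 < t)%N -> aug (arrows_from n c t) (loop t t.-1)) ->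
  nilS (arrows_from n c 0).
Proof.
move=> tn nt tA.
suff: forall k, (k <= t)%N -> nilS (arrows_from n c (t - k)).
  by move/(_ t (leqnn t)); rewrite subnn.
elim=> [|k IHk] kt; first by rewrite subn0.
have := IHk (ltnW kt); move: (t - k.+1)%N (subnSK kt) => m mE.
have mt : (m < t)%N by lia.
rewrite -mE => nm {k IHk kt mE}.
have lA : aug (arrows_from n c m.+1) (loop m.+1 m).
  have [/eqP mE|mlt] : (m.+1 == t) \/ (m.+1 < t)%N by lia.
    have -> : m = t.-1 by rewrite -mE.
    have t0 : (0 < t)%N by lia.
    by rewrite prednK //; apply: tA.
  have [_ _] := linked_nil (arm_nil mt).2 (mid_linked (j := m.+1) mlt).
  apply: aug_trans => x; rewrite inE => /eqP->.
  apply: augM; apply/aug_gen/arrows_fromP; first by exists m.+1, m.+2; split=> //; lia.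
  by exists m.+2, m.+1; split=> //; lia.
have: nilS [:: c m.+1 m, c m m.+1 & arrows_from n c m.+1].
  apply: nil_peel.
  - by apply: c_orth; lia.
  - by apply: c_orth; lia.
  - by move=> _ /arrows_fromP[i [j [mi mj ->]]]; split; apply: c_orth; lia.
  apply: nil_aug nm _ => x; rewrite inE => /predU1P[->|xS] //.
  exact: aug_gen.
move/nil_aug; apply=> _ /arrows_fromP[i [j [mi mj ->]]].
have [im|im] := eqVneq i m.
  have [jm|/eqP jm] := eqVneq j m.+1.
    by apply: aug_gen; rewrite im jm !inE eqxx orbT.
  have [] := @c_arm m j; rewrite ?im //; first by lia.
  by move=> -> _; apply: aug0.
have [jm|jm] := eqVneq j m.
  have [im'|/eqP im'] := eqVneq i m.+1.
    by apply: aug_gen; rewrite im' jm !inE eqxx.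
  have [] := @c_arm m i; rewrite ?jm //; first by lia.
  by move=> _ ->; apply: aug0.
apply: aug_gen; rewrite !inE; apply/orP; right; apply/orP; right.
by apply/arrows_fromP; exists i, j; split=> //; lia.
Qed.

End Arm.

Definition adjA n i j : bool :=
  ((i.+1 == j) && (j < n) || (j.+1 == i) && (i < n))%N.
Definition edgeD n i j : bool :=
  ((i.+1 == j) && (j.+1 < n) || (i.+2 == j) && (j.+1 == n))%N.
Definition adjD n i j : bool := edgeD n i j || edgeD n j i.

(** The order of the neighbours and the position of the parent are left open, so
as to cover all rooted orientations and all orders of the children. *)
Definition shaped (nb : rel nat) n (sh : nat -> seq nat * bool) : Prop :=
  forall i, (i < n)%N -> perm_eq (sh i).1 [seq j <- iota 0 n | nb i j].

Section Dynkin.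
Variables (H : pzRingType) (q : bool) (n : nat) (c : nat -> nat -> H).
Variable sh : nat -> seq nat * bool.
Hypothesis c_orth : forall i j k l, j <> k -> c i j * c k l = 0.
Hypothesis rels : forall i, (i < n)%N -> vrel q (loop c i) (sh i).1 (sh i).2.

Lemma filter_iota2 (P : pred nat) a b : (a < b < n)%N ->
  (forall i, (i < n)%N -> P i = (i == a) || (i == b)) ->
  perm_eq [seq j <- iota 0 n | P j] [:: a; b].
Proof.
move=> ab PE; apply: uniq_perm; rewrite ?filter_uniq ?iota_uniq //=.
  by rewrite inE andbT; lia.
move=> i; rewrite mem_filter mem_iota !inE add0n /=.
case: (ltnP i n) => ni; first by rewrite PE ?andbT.
by rewrite andbF; apply/esym/negbTE; lia.
Qed.

Lemma filter_iota1 (P : pred nat) a : (a < n)%N ->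
  (forall i, (i < n)%N -> P i = (i == a)) ->
  perm_eq [seq j <- iota 0 n | P j] [:: a].
Proof.
move=> ab PE; apply: uniq_perm; rewrite ?filter_uniq ?iota_uniq //=.
move=> i; rewrite mem_filter mem_iota !inE add0n /=.
case: (ltnP i n) => ni; first by rewrite PE ?andbT.
by rewrite andbF; apply/esym/negbTE; lia.
Qed.

Lemma filter_iota3 (P : pred nat) a b d : (a < b < d)%N -> (d < n)%N ->
  (forall i, (i < n)%N -> P i = [|| i == a, i == b | i == d]) ->
  perm_eq [seq j <- iota 0 n | P j] [:: a; b; d].
Proof.
move=> ab dn PE; apply: uniq_perm; rewrite ?filter_uniq ?iota_uniq //=.
  by rewrite !inE andbT; lia.
move=> i; rewrite mem_filter mem_iota !inE add0n /=.
case: (ltnP i n) => ni; first by rewrite PE ?andbT.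
by rewrite andbF; apply/esym/negbTE; lia.
Qed.

Section A.
Hypothesis c_adj : forall i j, ~~ adjA n i j -> c i j = 0.
Hypothesis shA : shaped (adjA n) n sh.

Lemma A_end0 : (1 < n)%N -> loop c 0 1 = 0.
Proof.
move=> n1; apply: vrel1 (rels (i := 0) _); last by lia.
apply: perm_trans (shA _) _; first by lia.
by apply: filter_iota1 => // i ni; rewrite /adjA; lia.
Qed.

Lemma A_end : (1 < n)%N -> loop c n.-1 n.-2 = 0.
Proof.
move=> n1; apply: vrel1 (rels (i := n.-1) _); last by lia.
apply: perm_trans (shA _) _; first by lia.
by apply: filter_iota1 => [|i ni]; rewrite /adjA; lia.
Qed.

Lemma A_mid j : (0 < j)%N -> (j.+1 < n)%N -> linked q (loop c j j.-1) (loop c j j.+1).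
Proof.
move=> j0 jn; apply: vrel2 (rels (i := j) _); last by lia.
apply: perm_trans (shA _) _; first by lia.
by apply: filter_iota2 => [|i ni]; rewrite /adjA; lia.
Qed.

(** The whole graph is an arm, of which only the vertex n.-1 remains. *)
Lemma A_nil : nilS (arrows_from n c 0).
Proof.
have [->|n0] := eqVneq n 0%N; first by exists 1 => -[|x []] //= _ /(_ x (mem_head _ _)).
apply: (@arm_peel _ q n n.-1) => //.
- move=> k j kn kj jk; rewrite !c_adj //; apply/negP; rewrite /adjA; lia.
- by move=> h; apply: A_end0; lia.
- by move=> j h; apply: A_mid; lia.
- by lia.
- have -> : arrows_from n c n.-1 = [:: 0].
    rewrite /arrows_from (_ : n - n.-1 = 1)%N /=; last by lia.
    by rewrite c_adj // /adjA; lia.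
  by apply: nilelt_nil; exists 1.
by move=> h; rewrite A_end; [apply: aug0 | lia].
Qed.
End A.

Section D.
Hypothesis n4 : (4 <= n)%N.
Hypothesis c_adj : forall i j, ~~ adjD n i j -> c i j = 0.
Hypothesis shD : shaped (adjD n) n sh.
Local Notation t := (n - 3)%N.

Lemma D_end0 : (0 < n - 3)%N -> loop c 0 1 = 0.
Proof.
move=> n1; apply: vrel1 (rels (i := 0) _); last by lia.
apply: perm_trans (shD _) _; first by lia.
by apply: filter_iota1 => [|i ni]; rewrite /adjD /edgeD; lia.
Qed.

Lemma D_leaf i : i \in [:: n.-1; n.-2] -> loop c i t = 0.
Proof.
rewrite !inE => iE; apply: vrel1 (rels (i := i) _); last by lia.
apply: perm_trans (shD _) _; first by lia.
by apply: filter_iota1 => [|j ni]; rewrite /adjD /edgeD; lia.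
Qed.

Lemma D_leaf' i : i \in [:: n.-1; n.-2] -> loop c t i * loop c t i = 0.
Proof.
by move=> iE; rewrite /loop mulrA -(mulrA (c t i)) -/(loop c i t) D_leaf // mulr0 mul0r.
Qed.

Lemma D_mid j : (0 < j < t)%N -> linked q (loop c j j.-1) (loop c j j.+1).
Proof.
move=> j0; apply: vrel2 (rels (i := j) _); last by lia.
apply: perm_trans (shD _) _; first by lia.
by apply: filter_iota2 => [|i ni]; rewrite /adjD /edgeD; lia.
Qed.

Lemma D_arm0 k j : (k < t)%N -> (k <= j)%N -> j <> k.+1 -> c k j = 0 /\ c j k = 0.
Proof. by move=> kn kj jk; rewrite !c_adj //; apply/negP; rewrite /adjD /edgeD; lia. Qed.

Lemma D_arm_nil : nilelt (loop c t t.-1).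
Proof.
have [_] := @arm_nil H q t c D_end0 D_mid t.-1 (ltac:(lia)).
by rewrite (_ : t.-1.+1 = t)%N //; lia.
Qed.

(** The order of the children is arbitrary, hence so is the order in which the
two leaves next to t occur. *)
Lemma D_perm : exists x y, [/\ perm_eq [:: x; y] [:: n.-2; n.-1], x != y &
  (sh t).1 \in rots x y t.-1].
Proof.
have : perm_eq (sh t).1 [:: t.-1; n.-2; n.-1].
  apply: perm_trans (shD _) _; first by lia.
  by apply: filter_iota3 => [||i ni]; rewrite /adjD /edgeD; lia.
have rotE x y (z : nat) s : (s \in rots z x y) = (s \in rots x y z).
  by rewrite !inE orbC -orbA.
case/perm3_rots; rewrite rotE => h.
  by exists n.-2, n.-1; split => //; lia.
exists n.-1, n.-2; split => //; [|by lia|by rewrite rotE in h].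
by rewrite (perm_catC [:: n.-1] [:: n.-2]).
Qed.

Lemma D_tri x y : perm_eq [:: x; y] [:: n.-2; n.-1] -> x != y ->
   (sh t).1 \in rots x y t.-1 -> forall fi : nat -> H,
   (forall w, w \in [:: x; y; t.-1] -> circ q (loop c t w) (fi w) = 0 /\
      circ q (fi w) (loop c t w) = 0) ->
   let g := tilde (loop c t) fi (sh t).1 (sh t).2 in
   circ q (g x) (circ q (g y) (g t.-1)) = 0.
Proof.
move=> pxy xy shR fi hfi g.
have xyE i : i \in [:: x; y] -> i \in [:: n.-1; n.-2].
  by rewrite (perm_mem pxy) !inE orbC.
have xE := xyE x (mem_head _ _).
have yE : y \in [:: n.-1; n.-2] by apply: xyE; rewrite !inE eqxx orbT.
have hU : uniq [:: x; y; t.-1].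
  by rewrite !inE in xE yE; rewrite /= !inE negb_or; lia.
apply: (vrel_tilde (fi := fi) _ hU shR _).1; last by apply: rels; lia.
move=> w wE; have [h1 h2] := hfi w wE; split=> //.
move: wE; rewrite !inE => /or3P[] /eqP ->; last exact: D_arm_nil.
- by apply/sq0_nilelt/D_leaf'.
- by apply/sq0_nilelt/D_leaf'.
Qed.

(** The closed paths at t through the two leaves have square zero, and the one
through the arm is nilpotent, so [tri_nil] applies.  It remains to peel off the
two leaves and then the arm. *)
Lemma D_nil : nilS (arrows_from n c 0).
Proof.
have [x [y [pxy xy shR]]] := D_perm.
have xyE i : i \in [:: x; y] -> i \in [:: n.-1; n.-2].
  by rewrite (perm_mem pxy) !inE orbC.
have xE := xyE x (mem_head _ _).
have yE : y \in [:: n.-1; n.-2] by apply: xyE; rewrite !inE eqxx orbT.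
have [ci [zi iz az]] := circ_inv q D_arm_nil.
pose fi w := if w == t.-1 then ci else - loop c t w.
have hz w : w \in [:: x; y] -> (w == t.-1) = false.
  by move/xyE; rewrite !inE; lia.
have yxy : y \in [:: x; y] by rewrite !inE eqxx orbT.
have hfi w : w \in [:: x; y; t.-1] ->
    circ q (loop c t w) (fi w) = 0 /\ circ q (fi w) (loop c t w) = 0.
  rewrite !inE /fi => /or3P[] /eqP ->; rewrite ?eqxx // hz ?mem_head //;
    by apply/circN/D_leaf'.
have /= := D_tri pxy xy shR hfi; set A := tilde _ _ _ _ _; set B := tilde _ _ _ _ _.
set C := tilde _ _ _ _ _ => ABC.
have sgn w g : w \in [:: x; y] -> g = tilde (loop c t) fi (sh t).1 (sh t).2 w ->
    [/\ g * g = 0, aug [:: g] (loop c t w) & aug [:: loop c t w] g].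
  move=> wxy ->; have aa := D_leaf' (xyE w wxy).
  have g1 u : aug [:: u] u by apply/aug_gen/mem_head.
  have g2 (u : H) : aug [:: u] (- u) by apply/augN.
  have g3 (u : H) : aug [:: - u] u by rewrite -{2}[u]opprK; apply/augN.
  rewrite /tilde; case: ifP => _ //; rewrite /fi hz //.
  by split=> //; rewrite mulNr mulrN aa !oppr0.
have [AA aA Aa] := sgn x A (mem_head _ _) erefl.
have [BB aB Bb] := sgn y B yxy erefl.
have [nC aC] : nilelt C /\ aug [:: C] (loop c t t.-1).
  rewrite /C /tilde; case: ifP => _; rewrite /fi ?eqxx.
    by have [] := circ_nil D_arm_nil zi.
  by split; [exact: D_arm_nil | apply/aug_gen/mem_head].
have nAB := tri_nil AA BB nC ABC.
have sub1 u v w : aug [:: u] w -> aug [:: u; v] w.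
  by apply: aug_trans => i; rewrite inE => /eqP->; apply/aug_gen/mem_head.
have sub2 u v w : aug [:: v] w -> aug [:: u; v] w.
  apply: aug_trans => i; rewrite inE => /eqP->.
  by apply/aug_gen; rewrite !inE eqxx orbT.
have aABC : aug [:: A; B] C.
  have aAB : aug [:: A; B] (circ q A B).
    apply: aug_circ; [apply: sub1 | apply: sub2]; exact/aug_gen/mem_head.
  rewrite circA in ABC.
  have [_ h _] := circ_nil (nilS_nilelt nAB aAB) ABC.
  by apply: aug_trans h => i; rewrite inE => /eqP->.
have nab : nilS [:: loop c t x; loop c t y].
  apply: nil_aug nAB _ => i; rewrite !inE => /orP[] /eqP->; first exact: sub1.
  exact: sub2.
have tx : t <> x by move: xE; rewrite !inE; lia.
have ty : t <> y by move: yE; rewrite !inE; lia.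
have xy' : x <> y by apply/eqP.
have nx : nilS [:: c t x; c x t; loop c t y].
  apply: nil_peel nab; try by apply: c_orth; auto.
  move=> s; rewrite inE => /eqP->; rewrite /loop mulrA -(mulrA (c t y)).
  by rewrite !c_orth ?mul0r ?mulr0; auto.
have nxy : nilS [:: c t y; c y t; c t x; c x t].
  apply: nil_peel; try by apply: c_orth; auto.
    by move=> s; rewrite !inE => /orP[] /eqP->; rewrite !c_orth; auto.
  apply: nil_aug nx _ => s; rewrite !inE => /or3P[] /eqP ->; apply: aug_gen;
    by rewrite !inE eqxx ?orbT.
have tn : (t < n)%N by lia.
have xn : (t <= x < n)%N by move: xE; rewrite !inE; lia.
have yn : (t <= y < n)%N by move: yE; rewrite !inE; lia.
apply: (@arm_peel _ q n t c) => //.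
- exact: D_arm0.
- exact: D_end0.
- exact: D_mid.
- apply: nil_aug nxy _ => _ /arrows_fromP[i [j [it jt ->]]].
  have H3 k : (t <= k < n)%N -> [\/ k = t, k = x | k = y].
    move=> kt; have : k \in [:: t; n.-2; n.-1] by rewrite !inE; lia.
    rewrite inE -(perm_mem pxy) !inE => /or3P[] /eqP->; by constructor.
  have adjn u v : u \in [:: x; y] -> v \in [:: x; y] -> c u v = 0.
    move=> /xyE + /xyE; rewrite !inE => uE vE.
    by apply: c_adj; rewrite /adjD /edgeD; lia.
  have ctt : c t t = 0 by apply: c_adj; rewrite /adjD /edgeD; lia.
  case: (H3 _ it) => ->; case: (H3 _ jt) => ->;
    rewrite ?ctt ?(adjn _ _ (mem_head _ _) yxy, adjn _ _ yxy yxy, adjn _ _ yxy (mem_head _ _), adjn _ _ (mem_head _ _) (mem_head _ _)); try (by apply: aug0);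
    by apply: aug_gen; rewrite !inE eqxx ?orbT.
move=> t0; apply: aug_trans aC => s; rewrite inE => /eqP->.
apply: aug_trans aABC => {}s; rewrite !inE => sE.
have al w : w \in [:: x; y] -> aug (arrows_from n c t) (loop c t w).
  move=> /xyE; rewrite !inE => wE.
  by apply: augM; apply/aug_gen/arrows_fromP; [exists t, w | exists w, t];
    split=> //; lia.
case/orP: sE => /eqP->.
  by apply: aug_trans Aa => u; rewrite inE => /eqP->; apply/al/mem_head.
by apply: aug_trans Bb => u; rewrite inE => /eqP->; apply/al.
Qed.
End D.
End Dynkin.

(** * Deformation of the arrows in types A and D *)

Section Higher.
Variables (H : pzRingType) (c : nat -> nat -> H).

(** The square of the two-sided ideal generated by the c i j. *)
Inductive higher : H -> Prop :=
| higher0 : higher 0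
| higherD x y : higher x -> higher y -> higher (x + y)
| higher_prod x i j y k l z : higher (x * c i j * y * c k l * z).

Lemma higherM x y z : higher y -> higher (x * y * z).
Proof.
elim=> [|y1 y2 _ h1 _ h2|u i j v k l w].
- by rewrite mulr0 mul0r; apply: higher0.
- by rewrite mulrDr mulrDl; apply: higherD.
have -> : x * (u * c i j * v * c k l * w) * z = (x * u) * c i j * v * c k l * (w * z).
  by rewrite !mulrA.
exact: higher_prod.
Qed.

Lemma higherMl x y : higher y -> higher (x * y).
Proof. by move=> hy; rewrite -[x * y]mulr1; apply: higherM. Qed.

Lemma higherMr x y : higher y -> higher (y * x).
Proof. by move=> hy; rewrite -[y]mul1r; apply: higherM. Qed.

Lemma higher_loop i j : higher (loop c i j).
Proof.
rewrite /loop (_ : _ * _ = 1 * c i j * 1 * c j i * 1); last by rewrite !mulr1 mul1r.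
exact: higher_prod.
Qed.

End Higher.

Section Geom.
Variables (H : pzRingType) (N : nat).
(** The inverse of 1 - x when x ^+ N = 0. *)
Definition geom (x : H) : H := \sum_(k < N) x ^+ k.

Lemma geom_inv x : x ^+ N = 0 -> (1 - x) * geom x = 1 /\ geom x * (1 - x) = 1.
Proof. exact: nilelt_geom. Qed.

Lemma geom_swap (x y : H) : x * geom (y * x) = geom (x * y) * x.
Proof.
rewrite /geom mulr_sumr mulr_suml; apply: eq_bigr => k _; elim: (k : nat) => [|m IHm].
  by rewrite !expr0 mulr1 mul1r.
by rewrite exprS mulrA mulrA -mulrA IHm exprS !mulrA.
Qed.

Lemma geom_higher (c : nat -> nat -> H) x : (0 < N)%N -> higher c x -> higher c (geom x - 1).
Proof.
rewrite /geom; case: N => // m _ hx; rewrite big_ord_recl expr0 addrAC subrr add0r.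
apply: (big_ind (higher c)); [exact: higher0 | by move=> *; apply: higherD |].
by move=> i _; rewrite exprS; apply: higherMr.
Qed.

Lemma geom_comm (x y : H) : GRing.comm x y -> GRing.comm x (geom y).
Proof. by move=> xy; apply: commr_sum => i _; apply: commrX. Qed.
End Geom.

Lemma nilS_loops (H : pzRingType) n (c : nat -> nat -> H) :
   nilS (arrows_from n c 0) -> (forall i j, (n <= i)%N || (n <= j)%N -> c i j = 0) ->
  exists2 N, (0 < N)%N & forall i j, loop c i j ^+ N = 0.
Proof.
move=> nS cn; pose T := [seq loop c i j | i <- iota 0 n, j <- iota 0 n].
have [N nT] : nilS T.
  apply: nil_aug nS _ => _ /allpairsP[[i j] /= [+ + ->]]; rewrite !mem_iota => ni nj.
  by apply: augM; apply/aug_gen/arrows_fromP; [exists i, j | exists j, i]; split=> //; lia.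
exists N.+1 => // i j.
have [nij|nij] := boolP ((n <= i) || (n <= j))%N.
  by rewrite exprS {1}/loop cn // !mul0r.
have := nT (nseq N (loop c i j)); rewrite size_nseq big_nseq iter_mulr_1 exprS => ->.
- by rewrite mulr0.
- by [].
move=> x /nseqP[-> _]; apply/allpairsP; exists (i, j) => /=.
by rewrite !mem_iota; split=> //; lia.
Qed.

(** With a parent and at most one child, the relation equates two closed paths,
or kills one, for both values of q; such a relation survives any substitution
that fixes 0. *)
Lemma vrel_par (H : pzRingType) (T : eqType) q q' (f f' : T -> H) psi s :
    (size s <= 2)%N -> psi 0 = 0 -> {in s, forall w, f' w = psi (f w)} ->
  vrel q f s true -> vrel q' f' s true.
Proof.
move=> s2 psi0 hf; case: s s2 hf => [|u [|w []]] //= _ hf; rewrite ?circr0 => h.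
  by rewrite hf ?mem_head // -h.
by rewrite !hf ?h // !inE eqxx ?orbT.
Qed.

Section TypeA.
Variables (H : pzRingType) (n r : nat) (c : nat -> nat -> H) (e : nat -> H).
Variable sh : nat -> seq nat * bool.
Hypothesis c_e : forall i j, e i * c i j = c i j /\ c i j * e j = c i j.
Hypothesis c_orth : forall i j k l, j <> k -> c i j * c k l = 0.
Hypothesis c_adj : forall i j, ~~ adjA n i j -> c i j = 0.
Hypothesis shA : shaped (adjA n) n sh.
Hypothesis rels : forall i, (i < n)%N -> vrel false (loop c i) (sh i).1 (sh i).2.
Hypothesis shR : forall i, (i < n)%N -> (sh i).2 = (i != r).

(** The closed paths on the edges to the right of the root r are replaced by
l/(1 - l), the factor being put on one of the two arrows.  At r this turns
x + y = 0 into x/(1 - x) o y = 0; the other relations survive by [vrel_par]. *)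
Lemma typeA_deform : exists X : nat -> nat -> H,
  [/\ forall i j, e i * X i j * e j = X i j,
      forall i j, higher c (X i j - c i j)
    & forall i, (i < n)%N -> vrel true (loop X i) (sh i).1 (sh i).2].
Proof.
have nS : nilS (arrows_from n c 0) by apply: (A_nil c_orth rels).
have [|N N0 lN] := nilS_loops nS.
  by move=> i j nij; apply: c_adj; rewrite /adjA; lia.
pose X (i j : nat) := if (r <= i)%N && (j == i.+1) then c i j * geom N (loop c j i) else c i j.
have cXl i j : e i * X i j = X i j.
  by rewrite /X; case: ifP; rewrite ?mulrA (c_e i j).1.
have cXr i j : X i j * e j = X i j.
  by rewrite /X /loop geom_swap; case: ifP; rewrite -?mulrA (c_e i j).2.
pose psi (x : H) := x * geom N x.
have psi0 : psi 0 = 0 by rewrite /psi mul0r.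
have loopX i j : i <> j -> loop X i j =
   if (r <= i)%N && (j == i.+1) || (r <= j)%N && (i == j.+1) then psi (loop c i j)
   else loop c i j.
  move=> ij; rewrite {1}/loop /X /psi; case: ifP => [/andP[ri /eqP jE]|_].
    have -> : (i == j.+1) = false by lia.
    by rewrite andbF /= /loop -mulrA -geom_swap mulrA.
  by case: ifP => _ //=; rewrite mulrA.
exists X; split=> [i j|i j|i ni].
- by rewrite cXl cXr.
- rewrite /X; case: ifP => _; last by rewrite subrr; apply: higher0.
  rewrite -[X in _ - X]mulr1 -mulrBr.
  by apply/higherMl/geom_higher/higher_loop.
have nbE w : adjA n i w -> loop X i w =
    if (i < r)%N || (w < i)%N && (i == r) then loop c i w else psi (loop c i w).
  rewrite /adjA => iw; rewrite loopX; last by lia.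
  by case: ifP => h1; case: ifP => h2 //; exfalso; lia.
have := rels ni; have := shA ni; have := shR ni; case: (sh i) => s par /= parE sp.
have sE w : w \in s -> adjA n i w by rewrite (perm_mem sp) mem_filter => /andP[].
have s2 : (size s <= 2)%N.
  apply: (@uniq_leq_size _ s [:: i.-1; i.+1]).
    by rewrite (perm_uniq sp) filter_uniq ?iota_uniq.
  by move=> w /sE; rewrite /adjA !inE; lia.
case: ltngtP parE => [ir|ir|ir] /= ->.
- apply: (@vrel_par _ _ false true (loop c i) _ id) => // w /sE /nbE ->; by rewrite ir.
- apply: (@vrel_par _ _ false true (loop c i) _ psi) => // w /sE /nbE ->; case: ifP => // h; exfalso; lia.
rewrite /=; case: s s2 sE {sp} (perm_uniq sp) => [|u [|w []]] //= _ sE us.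
  rewrite !circr0 nbE; last by apply: sE; rewrite mem_head.
  by move=> ->; case: ifP; rewrite ?psi0.
have uA : adjA n i u by apply: sE; rewrite mem_head.
have wA : adjA n i w by apply: sE; rewrite !inE eqxx orbT.
rewrite filter_uniq ?iota_uniq // inE andbT in us.
rewrite !circr0 (nbE _ uA) (nbE _ wA).
have key x y : x ^+ N = 0 -> circ false x y = 0 ->
   circ true (psi x) y = 0 /\ circ true y (psi x) = 0.
  rewrite /circ mulr0n addr0 !mulr1n => xN xy.
  have -> : y = - x by rewrite -[RHS]addr0 -xy addKr.
  have [g1 g2] := geom_inv xN; rewrite /psi; split.
    transitivity (x * (geom N x * (1 - x)) - x); first by ncring.
    by rewrite g2 mulr1 subrr.
  transitivity (x * ((1 - x) * geom N x) - x); first by ncring.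
  by rewrite g1 mulr1 subrr.
move=> h; have hC : circ false (loop c i w) (loop c i u) = 0.
  by move: h; rewrite /circ !mulr0n !addr0 addrC.
move: us uA wA h hC; rewrite /adjA ir => us uA wA h hC.
case: ifP => hu; case: ifP => hw; try (exfalso; lia).
  exact: (key _ _ (lN _ _) hC).2.
exact: (key _ _ (lN _ _) h).1.
Qed.
End TypeA.

Section Cayley.
Variable H : pzRingType.

(** Since a^2 = b^2 = 0, 1 + 2a and 1 + 2b are the Cayley transforms
(1 + x)/(1 - x) of a and b.  Conjugating 2b by 1 - a and rescaling it by the
inverse T of 1 - g^2 changes the product of the two into M = (1 - g)/(1 + g),
the inverse of the Cayley transform of g. *)
Lemma cayley_triple (a b G T : H) : a * a = 0 -> b * b = 0 ->
    let g := - (a + b) in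
    (1 - g) * G = 1 -> G * (1 - g) = 1 ->
    (1 - g * g) * T = 1 -> T * (1 - g * g) = 1 ->
  circ true (a + a) (circ true (T * (1 - a) * (b + b) * (1 + a)) ((g + g) * G)) = 0.
Proof.
move=> aa bb g gG Gg gT Tg.
have gg : g * g = a * b + b * a.
  transitivity (a * a + b * b + (a * b + b * a)); first by rewrite /g; ncring.
  by rewrite aa bb; ncring.
have commT x : (1 - g * g) * x = x * (1 - g * g) -> T * x = x * T.
  move=> h; have : T * ((1 - g * g) * x) * T = T * (x * (1 - g * g)) * T by rewrite h.
  by rewrite !mulrA Tg mul1r -!mulrA gT mulr1.
have Ta : T * a = a * T.
  apply: commT; rewrite gg.
  transitivity (a - a * b * a - b * (a * a)); first by ncring.
  by transitivity (a - a * b * a - (a * a) * b); [rewrite aa | ]; ncring.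
have Tgc : T * g = g * T by apply: commT; ncring.
pose M := (1 + (a + a)) * (1 + T * (1 - a) * (b + b) * (1 + a)).
have ME : M = T * (1 - g) * (1 - g).
  have E1 : (1 + (a + a)) * (T * (1 - a)) = T * (1 + a).
    transitivity (T + T * a + (a * T - T * a) + (a * T - T * a)
        - (a * T) * a - (a * T) * a); first by ncring.
    rewrite -Ta -!mulrA aa; ncring.
  transitivity (T * ((1 - g * g) * (1 + (a + a)) + (1 + a) * (b + b) * (1 + a))).
    rewrite mulrDr !mulrA Tg mul1r -E1 /M; ncring.
  rewrite -[RHS]mulrA; congr (_ * _); rewrite {1}gg /g.
  transitivity (1 + a + a - a * b - b * a - a * b * a - a * b * a - b * (a * a) - b * (a * a)
     + b + b + a * b + a * b + b * a + b * a + a * b * a + a * b * a).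
    by ncring.
  rewrite aa; transitivity (1 + (a + b) + (a + b) + a * a + b * b + (a * b + b * a)); last by ncring.
  by rewrite aa bb; ncring.
have CE : 1 + (g + g) * G = (1 + g) * G.
  transitivity ((1 - g) * G + (g + g) * G); first by rewrite gG.
  by ncring.
rewrite circA; transitivity (M * (1 + (g + g) * G) - 1).
  by rewrite /circ /M !mulr1n; ncring.
rewrite ME CE; transitivity (T * (1 - g) * ((1 - g) * (1 + g)) * G - 1); first by ncring.
have -> : (1 - g) * (1 + g) = 1 - g * g by ncring.
transitivity (T * (1 - g * g) * ((1 - g) * G) - 1); first by ncring.
by rewrite Tg gG mulr1 subrr.
Qed.
End Cayley.

Section TypeD.
Variables (H : pzRingType) (n : nat) (c : nat -> nat -> H) (e : nat -> H) (h : H).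
Variable sh : nat -> seq nat * bool.
Hypothesis n4 : (4 <= n)%N.
Hypothesis h_half : h + h = 1.
Hypothesis h_central : forall x, h * x = x * h.
Hypothesis c_e : forall i j, e i * c i j = c i j /\ c i j * e j = c i j.
Hypothesis c_orth : forall i j k l, j <> k -> c i j * c k l = 0.
Hypothesis c_adj : forall i j, ~~ adjD n i j -> c i j = 0.
Hypothesis shD : shaped (adjD n) n sh.
Hypothesis rels : forall i, (i < n)%N -> vrel false (loop c i) (sh i).1 (sh i).2.
Local Notation t := (n - 3)%N.

(** With h = 1/2, each 1 + l is replaced by the Cayley transform of l/2.  At a
vertex of valence two this works because the Cayley transforms of x and -x are
inverse to each other.  At t it works by [cayley_triple], for which the arrows
between t and the second leaf y are modified further. *)
Lemma typeD_deform : exists X : nat -> nat -> H,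
  [/\ forall i j, e i * X i j * e j = X i j,
      forall i j, higher c (X i j - c i j)
    & forall i, (i < n)%N -> vrel true (loop X i) (sh i).1 (sh i).2].
Proof.
have nS : nilS (arrows_from n c 0) by apply: (D_nil c_orth rels).
have [|N N0 lN] := nilS_loops nS.
  by move=> i j nij; apply: c_adj; rewrite /adjD /edgeD; lia.
have hh (x : H) : h * x + h * x = x by rewrite -mulrDl h_half mul1r.
have [x [y [pxy xy shR]]] := D_perm n4 shD.
have xyE i : i \in [:: x; y] -> i \in [:: n.-1; n.-2].
  by rewrite (perm_mem pxy) !inE orbC.
have xE := xyE x (mem_head _ _).
have yE : y \in [:: n.-1; n.-2] by apply: xyE; rewrite !inE eqxx orbT.
have [tx ty zt] : [/\ (t < x)%N, (t < y)%N & (t.-1 < t)%N].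
  by move: xE yE; rewrite !inE => xE yE; split; lia.
have sq w : w \in [:: n.-1; n.-2] -> loop c t w * loop c t w = 0.
  exact: (D_leaf' rels n4 shD).
have leaf w : w \in [:: n.-1; n.-2] -> loop c w t = 0.
  exact: (D_leaf rels n4 shD).
pose psi (l : H) := l * geom N (h * l).
have psi0 : psi 0 = 0 by rewrite /psi mul0r.
have psi_sq0 l : l * l = 0 -> psi l = l.
  move=> ll; rewrite /psi /geom; case: (N) N0 => // m _.
  rewrite big_ord_recl expr0 mulrDr mulr1 mulr_sumr big1 ?addr0 // => i _.
  by rewrite exprS !mulrA -h_central -(mulrA h) ll mulr0 mul0r.
(* For q = false the circle inverse is the opposite, so the relation at t says
   that the three g w sum to 0. *)
pose g := tilde (loop c t) (fun w => - loop c t w) (sh t).1 (sh t).2.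
have gS w : g w = loop c t w \/ g w = - loop c t w.
  by rewrite /g /tilde; case: ifP; [right | left].
have gsq w : w \in [:: n.-1; n.-2] -> g w * g w = 0.
  by move=> wE; have [->|->] := gS w; rewrite ?mulrNN sq.
have XN (u : H) : u ^+ N = 0 -> (- u) ^+ N = 0 by rewrite exprNn => ->; rewrite mulr0.
have gN w : g w ^+ N = 0 by case: (gS w) => ->; [|apply: XN]; apply: lN.
have hN u : higher c u -> higher c (- u).
  by move=> hu; rewrite -[- u]mulN1r; apply: higherMl.
have ghigher w : higher c (g w).
  by case: (gS w) => ->; [|apply: hN]; apply: higher_loop.
have gz : g t.-1 = - (g x + g y).
  have c0 (u : H) : circ false u (- u) = 0 /\ circ false (- u) u = 0.
    by rewrite /circ !mulr0n !addr0 subrr addNr.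
  have := D_tri rels n4 shD pxy xy shR (fun w _ => c0 (loop c t w)).
  rewrite /= -/g /circ !mulr0n !addr0 => E; rewrite -[RHS]addr0 -E.
  by ncring.
have [al alE] : exists u, u = h * g x by eexists.
have [be beE] : exists u, u = h * g y by eexists.
have [ga gaD] : exists u, u = h * g t.-1 by eexists.
have gaE : ga = - (al + be) by rewrite gaD alE beE gz mulrN mulrDr.
have hMM u v : (h * u) * (h * v) = h * h * (u * v).
  by rewrite mulrA -(mulrA h) -h_central !mulrA.
have al2 : al * al = 0 by rewrite alE hMM gsq ?mulr0.
have be2 : be * be = 0 by rewrite beE hMM gsq ?mulr0.
have hX u k : (h * u) ^+ k = h ^+ k * u ^+ k by apply/exprMn_comm/h_central.
have gaN : ga ^+ N = 0 by rewrite gaD hX gN mulr0.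
have gagaN : (ga * ga) ^+ N = 0 by rewrite -expr2 -exprM mulnC exprM gaN expr2 mulr0.
have [G1 G2] := geom_inv gaN; have [T1 T2] := geom_inv gagaN.
pose T := geom N (ga * ga).
have gaga : ga * ga = al * be + be * al.
  transitivity (al * al + be * be + (al * be + be * al)); first by rewrite gaE; ncring.
  by rewrite al2 be2; ncring.
have Tal : al * T = T * al.
  apply: geom_comm; rewrite /GRing.comm gaga mulrDr mulrDl !mulrA al2 mul0r add0r.
  by rewrite -(mulrA be) al2 mulr0 addr0.
have Tbe : be * T = T * be.
  apply: geom_comm; rewrite /GRing.comm gaga mulrDr mulrDl !mulrA be2 mul0r addr0.
  by rewrite -(mulrA al) be2 mulr0 add0r.
(* This makes the closed path at t through y equal to T (1 - al) l (1 + al), the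
   second factor in [cayley_triple]. *)
pose X (i j : nat) := if (i == t) && (j == y) then T * (1 - al) * c t y
  else if (i == y) && (j == t) then c y t * (1 + al)
  else if (i < j)%N then c i j * geom N (h * loop c j i) else c i j.
have swap i j : c i j * geom N (h * loop c j i) = geom N (h * loop c i j) * c i j.
  by rewrite /loop mulrA geom_swap mulrA -h_central mulrA.
have loopX i j : i <> j -> ~~ ((i == t) && (j == y)) -> ~~ ((i == y) && (j == t)) ->
    loop X i j = psi (loop c i j).
  move=> ij n1 n2; rewrite {1}/loop /X (negPf n1) (negPf n2) (andbC (j == t)) (negPf n2).
  rewrite (andbC (j == y)) (negPf n1) /psi; case: (ltngtP i j) => // _.
    rewrite swap -mulrA -/(loop c i j); apply/esym/geom_comm.
    by rewrite /GRing.comm mulrA h_central.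
  by rewrite mulrA.
have loopXty : loop X t y = T * (1 - al) * loop c t y * (1 + al).
  rewrite /loop /X !eqxx /=; have -> : (y == t) = false by lia.
  by rewrite !mulrA.
have loopXyt : loop X y t = 0.
  rewrite /loop /X !eqxx /=; have -> : (y == t) = false by lia.
  have -> : c y t * (1 + al) * (T * (1 - al) * c t y) = c y t * T * c t y.
    transitivity (c y t * (T * (1 - al) + al * T - (al * T) * al) * c t y); first by ncring.
    by rewrite Tal -(mulrA T) al2; ncring.
  have lyt : c y t * c t y = 0 by exact: leaf.
  have cl : c y t * loop c t y = 0 by rewrite /loop mulrA lyt mul0r.
  have lc : loop c t y * c t y = 0 by rewrite /loop -mulrA lyt mulr0.
  have cb : c y t * be = 0.
    rewrite beE mulrA -h_central -mulrA.
    by case: (gS y) => ->; rewrite ?mulrN cl mulr0 ?oppr0.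
  have bc : be * c t y = 0.
    rewrite beE -mulrA.
    by case: (gS y) => ->; rewrite ?mulNr lc ?oppr0 ?mulr0 ?oppr0.
  rewrite /T /geom mulr_sumr mulr_suml big1 // => -[k _] _ /=; case: k => [|k].
    by rewrite expr0 mulr1.
  have beX : be * (ga * ga) ^+ k = (ga * ga) ^+ k * be.
    apply: commrX; rewrite /GRing.comm gaga mulrDr mulrDl !mulrA be2 mul0r addr0.
    by rewrite -(mulrA al) be2 mulr0 add0r.
  rewrite exprS mulrA {1}gaga mulrDr !mulrA cb !mul0r addr0.
  by rewrite -(mulrA _ be) beX !mulrA -(mulrA _ be) bc mulr0.
have psi1 l : l ^+ N = 0 -> circ true (psi l) (psi (- l)) = 0.
  move=> lN0; pose m := h * l.
  have lm : l = m + m by rewrite /m hh.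
  have mN : m ^+ N = 0 by rewrite hX lN0 mulr0.
  have [g1 g2] := geom_inv mN.
  have [|g3 g4] := @geom_inv _ N (- m); first exact: XN.
  rewrite /psi mulrN -/m lm /circ mulr1n.
  transitivity (((1 - m) * geom N m + (m + m) * geom N m) *
     ((1 - - m) * geom N (- m) - (m + m) * geom N (- m)) - 1).
    by rewrite g1 g3; ncring.
  have -> : ((1 - - m) * geom N (- m) - (m + m) * geom N (- m)) = (1 - m) * geom N (- m).
    by ncring.
  have gm : (1 - m) * geom N (- m) = geom N (- m) * (1 - m).
    apply: geom_comm; rewrite /GRing.comm; ncring.
  transitivity ((1 - - m) * (geom N m * ((1 - m) * geom N (- m))) - 1); first by ncring.
  by rewrite (mulrA (geom N m)) g2 mul1r g3 subrr.
exists X; split=> [i j|i j|i ni].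
- have lE : e i * X i j = X i j.
    rewrite /X; case: ifP => [/andP[/eqP -> _]|_].
      have eg w : e t * g w = g w * e t.
        case: (gS w) => ->; rewrite ?mulrN ?mulNr /loop mulrA (c_e t w).1;
        by rewrite -mulrA (c_e w t).2.
      have ea : GRing.comm (e t) al by rewrite /GRing.comm alE -mulrA -eg !mulrA h_central.
      have eT : GRing.comm (e t) T.
        have eg' : GRing.comm (e t) ga by rewrite /GRing.comm gaD -mulrA -eg !mulrA h_central.
        by apply/geom_comm/commrM.
      rewrite mulrA (commrM eT (commrB (commr1 _) ea)) -!mulrA (c_e t y).1 !mulrA.
      by [].
    by case: ifP => [/andP[/eqP -> _]|_]; [|case: ifP]; rewrite ?mulrA (c_e _ _).1.
  have rE : X i j * e j = X i j.
    rewrite /X; case: ifP => [/andP[_ /eqP ->]|_].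
      by rewrite -mulrA (c_e t y).2.
    case: ifP => [/andP[_ /eqP ->]|_]; last first.
      by rewrite swap; case: ifP => _; rewrite -?mulrA (c_e i j).2.
    have eg w : e t * g w = g w * e t.
      case: (gS w) => ->; rewrite ?mulrN ?mulNr /loop mulrA (c_e t w).1;
      by rewrite -mulrA (c_e w t).2.
    rewrite mulrDr mulr1 mulrDl (c_e y t).2 alE; congr (_ + _).
    by rewrite -!mulrA -eg (mulrA h) h_central !mulrA (c_e y t).2.
  by rewrite lE rE.
- have hal : higher c al by rewrite alE; apply/higherMl.
  rewrite /X; case: ifP => [/andP[/eqP -> /eqP ->]|_].
    have -> : T * (1 - al) * c t y - c t y = ((T - 1) + (- (T * al))) * c t y by ncring.
    apply/higherMr/higherD; last exact/hN/higherMl.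
    by apply: geom_higher => //; rewrite {2}gaD; apply/higherMl/higherMl.
  case: ifP => [/andP[/eqP -> /eqP ->]|_].
    by rewrite mulrDr mulr1 addrAC subrr add0r; apply: higherMl.
  case: ifP => _; last by rewrite subrr; apply: higher0.
  rewrite -[X in _ - X]mulr1 -mulrBr.
  by apply/higherMl/geom_higher/higherMl/higher_loop.
have [it|it|it] := ltngtP i t.
- have := rels ni; have := shD ni; case: (sh i) => s par /= sp.
  have sE w : w \in s -> adjD n i w by rewrite (perm_mem sp) mem_filter => /andP[].
  have s2 : (size s <= 2)%N.
    apply: (@uniq_leq_size _ s [:: i.-1; i.+1]).
      by rewrite (perm_uniq sp) filter_uniq ?iota_uniq.
    by move=> w /sE; rewrite /adjD /edgeD !inE; lia.
  have nbE w : w \in s -> loop X i w = psi (loop c i w).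
    by move=> /sE; rewrite /adjD /edgeD => iw; apply: loopX; lia.
  case: par => [|/=].
    by apply: (@vrel_par _ _ false true (loop c i) _ psi).
  case: s s2 nbE {sE sp} => [|u [|w []]] //= _ nbE; rewrite !circr0.
    by rewrite nbE ?mem_head // => ->.
  rewrite !nbE ?mem_head //; last by rewrite !inE eqxx orbT.
  rewrite {1}/circ mulr0n addr0 => E.
  have -> : loop c i w = - loop c i u by rewrite -[RHS]addr0 -E addKr.
  exact/psi1/lN.
- have iE : i \in [:: n.-1; n.-2] by rewrite !inE; lia.
  have lX0 : loop X i t = 0.
    have [->|iy] := eqVneq i y; first exact: loopXyt.
    by rewrite loopX ?leaf ?psi0 //; lia.
  have := shD ni; case: (sh i) => s par /= sp.
  have sp1 : perm_eq s [:: t].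
    apply: perm_trans sp _; apply: filter_iota1 => [|w nw]; first by lia.
    by move: iE; rewrite !inE /adjD /edgeD; lia.
  by rewrite (@perm_small_eq _ _ [:: t] isT sp1); case: par; rewrite //= circr0.
rewrite it; have zt1 : t.-1 <> t by lia.
have hU : uniq [:: x; y; t.-1].
  by rewrite !inE in xE yE; rewrite /= !inE negb_or; lia.
have fx : loop X t x = loop c t x.
  by rewrite loopX ?psi_sq0 ?sq //; lia.
have fz : loop X t t.-1 = psi (loop c t t.-1).
  by apply: loopX; lia.
(* circle inverses of the closed paths at t *)
pose fi w := if w == x then - loop c t x else if w == y then
  T * (1 - al) * - loop c t y * (1 + al) else psi (- loop c t w).
have yx : (y == x) = false by rewrite eq_sym; apply/negbTE.
have zx : (t.-1 == x) = false by lia.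
have zy : (t.-1 == y) = false by lia.
have E := @vrel_tilde H true _ (loop X t) fi (sh t).1 (sh t).2 x y t.-1 hU shR.
apply/E; last first.
  have gE w (cw : H) (dw : H) : loop X t w = cw -> fi w = dw ->
      tilde (loop X t) fi (sh t).1 (sh t).2 w =
      if (sh t).2 && (w == head w (sh t).1) then dw else cw.
    by move=> <- <-.
  rewrite (gE x _ (- loop c t x) fx) /fi ?eqxx //.
  rewrite (gE y _ (T * (1 - al) * - loop c t y * (1 + al)) loopXty) /fi ?yx ?eqxx //.
  rewrite (gE t.-1 _ (psi (- loop c t t.-1)) fz) /fi ?zx ?zy //.
  have -> : (if (sh t).2 && (x == head x (sh t).1) then - loop c t x else loop c t x) = al + al.
    by rewrite alE hh.
  have -> : (if (sh t).2 && (y == head y (sh t).1) then T * (1 - al) * - loop c t y * (1 + al)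
    else T * (1 - al) * loop c t y * (1 + al)) = T * (1 - al) * (be + be) * (1 + al).
    by rewrite beE hh /g /tilde; case: ifP.
  have -> : (if (sh t).2 && (t.-1 == head t.-1 (sh t).1) then psi (- loop c t t.-1) else
    psi (loop c t t.-1)) = (ga + ga) * geom N ga.
    by rewrite gaD hh /psi /g /tilde; case: ifP.
  by have := cayley_triple al2 be2; rewrite /= -gaE; apply.
move=> w; rewrite !inE => /or3P[] /eqP ->; rewrite /fi ?eqxx ?yx ?zx ?zy.
- rewrite fx; have [c1 c2] := circN true (sq _ xE).
  by split=> //; apply/sq0_nilelt/sq.
- have BB : loop X t y * loop X t y = 0.
    have lT : loop c t y * T = T * loop c t y.
      have gT : g y * T = T * g y by rewrite -(hh (g y)) -beE mulrDl mulrDr Tbe.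
      have [<-//|gE] := gS y; have -> : loop c t y = - g y by rewrite gE opprK.
      by rewrite mulNr mulrN gT.
    have TT : (1 + al) * (T * (1 - al)) = T.
      transitivity (T + (al * T - T * al) - (al * T) * al); first by ncring.
      by rewrite Tal -(mulrA T) al2 subrr mulr0 addr0 subr0.
    rewrite loopXty; transitivity (T * (1 - al) * (loop c t y * ((1 + al) * (T * (1 - al))))
      * loop c t y * (1 + al)); first by ncring.
    rewrite TT lT.
    transitivity (T * (1 - al) * T * (loop c t y * loop c t y) * (1 + al)); first by ncring.
    by rewrite (sq _ yE) mulr0 mul0r.
  have -> : T * (1 - al) * - loop c t y * (1 + al) = - loop X t y.
    by rewrite loopXty mulrN mulNr.
  by have [c1 c2] := circN true BB; split=> //; apply/sq0_nilelt.
rewrite fz; split; last by rewrite -{2}[loop c t t.-1]opprK psi1 // XN.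
  exists N; rewrite /psi exprMn_comm ?lN ?mul0r //.
  by apply: geom_comm; rewrite /GRing.comm mulrA h_central.
exact/psi1.
Qed.
End TypeD.

(** * Filtration of a path algebra by path length *)

Section Length.
Variables (K : fieldType) (V : finType) (Q : gquiver V).
Local Notation A := (pathalg K Q).
Local Notation wbase := (wbase K).
Local Notation pgen := (pgen K).
Local Notation e := (pidem K Q).
Implicit Types (x y z : A) (v : V) (s : seq (arrow Q)) (a b : arrow Q).

Definition deep (m : nat) x : Prop := forall p, p \in msupp x -> (m <= size (pword p))%N.

Lemma deepP m x : deep m x <-> forall p, x@_p != 0 -> (m <= size (pword p))%N.
Proof. by split=> h p; have := h p; rewrite mcoeff_neq0. Qed.

Lemma deep0 m : deep m 0.
Proof. by move=> p; rewrite msupp0. Qed.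

Lemma deepL m c x y : deep m x -> deep m y -> deep m (c *: x + y).
Proof.
move=> /deepP hx /deepP hy; apply/deepP => p.
rewrite mcoeffD mcoeffZ; have [/eqP x0|/hx//] := boolP (x@_p == 0).
by rewrite x0 mulr0 add0r => /hy.
Qed.

Lemma deepD m x y : deep m x -> deep m y -> deep m (x + y).
Proof. by move=> hx hy; rewrite -[x]scale1r; apply: deepL. Qed.

Lemma deepZ m c x : deep m x -> deep m (c *: x).
Proof. by move=> hx; rewrite -[_ *: _]addr0; apply/deepL/deep0. Qed.

Lemma deepN m x : deep m x -> deep m (- x).
Proof. by move=> hx; rewrite -scaleN1r; apply: deepZ. Qed.

Lemma deepB m x y : deep m x -> deep m y -> deep m (x - y).
Proof. by move=> hx hy; apply/deepD/deepN. Qed.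

Lemma deep_sum m (I : Type) (r : seq I) (P : pred I) (F : I -> A) :
  (forall j, P j -> deep m (F j)) -> deep m (\sum_(j <- r | P j) F j).
Proof. exact: (big_ind _ (deep0 m) (@deepD m)). Qed.

Lemma deep_mono m n x : deep n x -> (m <= n)%N -> deep m x.
Proof. by move=> hx mn p /hx; apply: leq_trans. Qed.

Lemma deep_any x : deep 0 x.
Proof. by []. Qed.

Lemma deep_wbase v s : deep (size s) (wbase v s).
Proof.
have [vs|/(wbase0 K)->] := boolP (is_word v s); last exact: deep0.
move=> p; rewrite (wbaseE K vs) => /(fsubsetP msuppU_le).
by rewrite inE => /eqP ->.
Qed.

Lemma deep_word m v s : (m <= size s)%N -> deep m (wbase v s).
Proof. by move=> ms p /deep_wbase; apply: leq_trans. Qed.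

Lemma supp_ind x (S : A -> Prop) :
  S 0 -> (forall c y z, S y -> S z -> S (c *: y + z)) ->
  (forall v s (vs : is_word v s), (@QPath V Q (v, s) vs) \in msupp x -> S (wbase v s)) -> S x.
Proof.
move=> S0 SP Sw; rewrite [x]pathalgE big_seq.
elim/big_rec: _ => // p y px Sy; apply: SP => //.
rewrite -wbase_val; apply: (Sw _ _ (qpathP p)).
have -> : @QPath V Q (psrc p, pword p) (qpathP p) = p.
  by apply: val_inj; rewrite /= [RHS]surjective_pairing.
exact: px.
Qed.

Lemma deep_ind m x (S : A -> Prop) : deep m x ->
  S 0 -> (forall c y z, S y -> S z -> S (c *: y + z)) ->
  (forall v s, is_word v s -> (m <= size s)%N -> S (wbase v s)) -> S x.
Proof. by move=> hx S0 SP Sw; apply: supp_ind => // v s vs /hx; apply: Sw. Qed.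

Lemma homog_ind i x (S : A -> Prop) : pahomog i x ->
  S 0 -> (forall c y z, S y -> S z -> S (c *: y + z)) ->
  (forall v s, is_word v s -> \sum_(a <- s) adeg a = i -> S (wbase v s)) -> S x.
Proof. by move=> hx S0 SP Sw; apply: supp_ind => // v s vs /hx; apply: Sw. Qed.

Lemma homog_deep_ind i m x (S : A -> Prop) : pahomog i x -> deep m x ->
  S 0 -> (forall c y z, S y -> S z -> S (c *: y + z)) ->
  (forall v s, is_word v s -> \sum_(a <- s) adeg a = i -> (m <= size s)%N -> S (wbase v s)) -> S x.
Proof.
by move=> hx dx S0 SP Sw; apply: supp_ind => // v s vs px; apply: Sw (hx _ px) (dx _ px).
Qed.

Lemma deepM m n x y : deep m x -> deep n y -> deep (m + n)%N (x * y).
Proof.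
move=> hx hy; apply: (deep_ind (S := fun x => deep (m + n)%N (x * y)) hx).
- by rewrite mul0r; apply: deep0.
- by move=> c x1 x2 h1 h2; rewrite mulrDl -scalerAl; apply: deepL.
move=> v s vs ms; apply: (deep_ind (S := fun y => deep (m + n)%N (wbase v s * y)) hy).
- by rewrite mulr0; apply: deep0.
- by move=> c x1 x2 h1 h2; rewrite mulrDr -scalerAr; apply: deepL.
move=> w t wt nt; rewrite wbaseM //; case: ifP => _; last exact: deep0.
by apply: deep_word; rewrite size_cat leq_add.
Qed.

Lemma deepMl m x y : deep m y -> deep m (x * y).
Proof. by move=> hy; rewrite -[m]add0n; apply: deepM. Qed.

Lemma deepMr m x y : deep m x -> deep m (x * y).
Proof. by move=> hx; rewrite -[m]addn0; apply: deepM. Qed.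

Lemma deep_sign m n x : deep m x -> deep m ((-1) ^+ n * x).
Proof. exact: deepMl. Qed.

Lemma deep_pgen a : deep 1 (pgen a).
Proof. exact: deep_wbase. Qed.

(** The coordinates in [ldiv_decomp]: removes a from the head of the word. *)
Definition ldiv a : A -> A := lext (fun p =>
  if pword p is b :: s then (if a == b then wbase (psrc p) s else 0) else 0).
HB.instance Definition _ a := GRing.Linear.on (ldiv a).

Lemma ldiv_word a v s : is_word v s -> ldiv a (wbase v s) =
  if s is b :: s' then (if a == b then wbase v s' else 0) else 0.
Proof. by move=> vs; rewrite (wbaseE K vs) /ldiv lextU. Qed.

Lemma pgen_word b v s : is_word v s ->
  pgen b * wbase v s = if asrc b == word_tgt v s then wbase v (b :: s) else 0.
Proof. by move=> vs; rewrite wbaseM //= eqxx. Qed.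

Lemma pidem_word w v s : is_word v s ->
  e w * wbase v s = if w == word_tgt v s then wbase v s else 0.
Proof. by move=> vs; rewrite wbaseM. Qed.

Lemma ldiv_pgen a b x : ldiv a (pgen b * x) = if a == b then e (asrc a) * x else 0.
Proof.
elim/pathalg_ind: x => [|c x y hx hy|v s vs].
- by rewrite !mulr0 linear0; case: ifP.
- rewrite mulrDr -scalerAr linearP /= hx hy; case: ifP => _.
    by rewrite mulrDr -scalerAr.
  by rewrite scaler0 addr0.
rewrite pgen_word //; case: eqP => [h|/eqP/negPf h].
  rewrite ldiv_word /= ?h ?eqxx //; case: eqP => // ->.
  by rewrite pidem_word // h eqxx.
by rewrite linear0; case: eqP => // ->; rewrite pidem_word // h.
Qed.

Lemma pidem_ldiv a x : e (asrc a) * ldiv a x = ldiv a x.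
Proof.
elim/pathalg_ind: x => [|c x y hx hy|v s vs].
- by rewrite linear0 mulr0.
- by rewrite linearP /= mulrDr -scalerAr hx hy.
rewrite ldiv_word //; case: s vs => [|b s] /=; first by rewrite mulr0.
case/andP=> /eqP h vs; case: eqP => [->|_]; last by rewrite mulr0.
by rewrite pidem_word // h eqxx.
Qed.

Lemma ldiv_deep m a x : deep m.+1 x -> deep m (ldiv a x).
Proof.
move=> hx; apply: (deep_ind (S := fun x => deep m (ldiv a x)) hx).
- by rewrite linear0; apply: deep0.
- by move=> c y z hy hz; rewrite linearP; apply: deepL.
move=> v [|b s] vs // ms; rewrite ldiv_word //; case: ifP => _; last exact: deep0.
exact: deep_word.
Qed.

Lemma ldiv_homog i a x : pahomog i x -> pahomog (i - adeg a) (ldiv a x).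
Proof.
move=> hx; apply: (homog_ind (S := fun x => pahomog (i - adeg a) (ldiv a x)) hx).
- by rewrite linear0; apply: pahomog0.
- by move=> c y z hy hz; rewrite linearP; apply: pahomogL.
move=> v [|b s] vs; rewrite ldiv_word //; first by move=> _; apply: pahomog0.
rewrite big_cons; case: eqP => [->|] h; last by move=> _; apply: pahomog0.
by rewrite -h addrAC subrr add0r; apply: pahomog_wbase.
Qed.

Lemma ldiv_decomp x : deep 1 x -> x = \sum_a pgen a * ldiv a x.
Proof.
move=> hx; apply: (deep_ind (S := fun x => x = \sum_a pgen a * ldiv a x) hx).
- by rewrite big1 // => a _; rewrite linear0 mulr0.
- move=> c y z hy hz; rewrite {1}hy {1}hz scaler_sumr -big_split; apply: eq_bigr => a _ /=.
  by rewrite linearP mulrDr -scalerAr.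
move=> v [|b s] vs // _; rewrite (bigD1 b) //= ldiv_word // eqxx big1 ?addr0.
  by rewrite -wbase_cons.
by move=> a /negPf ab; rewrite ldiv_word // ab mulr0.
Qed.

End Length.

(** * Cocycles made of long paths *)

Section Acyclic.
Variables (K : fieldType) (V : finType) (Q : gquiver V).
Local Notation A := (pathalg K Q).
Local Notation wbase := (wbase K).
Local Notation pgen := (pgen K).
Local Notation e := (pidem K Q).
Implicit Types (x y z : A) (v : V) (s : seq (arrow Q)) (a b : arrow Q).
Variable delta : arrow Q -> A.
Hypotheses (deltaE : delta_bimod delta) (delta_hom : delta_deg delta).
Hypothesis delta_sq : delta_square delta.
Local Notation D := (qfree_diff delta).

Hypothesis Qdeg : forall a, adeg a = 0 \/ adeg a = -1.
Hypothesis delta_deep : forall a, deep 2 (delta a).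

Lemma word_deg_le0 s : \sum_(a <- s) adeg a <= 0.
Proof. by apply: sumr_le0 => a _; case: (Qdeg a) => ->. Qed.

Lemma word_deg0 s : \sum_(a <- s) adeg a = 0 -> forall a, a \in s -> adeg a = 0.
Proof.
elim: s => // b s IHs; rewrite big_cons => h.
have s0 := word_deg_le0 s; have b0 : adeg b <= 0 by case: (Qdeg b) => ->.
move/eqP: h; rewrite naddr_eq0 // => /andP[/eqP hb /eqP hs].
by move=> a; rewrite inE => /predU1P[->//|]; apply: IHs.
Qed.

Lemma homog_pos i x : 0 < i -> pahomog i x -> x = 0.
Proof.
move=> i0 hx; apply: (homog_ind (S := fun x => x = 0) hx) => //.
  by move=> c y z -> ->; rewrite scaler0 addr0.
by move=> v s _ h; have := word_deg_le0 s; rewrite h leNgt i0.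
Qed.

Lemma delta_degree0 a : adeg a = 0 -> delta a = 0.
Proof. by move=> a0; apply: homog_pos (@delta_hom a); rewrite a0. Qed.

Lemma diff_homog0 x : pahomog 0 x -> D x = 0.
Proof. by move=> hx; apply: (homog_pos (i := 1)) => //; apply: (qfree_diff_homog delta_hom hx). Qed.

Lemma word_homog0 v s : (forall a, a \in s -> adeg a = 0) -> pahomog 0 (wbase v s).
Proof.
move=> s0; have := @pahomog_wbase K V Q v s; rewrite big_seq big1 // => a /s0.
Qed.

Lemma diff_leibniz i x y : pahomog i x -> D (x * y) = D x * y + (-1) ^+ `|i|%N * (x * D y).
Proof. exact: qfree_leibniz. Qed.

Lemma diff_mul0 x y : pahomog 0 x -> D (x * y) = x * D y.
Proof. by move=> hx; rewrite (diff_leibniz _ hx) diff_homog0 // mul0r add0r mul1r. Qed.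

Lemma diff_mul1 x y : pahomog (-1) x -> D (x * y) = D x * y - x * D y.
Proof. by move=> hx; rewrite (diff_leibniz _ hx) expr1 mulN1r. Qed.

Lemma diff_idem v x : D (e v * x) = e v * D x.
Proof. by apply/diff_mul0/pahomog_pidem. Qed.

Lemma diff_deepS m x : deep m x -> deep m.+1 (D x).
Proof.
move=> hx; apply: (deep_ind (S := fun x => deep m.+1 (D x)) hx).
- by rewrite linear0; apply: deep0.
- by move=> c y z hy hz; rewrite linearP; apply: deepL.
move=> v s vs ms; rewrite qfree_diff_word //.
have: deep (size s).+1 (dword delta v s).
  elim: s {vs ms} => [|a s IHs] /=; first exact: deep0.
  rewrite -addn2 addnC; apply: deepD; first by apply/deepM/deep_wbase.
  by apply: deep_sign; rewrite add2n -add1n; apply/deepM/IHs/deep_pgen.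
by move/deep_mono; apply.
Qed.

Lemma diff_deep m x : deep m x -> deep m (D x).
Proof. by move/diff_deepS/deep_mono; apply; apply: leqnSn. Qed.

(** A nonzero delta b is a combination of nontrivial paths of degree 0, whose
words do not have an arrow of degree -1 at the head. *)
Lemma ldiv_delta c b y : adeg c = -1 -> ldiv c (delta b * y) = 0.
Proof.
move=> c1; case: (Qdeg b) => [/delta_degree0->|b1]; first by rewrite mul0r linear0.
have hb : pahomog 0 (delta b) by have := @delta_hom b; rewrite b1 addNr.
apply: (homog_deep_ind (S := fun x => ldiv c (x * y) = 0) hb (@delta_deep b)).
- by rewrite mul0r linear0.
- by move=> k u w hu hw; rewrite mulrDl -scalerAl linearP /= hu hw scaler0 addr0.
move=> v [|a s] // vs h _; rewrite wbase_cons // -mulrA ldiv_pgen; case: eqP => // ca.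
by have := word_deg0 h (mem_head _ _); rewrite -ca c1.
Qed.

Lemma ldiv_diff b x : deep 1 x ->
  ldiv b (D x) = \sum_a ldiv b (delta a * ldiv a x) + (-1) ^+ `|adeg b|%N * D (ldiv b x).
Proof.
move=> hx; rewrite {1}(ldiv_decomp hx) !linear_sum /=.
under eq_bigr do rewrite (diff_leibniz _ (@pahomog_pgen K V Q _)) qfree_diff_pgen // linearD.
rewrite big_split /=; congr (_ + _); rewrite (bigD1 b) //= big1 ?addr0.
  rewrite -sign_mulA ldiv_pgen eqxx sign_mulA; congr (_ * _).
  by rewrite -diff_idem pidem_ldiv.
move=> a /negPf ab; rewrite -sign_mulA ldiv_pgen eq_sym ab.
by [].
Qed.

Variable N : nat.
Hypothesis deadN : forall v s, is_word v s -> size s = N ->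
  (forall a, a \in s -> adeg a = 0) -> exists2 w, pahomog (-1) w & wbase v s = D w.

(** Deep in the filtration by path length there is no cohomology in degrees below
1.  In degree 1 there is nothing, whence the start of the induction on i.  For
the step it is shown, by descending induction on the length k of a path u of
degree 0, that u * x is a coboundary.  If k = N, then u = D w and
u * x = D (w * x).  Otherwise decompose x into the a * x_a.  For c of degree -1,
x_c is a deep cocycle of degree one higher, so x_c = D b_c.  Adding
D (sum of the c * b_c) to x removes these components, and the remaining terms
u * a * x_a involve the paths u * a of length k + 1. *)
Lemma acyclic_deep (i : nat) : forall m', exists m, forall x, pahomog (1 - i%:Z) x ->
  D x = 0 -> deep m x -> exists y, [/\ pahomog (- i%:Z) y, deep m' y & x = D y].
Proof.
elim: i => [|i IHi] m'.
  exists 0%N => x /(homog_pos (i := 1 - 0)) -> // _ _.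
  by exists 0; split; [apply: pahomog0 | apply: deep0 | rewrite linear0].
pose d : int := 1 - i.+1%:Z; pose d1 : int := - i.+1%:Z.
have d1E : d - 1 = d1 by rewrite /d /d1; lia.
have dE : d + 1 = 1 - i%:Z by rewrite /d; lia.
have dE' : d = - i%:Z by rewrite /d; lia.
pose good k := forall m', exists m, forall v u x, is_word v u -> size u = k ->
  (forall a, a \in u -> adeg a = 0) -> pahomog d x -> D x = 0 -> deep m x -> e v * x = x ->
  exists y, [/\ pahomog d1 y, deep m' y & wbase v u * x = D y].
have goodN : good N.
  move=> m2; exists m2 => v u x vu su u0 hx Dx mx ex.
  have [w hw wE] := deadN vu su u0; exists (w * x); split.
  - by rewrite -d1E addrC; apply: pahomogM.
  - exact: deepMl.
  by rewrite diff_mul1 // Dx mulr0 subr0 wE.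
have good_step k : good k.+1 -> good k.
  move=> gk m2; have [m1 hm1] := gk m2; have [m3 hm3] := IHi (maxn m1 m2).
  exists (maxn m1 m3).+1 => v u x vu su u0 hx Dx mx ex.
  have x1 : deep 1 x by apply: deep_mono mx _.
  have ldx a : deep (maxn m1 m3) (ldiv a x) by apply: ldiv_deep.
  have bex (c : arrow Q) : exists y, [/\ pahomog d y, deep (maxn m1 m2) y &
      if adeg c == -1 then ldiv c x = D y else y = 0].
    case: eqP => c1; last first.
      by exists 0; split; [apply: pahomog0 | apply: deep0 |].
    have [|||y [hy my yE]] := hm3 (ldiv c x).
    - by have := ldiv_homog (a := c) hx; rewrite c1 opprK dE.
    - have := ldiv_diff c x1; rewrite Dx linear0 big1 ?add0r.
        by rewrite c1 expr1 mulN1r => /eqP; rewrite eq_sym oppr_eq0 => /eqP.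
      by move=> a _; apply: ldiv_delta.
    - by apply: deep_mono (ldx c) _; apply: leq_maxr.
    by exists y; rewrite dE'.
  have {bex} [b hb] := fin_all_exists bex.
  pose w := \sum_c pgen c * b c.
  have hw : pahomog d1 w.
    apply: pahomog_sum => c _; have [h1 _] := hb c; case: eqP => [c1|_] h2; last first.
      by rewrite h2 mulr0; apply: pahomog0.
    by rewrite -d1E addrC -c1; apply/pahomogM/h1/pahomog_pgen.
  have mw : deep m2 w.
    apply: deep_sum => c _; apply: deepMl; have [_ h _] := hb c.
    by apply: deep_mono h _; apply: leq_maxr.
  (* z is cohomologous to x, without components along arrows of degree -1 *)
  pose z := x + D w.
  have hz : pahomog d z.
    by apply: pahomogD => //; have := qfree_diff_homog delta_hom hw; rewrite -d1E subrK.
  have Dz : D z = 0 by rewrite linearD /= Dx qfree_diffK // addr0.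
  have zE : z = \sum_(a | adeg a == 0) pgen a * ldiv a x + \sum_c delta c * b c.
    rewrite /z {1}(ldiv_decomp x1) /w linear_sum.
    rewrite (bigID (fun a => adeg a == 0)) /= -addrA; congr (_ + _).
    rewrite big_mkcond -big_split; apply: eq_bigr => c _ /=.
    have [_ _] := hb c; case: (Qdeg c) => c0; rewrite c0 /= => h.
      by rewrite h !mulr0 linear0 addr0.
    by rewrite diff_mul1 ?qfree_diff_pgen // -?c0 -?h; [rewrite addrC subrK | apply: pahomog_pgen].
  have mz : deep m1.+1 z.
    rewrite zE; apply: deepD; apply: deep_sum => a _.
      rewrite -add1n; apply: deepM; first exact: deep_pgen.
      by apply: deep_mono (ldx a) _; apply: leq_maxl.
    have [_ h _] := hb a; apply: (@deep_mono _ _ _ _ (2 + maxn m1 m2)%N); last by lia.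
    exact/deepM.
  have z1 : deep 1 z by apply: deep_mono mz _.
  have ldz a : adeg a = -1 -> ldiv a z = 0.
    move=> a1; rewrite zE linearD !linear_sum /= [X in _ + X]big1 ?addr0.
      apply: big1 => c /eqP c0.
      by rewrite ldiv_pgen; case: eqP => // ac; move: a1; rewrite ac c0.
    by move=> c _; apply: ldiv_delta.
  have Dldz a : D (ldiv a z) = 0.
    case: (Qdeg a) => a0; last by rewrite ldz // linear0.
    have := ldiv_diff a z1; rewrite Dz linear0 big1; first by rewrite a0 mul1r add0r.
    move=> c _; case: (Qdeg c) => c0; first by rewrite delta_degree0 // mul0r linear0.
    by rewrite ldz // mulr0 linear0.
  have yex (a : arrow Q) : exists y, [/\ pahomog d1 y, deep m2 y &
      wbase v u * (pgen a * ldiv a z) = D y].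
    have [a0|a1] := Qdeg a; last first.
      exists 0; split; [exact: pahomog0 | exact: deep0|].
      by rewrite ldz // !mulr0 linear0.
    rewrite mulrA wbaseM /= ?eqxx //; case: eqP => [vE|_]; last first.
      exists 0; split; [exact: pahomog0 | exact: deep0|].
      by rewrite mul0r linear0.
    apply: hm1 => //.
    - by apply: is_word_cat; rewrite /= ?eqxx // -vE.
    - by rewrite size_cat su addn1.
    - by move=> c; rewrite mem_cat inE => /orP[/u0//|/eqP->].
    - by have := ldiv_homog (a := a) hz; rewrite a0 subr0.
    - exact: ldiv_deep.
    exact: pidem_ldiv.
  have {yex} [f hf] := fin_all_exists yex.
  have hu : pahomog 0 (wbase v u) by apply: word_homog0.
  exists (\sum_a f a - wbase v u * w); split.
  - apply: pahomogD; first by apply: pahomog_sum => a _; case: (hf a).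
    by apply: pahomogN; rewrite -[d1]add0r; apply: pahomogM.
  - apply: deepB; first by apply: deep_sum => a _; case: (hf a).
    exact: deepMl.
  rewrite linearB /= diff_mul0 // -[LHS](addrK (wbase v u * D w)) -mulrDr -/z.
  congr (_ - _); rewrite {1}(ldiv_decomp z1) mulr_sumr linear_sum.
  by apply: eq_bigr => a _; case: (hf a).
have good0 : good 0%N.
  suff: forall k, (k <= N)%N -> good (N - k)%N by move/(_ N (leqnn N)); rewrite subnn.
  elim=> [|k IHk] kN; first by rewrite subn0.
  by apply: good_step; rewrite subnSK //; apply/IHk/ltnW.
have [m hm] := good0 m'; exists m => x hx Dx mx.
have yex (v : V) : exists y, [/\ pahomog d1 y, deep m' y & e v * x = D y].
  have [|||||||y [hy my yE]] := hm v [::] (e v * x); rewrite ?diff_idem ?Dx ?mulr0 //.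
  - by rewrite -[d]add0r; apply/pahomogM/hx/pahomog_pidem.
  - exact: deepMl.
  - by rewrite mulrA pidemM eqxx.
  by exists y; split=> //; rewrite -yE mulrA pidemM eqxx.
have {yex} [f hf] := fin_all_exists yex.
exists (\sum_v f v); split.
- by apply: pahomog_sum => a _; case: (hf a).
- by apply: deep_sum => a _; case: (hf a).
rewrite linear_sum -[LHS]mul1r -(pidem_sum K Q) mulr_suml.
by apply: eq_bigr => a _; case: (hf a).
Qed.

End Acyclic.

(** * A criterion for quasi-isomorphisms *)

Section QuasiIso.
Variables (K : fieldType) (V : finType) (Q1 Q2 : gquiver V).
Local Notation A := (pathalg K Q1).
Local Notation B := (pathalg K Q2).
Variables (sg : arrow Q1 -> arrow Q2) (sg' : arrow Q2 -> arrow Q1).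
Hypotheses (sgK : cancel sg sg') (sg'K : cancel sg' sg).
Hypotheses (sg_src : forall a, asrc (sg a) = asrc a) (sg_tgt : forall a, atgt (sg a) = atgt a).
Hypothesis sg_deg : forall a, adeg (sg a) = adeg a.
Variable f : {lrmorphism A -> B}.
Hypothesis f_idem : forall v, f (pidem K Q1 v) = pidem K Q2 v.
Hypothesis f_lead : forall a, deep 2 (pgen K (sg a) - f (pgen K a)).

(** Inverse of the leading part of f. *)
Definition relabel : B -> A := lext (fun p => wbase K (psrc p) (map sg' (pword p))).
HB.instance Definition _ := GRing.Linear.on relabel.

Lemma is_word_relabel v (s : seq (arrow Q2)) : is_word v (map sg' s) = is_word v s.
Proof.
elim: s => //= a s ->; rewrite -(sg_src (sg' a)) sg'K.
suff -> : word_tgt v (map sg' s) = word_tgt v s by [].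
by case: s => //= b s; rewrite -(sg_tgt (sg' b)) sg'K.
Qed.

Lemma relabel_word v (s : seq (arrow Q2)) : is_word v s ->
  relabel (wbase K v s) = wbase K v (map sg' s).
Proof. by move=> vs; rewrite (wbaseE K vs) /relabel lextU. Qed.

Lemma relabel_deep m y : deep m y -> deep m (relabel y).
Proof.
move=> hy; apply: (deep_ind (S := fun x => deep m (relabel x)) hy).
- by rewrite linear0; apply: deep0.
- by move=> c y1 z h1 h2; rewrite linearP; apply: deepL.
by move=> v s vs ms; rewrite relabel_word //; apply: deep_word; rewrite size_map.
Qed.

Lemma relabel_homog d y : pahomog d y -> pahomog d (relabel y).
Proof.
move=> hy; apply: (homog_ind (S := fun x => pahomog d (relabel x)) hy).
- by rewrite linear0; apply: pahomog0.
- by move=> c y1 z h1 h2; rewrite linearP; apply: pahomogL.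
move=> v s vs <-; rewrite relabel_word //; have := @pahomog_wbase K V Q1 v (map sg' s).
rewrite big_map; under eq_bigr do rewrite -(sg_deg (sg' _)) sg'K.
by [].
Qed.

Lemma f_pgen_deep a : deep 1 (f (pgen K a)).
Proof.
rewrite -[f _](subKr (pgen K (sg a))); apply: deepB; first exact: deep_pgen.
by apply: deep_mono (@f_lead a) _.
Qed.

Lemma f_relabel_word v (s : seq (arrow Q2)) : is_word v s ->
  deep (size s).+1 (wbase K v s - f (wbase K v (map sg' s))).
Proof.
elim: s => [|a s IHs] /=; first by rewrite f_idem subrr => _; apply: deep0.
move=> vas; have /andP[_ vs] := vas.
rewrite (wbase_cons K vas) (@wbase_cons K V Q1 v (sg' a) (map sg' s)); last first.
  by rewrite -[_ :: _]/(map sg' (a :: s)) is_word_relabel.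
rewrite rmorphM /=.
have mulBB (p p' w w' : B) : p * w - p' * w' = (p - p') * w + p' * (w - w').
  by rewrite mulrBl mulrBr addrA subrK.
rewrite mulBB.
apply: deepD.
  by rewrite -add2n; apply: deepM; [rewrite -{1}[a]sg'K | exact: deep_wbase].
by rewrite -add1n; apply: deepM; [exact: f_pgen_deep | exact: IHs].
Qed.

Lemma f_relabel m y : deep m y -> deep m.+1 (y - f (relabel y)).
Proof.
move=> hy; apply: (deep_ind (S := fun y => deep m.+1 (y - f (relabel y))) hy).
- by rewrite linear0 (linear0 f) subrr; apply: deep0.
- move=> c y1 z h1 h2; rewrite linearP (linearP f) /= opprD addrACA -scalerN -scalerDr.
  exact: deepL.
move=> v s vs ms; rewrite relabel_word //.
by apply: deep_mono (f_relabel_word vs) _.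
Qed.

Lemma relabel_f m x : deep m x -> deep m.+1 (x - relabel (f x)).
Proof.
move=> hx; apply: (deep_ind (S := fun x => deep m.+1 (x - relabel (f x))) hx).
- by rewrite (linear0 f) linear0 subrr; apply: deep0.
- move=> c y1 z h1 h2; rewrite (linearP f) linearP /= opprD addrACA -scalerN -scalerDr.
  exact: deepL.
move=> v s vs ms; have sE : s = map sg' (map sg s) by rewrite mapK.
have ws : is_word v (map sg s) by rewrite -is_word_relabel -sE.
have := relabel_deep (f_relabel_word ws).
rewrite linearB /= relabel_word // -sE size_map => h.
by apply: deep_mono h _.
Qed.

Lemma f_deep m x : deep m x -> deep m (f x).
Proof.
move=> hx; apply: (deep_ind (S := fun x => deep m (f x)) hx).
- by rewrite (linear0 f); apply: deep0.
- by move=> c y1 z h1 h2; rewrite (linearP f); apply: deepL.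
move=> v s vs ms; have sE : s = map sg' (map sg s) by rewrite mapK.
have ws : is_word v (map sg s) by rewrite -is_word_relabel -sE.
have := f_relabel_word ws; rewrite -sE size_map => h.
rewrite -[f _](subKr (wbase K v (map sg s))); apply: deepB.
  by apply: deep_word; rewrite size_map.
by apply: deep_mono h _; apply: leqW.
Qed.

Lemma f_inj_deep m x : deep m (f x) -> deep m x.
Proof.
move=> hf; suff: forall k, (k <= m)%N -> deep k x by apply.
elim=> [|k IHk] km; first exact: deep_any.
have := relabel_f (IHk (ltnW km)) => h.
rewrite -[x](subrK (relabel (f x))); apply: deepD => //.
by apply/relabel_deep; apply: deep_mono hf _.
Qed.

Hypothesis f_homog : forall d x, pahomog d x -> pahomog d (f x).

Lemma f_surj_deep m d y : pahomog d y -> exists2 x, pahomog d x & deep m (y - f x).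
Proof.
move=> hy; elim: m => [|m [x hx mx]].
  by exists 0; [apply: pahomog0 | apply: deep_any].
exists (x + relabel (y - f x)).
  by apply: pahomogD => //; apply/relabel_homog/pahomogD => //; apply/pahomogN/f_homog.
by rewrite rmorphD opprD addrA; apply: f_relabel.
Qed.

Variables (d1 : arrow Q1 -> A) (d2 : arrow Q2 -> B).
Hypotheses (d1E : delta_bimod d1) (d1_hom : delta_deg d1) (d1_sq : delta_square d1).
Hypotheses (d2E : delta_bimod d2) (d2_hom : delta_deg d2) (d2_sq : delta_square d2).
Hypothesis Q1deg : forall a : arrow Q1, adeg a = 0 \/ adeg a = -1.
Hypothesis d1_deep : forall a, deep 2 (d1 a).
Hypothesis d2_deep : forall a, deep 2 (d2 a).
Variables (N1 N2 : nat).
Hypothesis dead1 : forall v s, is_word v s -> size s = N1 ->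
  (forall a, a \in s -> adeg a = 0) -> exists2 w, pahomog (-1) w & wbase K v s = qfree_diff d1 w.
Hypothesis dead2 : forall v s, is_word v s -> size s = N2 ->
  (forall a, a \in s -> adeg a = 0) -> exists2 w, pahomog (-1) w & wbase K v s = qfree_diff d2 w.
Hypothesis f_diff : forall x, f (qfree_diff d1 x) = qfree_diff d2 (f x).

Lemma Q2deg (a : arrow Q2) : adeg a = 0 \/ adeg a = -1.
Proof. by rewrite -[a]sg'K sg_deg. Qed.

(** If f x = D y with y close to f x', then x - D x' is a cocycle whose image
under f is deep; so it is deep itself, and [acyclic_deep] applies. *)
Lemma f_inj_coh d x : pahomog d x -> qfree_diff d1 x = 0 ->
  (exists2 y, pahomog (d - 1) y & f x = qfree_diff d2 y) ->
  exists2 y, pahomog (d - 1) y & x = qfree_diff d1 y.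
Proof.
move=> hx Dx [y hy fx]; have [d0|d0] := ltrP 0 d.
  exists 0; first exact: pahomog0.
  by rewrite linear0 (homog_pos Q1deg d0 hx).
have [i dE] : exists i : nat, d = 1 - i%:Z by exists `|1 - d|%N; lia.
have [m hm] := acyclic_deep d1E d1_hom d1_sq Q1deg d1_deep dead1 i 0.
have [x' hx' mx'] := f_surj_deep m hy.
have [||| y' [hy' _ yE]] := hm (x - qfree_diff d1 x').
- apply: pahomogD; first by rewrite -dE.
  by apply: pahomogN; have := qfree_diff_homog d1_hom hx'; rewrite subrK dE.
- by rewrite linearB /= Dx qfree_diffK // subr0.
- apply: f_inj_deep; rewrite rmorphB /= f_diff fx -linearB /=.
  exact: diff_deep.
exists (y' + x').
  by apply: pahomogD => //; rewrite dE addrAC subrr add0r.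
by rewrite linearD /= -yE subrK.
Qed.

(** If y is close to f x0, then D x0 is deep.  By [acyclic_deep] D x0 = D x1
with x1 deep, so x0 - x1 is a cocycle, and y - f (x0 - x1) is a deep cocycle. *)
Lemma f_surj_coh d y : pahomog d y -> qfree_diff d2 y = 0 ->
  exists2 x, pahomog d x /\ qfree_diff d1 x = 0 &
    exists2 z, pahomog (d - 1) z & y - f x = qfree_diff d2 z.
Proof.
move=> hy Dy; have [d0|d0] := ltrP 0 d.
  exists 0; first by split; [exact: pahomog0 | rewrite linear0].
  exists 0; first exact: pahomog0.
  by rewrite (homog_pos Q2deg d0 hy) (linear0 f) subrr linear0.
have [i dE] : exists i : nat, d = 1 - i.+1%:Z by exists `|d|%N; lia.
have [m hm] := acyclic_deep d2E d2_hom d2_sq Q2deg d2_deep dead2 i.+1 0.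
have [m1 hm1] := acyclic_deep d1E d1_hom d1_sq Q1deg d1_deep dead1 i m.
have [x0 hx0 mx0] := f_surj_deep (maxn m m1) hy.
have [||| x1 [hx1 mx1 x1E]] := hm1 (qfree_diff d1 x0).
- by have := qfree_diff_homog d1_hom hx0; rewrite dE; congr (pahomog _ _); lia.
- exact: qfree_diffK.
- apply: f_inj_deep; rewrite f_diff.
  have -> : qfree_diff d2 (f x0) = - qfree_diff d2 (y - f x0).
    by rewrite linearB /= Dy sub0r opprK.
  apply: deepN; apply: (diff_deep d2_deep).
  by apply: deep_mono mx0 _; apply: leq_maxr.
have hx : pahomog d (x0 - x1).
  by apply: pahomogD => //; apply: pahomogN; move: hx1; rewrite dE; congr (pahomog _ _); lia.
have Dx : qfree_diff d1 (x0 - x1) = 0 by rewrite linearB /= x1E subrr.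
have [||| z [hz _ zE]] := hm (y - f (x0 - x1)).
- by rewrite -dE; apply: pahomogD => //; apply/pahomogN/f_homog.
- by rewrite linearB /= -f_diff Dx linear0 Dy subr0.
- rewrite rmorphB /= opprB addrCA addrC; apply: deepD; last exact: f_deep.
  by apply: deep_mono mx0 _; apply: leq_maxl.
exists (x0 - x1); first by split.
by exists z => //; rewrite dE; move: hz; congr (pahomog _ _); lia.
Qed.

End QuasiIso.

(** * The ring H^0 *)

Section QuotientRing.
Variables (R : nzRingType) (I : zmodClosed R).
Hypothesis I_ideal : forall x y, y \in I -> x * y \in I /\ y * x \in I.
Local Open Scope quotient_scope.

(** Quotient by a two-sided ideal; the ring need not be commutative. *)
Definition qring : Type := Quotient.quot I.
HB.instance Definition _ := GRing.Zmodule.on qring.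
Definition qpi (x : R) : qring := \pi_(Quotient.quot I) x.
Definition qlift (u : qring) : R := @repr _ (Quotient.quot I) u.

Lemma qpiE x y : (qpi x = qpi y) <-> (x - y \in I).
Proof.
rewrite /qpi Quotient.idealrBE; split=> [->//|/eqP//].
Qed.

Lemma qliftK u : qpi (qlift u) = u.
Proof. exact: (@reprK _ (Quotient.quot I)). Qed.

Definition qone : qring := qpi 1.
Definition qmul (u v : qring) : qring := qpi (qlift u * qlift v).

Lemma qpiM x y : qpi (x * y) = qmul (qpi x) (qpi y).
Proof.
apply/qpiE.
have hx : x - qlift (qpi x) \in I by apply/qpiE; rewrite qliftK.
have hy : y - qlift (qpi y) \in I by apply/qpiE; rewrite qliftK.
rewrite -[x * y](subrK (qlift (qpi x) * y)) -addrA -mulrBl -mulrBr.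
by rewrite rpredD // ?(I_ideal _ hx).2 ?(I_ideal _ hy).1.
Qed.

Lemma qpiD x y : qpi (x + y) = qpi x + qpi y.
Proof. exact: (@raddfD _ _ (\pi_(Quotient.quot I))). Qed.

Lemma qmulA : associative qmul.
Proof.
by move=> u v w; rewrite -[u]qliftK -[v]qliftK -[w]qliftK -!qpiM mulrA.
Qed.
Lemma qmul1 : left_id qone qmul.
Proof. by move=> u; rewrite -[u]qliftK /qone -!qpiM mul1r. Qed.
Lemma qmulr1 : right_id qone qmul.
Proof. by move=> u; rewrite -[u]qliftK /qone -!qpiM mulr1. Qed.
Lemma qmulDl : left_distributive qmul +%R.
Proof.
move=> u v w; rewrite -[u]qliftK -[v]qliftK -[w]qliftK -!qpiM.
by rewrite -!qpiD -!qpiM mulrDl qpiD.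
Qed.
Lemma qmulDr : right_distributive qmul +%R.
Proof.
move=> u v w; rewrite -[u]qliftK -[v]qliftK -[w]qliftK -!qpiM.
by rewrite -!qpiD -!qpiM mulrDr qpiD.
Qed.
HB.instance Definition _ := GRing.Zmodule_isPzRing.Build qring
  qmulA qmul1 qmulr1 qmulDl qmulDr.

Lemma qpi_zmod : zmod_morphism qpi.
Proof. exact: (@raddfB _ _ (\pi_(Quotient.quot I))). Qed.
Lemma qpi_monoid : monoid_morphism qpi.
Proof. by split=> // x y; apply: qpiM. Qed.
HB.instance Definition _ := GRing.isZmodMorphism.Build R qring qpi qpi_zmod.
HB.instance Definition _ := GRing.isMonoidMorphism.Build R qring qpi qpi_monoid.

Lemma quotient_ring : exists (H : pzRingType) (pi : {rmorphism R -> H}),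
  (forall x, pi x = 0 <-> x \in I) /\ (forall u, exists x, pi x = u).
Proof.
exists qring, qpi; split=> [x|u]; last by exists (qlift u); apply: qliftK.
by rewrite -[X in _ = X <-> _](rmorph0 qpi) qpiE subr0.
Qed.

End QuotientRing.

Section H0.
Variables (K : fieldType) (V : finType) (Q : gquiver V).
Local Notation A := (pathalg K Q).
Local Notation wbase := (wbase K).
Implicit Types (x y z : A) (v : V) (s : seq (arrow Q)) (a b : arrow Q).
Variable delta : arrow Q -> A.
Hypotheses (deltaE : delta_bimod delta) (delta_hom : delta_deg delta).
Local Notation D := (qfree_diff delta).
Hypothesis Qdeg : forall a, adeg a = 0 \/ adeg a = -1.

(** As all degrees are at most 0, the elements without component of degree 0 form
an ideal, so this projection is multiplicative. *)
Definition proj0 : A -> A := lext (fun p => if pdeg p == 0 then pbase K p else 0).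
HB.instance Definition _ := GRing.Linear.on proj0.

Lemma proj0_word v s : is_word v s ->
  proj0 (wbase v s) = if \sum_(a <- s) adeg a == 0 then wbase v s else 0.
Proof. by move=> vs; rewrite (wbaseE K vs) /proj0 lextU. Qed.

Lemma proj0_homog x : pahomog 0 (proj0 x).
Proof.
elim/pathalg_ind: x => [|c x y hx hy|v s vs].
- by rewrite linear0; apply: pahomog0.
- by rewrite linearP; apply: pahomogL.
rewrite proj0_word //; case: eqP => h; last exact: pahomog0.
by have := @pahomog_wbase K V Q v s; rewrite h.
Qed.

Lemma proj0_id x : pahomog 0 x -> proj0 x = x.
Proof.
move=> hx; apply: (homog_ind (S := fun x => proj0 x = x) hx).
- exact: linear0.
- by move=> c y z hy hz; rewrite linearP /= hy hz.
by move=> v s vs h; rewrite proj0_word // h eqxx.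
Qed.

Lemma proj0M x y : proj0 (x * y) = proj0 x * proj0 y.
Proof.
elim/pathalg_ind: x => [|c x z hx hz|v s vs].
- by rewrite !(mul0r, linear0).
- by rewrite mulrDl -scalerAl !linearP /= mulrDl -scalerAl hx hz.
elim/pathalg_ind: y => [|c x z hx hz|w t wt].
- by rewrite !(mulr0, linear0).
- by rewrite mulrDr -scalerAr !linearP /= mulrDr -scalerAr hx hz.
have -> : proj0 (wbase v s) * proj0 (wbase w t) =
    if \sum_(a <- s ++ t) adeg a == 0 then wbase v s * wbase w t else 0.
  rewrite !proj0_word // big_cat /= naddr_eq0 ?word_deg_le0 //.
  by do 2!case: eqP; rewrite ?mulr0 ?mul0r.
rewrite wbaseM //; case: eqP => [vE|_].
  by rewrite proj0_word // is_word_cat -?vE.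
by rewrite linear0; case: ifP.
Qed.

(** The ideal of the path algebra with quotient H^0. *)
Definition exact0 : {pred A} := fun x => `[< exists2 w, pahomog (-1) w & proj0 x = D w >].

Lemma exact0_zmod : zmod_closed exact0.
Proof.
split=> [|x y /asboolP[w hw xw] /asboolP[w' hw' yw]]; apply/asboolP.
  by exists 0; [apply: pahomog0 | rewrite !linear0].
by exists (w - w'); [apply/pahomogD/pahomogN | rewrite !linearB /= xw yw].
Qed.
HB.instance Definition _ := GRing.isZmodClosed.Build A exact0 exact0_zmod.

Lemma exact0_ideal x y : y \in exact0 -> x * y \in exact0 /\ y * x \in exact0.
Proof.
case/asboolP=> w hw yw; split; apply/asboolP.
  exists (proj0 x * w).
    by rewrite -[-1]add0r; apply/pahomogM/hw/proj0_homog.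
  by rewrite proj0M yw (diff_mul0 deltaE delta_hom Qdeg) //; apply: proj0_homog.
exists (w * proj0 x).
  by rewrite -[-1]addr0; apply/pahomogM/proj0_homog/hw.
rewrite proj0M yw (diff_mul1 deltaE) //.
by rewrite (diff_homog0 delta_hom Qdeg (@proj0_homog x)) mulr0 subr0.
Qed.

Lemma H0_ring : exists (H : pzRingType) (pi : {rmorphism A -> H}),
  [/\ forall x, pahomog 0 x -> (pi x = 0 <-> exists2 w, pahomog (-1) w & x = D w),
      forall u, exists2 x, pahomog 0 x & pi x = u
    & forall c x, pi (c *: 1) * pi x = pi x * pi (c *: 1)].
Proof.
have [H [pi [piE piS]]] := @quotient_ring A exact0 exact0_ideal.
exists H, pi; split=> [x hx|u|c x].
- rewrite piE; split=> [/asboolP|h]; first by rewrite proj0_id.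
  by apply/asboolP; rewrite proj0_id.
- have [x <-] := piS u; exists (proj0 x); first exact: proj0_homog.
  apply/eqP; rewrite -subr_eq0 -rmorphB; apply/eqP/piE/asboolP.
  exists 0; first exact: pahomog0.
  by rewrite linearB /= (proj0_id (@proj0_homog x)) subrr linear0.
by rewrite -!rmorphM -scalerAl -scalerAr mul1r mulr1.
Qed.

End H0.

(** * Morphisms between path algebras *)

Section PathMorphism.
Variables (K : fieldType) (V : finType) (Q : gquiver V) (B : algType K).
Local Notation A := (pathalg K Q).
Variables (eB : V -> B) (phi : arrow Q -> B).
Hypothesis eBM : forall v w, eB v * eB w = if v == w then eB v else 0.
Hypothesis eB_sum : \sum_v eB v = 1.
Hypothesis phi_bimod : forall a, eB (atgt a) * phi a * eB (asrc a) = phi a.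

Definition phiword v (s : seq (arrow Q)) : B := foldr (fun a y => phi a * y) (eB v) s.
Definition pathmor : A -> B := lext (fun p => phiword (psrc p) (pword p)).
HB.instance Definition _ := GRing.Linear.on pathmor.

Lemma pathmor_word v s : is_word v s -> pathmor (wbase K v s) = phiword v s.
Proof. by move=> vs; rewrite (wbaseE K vs) /pathmor lextU. Qed.

Lemma phiword_l v s : eB (word_tgt v s) * phiword v s = phiword v s.
Proof.
case: s => [|a s] /=; first by rewrite eBM eqxx.
by rewrite mulrA -phi_bimod !mulrA eBM eqxx.
Qed.

Lemma phiword_r v s : phiword v s * eB v = phiword v s.
Proof. by elim: s => [|a s IHs] /=; rewrite ?eBM ?eqxx // -mulrA IHs. Qed.

Lemma phiword_cat v s t : phiword v (s ++ t) = phiword (word_tgt v t) s * phiword v t.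
Proof. by elim: s => [|a s IHs] /=; rewrite ?phiword_l // IHs mulrA. Qed.

Lemma pathmor_mul : {morph pathmor : x y / x * y}.
Proof.
move=> x y; elim/pathalg_ind: x => [|c x z hx hz|v s vs].
- by rewrite mul0r !linear0 mul0r.
- by rewrite mulrDl -scalerAl !linearP /= mulrDl -scalerAl hx hz.
elim/pathalg_ind: y => [|c x z hx hz|w t wt].
- by rewrite mulr0 !linear0 mulr0.
- by rewrite mulrDr -scalerAr !linearP /= mulrDr -scalerAr hx hz.
rewrite wbaseM // !pathmor_word //; case: eqP => [vE|/eqP/negPf vE].
  by rewrite pathmor_word ?is_word_cat -?vE // phiword_cat -vE.
rewrite linear0 -[phiword v s]phiword_r -[phiword w t]phiword_l.
by rewrite -mulrA (mulrA (eB v)) eBM vE mul0r mulr0.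
Qed.

Lemma pathmor1 : pathmor 1 = 1.
Proof.
rewrite -(pidem_sum K Q) linear_sum -eB_sum; apply: eq_bigr => v _ /=.
by rewrite /pidem pathmor_word.
Qed.

Lemma pathmor_monoid : monoid_morphism pathmor.
Proof. by split; [apply: pathmor1 | apply: pathmor_mul]. Qed.
HB.instance Definition _ := GRing.isMonoidMorphism.Build A B pathmor pathmor_monoid.

(** The universal property of the path algebra. *)
Lemma path_morphism : exists f : {lrmorphism A -> B},
  (forall v, f (pidem K Q v) = eB v) /\ (forall a, f (pgen K a) = phi a).
Proof.
exists pathmor; split=> [v|a]; first by rewrite -[LHS]/(pathmor (wbase K v [::])) pathmor_word.
rewrite -[LHS]/(pathmor (wbase K (asrc a) [:: a])) pathmor_word /= ?eqxx //.
by rewrite -[in LHS]phi_bimod -mulrA eBM eqxx phi_bimod.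
Qed.

End PathMorphism.

Section DGMorphism.
Variables (K : fieldType) (V : finType) (Q1 Q2 : gquiver V).
Local Notation A := (pathalg K Q1).
Local Notation B := (pathalg K Q2).
Variables (d1 : arrow Q1 -> A) (d2 : arrow Q2 -> B).
Hypotheses (d1E : delta_bimod d1) (d1_hom : delta_deg d1) (d1_sq : delta_square d1).
Hypotheses (d2E : delta_bimod d2) (d2_hom : delta_deg d2) (d2_sq : delta_square d2).
Variable f : {lrmorphism A -> B}.
Hypothesis f_idem : forall v, f (pidem K Q1 v) = pidem K Q2 v.
Hypothesis f_gen_homog : forall a, pahomog (adeg a) (f (pgen K a)).
Hypothesis f_gen_diff : forall a, f (d1 a) = qfree_diff d2 (f (pgen K a)).

Lemma pathmor_homog i x : pahomog i x -> pahomog i (f x).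
Proof.
move=> hx; apply: (homog_ind (S := fun x => pahomog i (f x)) hx).
- by rewrite (linear0 f); apply: pahomog0.
- by move=> c y z hy hz; rewrite (linearP f); apply: pahomogL.
move=> v s vs <-; elim: s vs => [|a s IHs] vs.
  by rewrite big_nil f_idem; apply: pahomog_pidem.
have /andP[_ vs'] := vs.
by rewrite big_cons (wbase_cons K vs) rmorphM; apply/pahomogM/IHs.
Qed.

Lemma pathmor_diff x : f (qfree_diff d1 x) = qfree_diff d2 (f x).
Proof.
elim/pathalg_ind: x => [|c x y hx hy|v s vs].
- by rewrite [qfree_diff d1 0]linear0 (linear0 f) linear0.
- by rewrite [qfree_diff d1 _]linearP !(linearP f) linearP /= hx hy.
elim: s vs => [|a s IHs] vs.
  by rewrite f_idem !qfree_diff_pidem (linear0 f).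
have /andP[_ vs'] := vs.
rewrite (wbase_cons K vs) (qfree_leibniz d1E _ (@pahomog_pgen K V Q1 a)).
rewrite qfree_diff_pgen // rmorphD !rmorphM /= rmorph_sign f_gen_diff IHs //.
by rewrite (qfree_leibniz d2E _ (f_gen_homog (a := a))).
Qed.

End DGMorphism.

(** * Rooted trees *)

(** The properties of a tree with root r that are used below. *)
Definition rooted (V : finType) (adj : rel V) (r : V) : Prop :=
  [/\ forall v w, adj v w -> away adj r v w (+) away adj r w v,
      forall u u' v, away adj r u v -> away adj r u' v -> u = u',
      forall u, ~~ away adj r u r
    & forall v, v != r -> exists u, away adj r u v].

Section Orientation.
Variables (V : finType) (adj : rel V) (r : V) (side : V -> V -> pred V).
Hypothesis adj_sym : symmetric adj.
Hypothesis adj_irr : irreflexive adj.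
Hypothesis adj_conn : forall x y, connect adj x y.
Hypothesis side_self : forall v w, adj v w -> side v w w.
Hypothesis side_step : forall v w x y, adj v w -> adj x y -> x != v -> y != v ->
  side v w x -> side v w y.
Hypothesis side_inj : forall v w w' x, adj v w -> adj v w' ->
  side v w x -> side v w' x -> w = w'.
Hypothesis side_opp : forall v w x, adj v w -> side v w x -> side w v x -> False.
Hypothesis side_irr : forall v w, adj v w -> ~~ side v w v.

Local Notation away := (away adj r).

Lemma awayE v w : away v w =
  adj v w && connect [rel x y | [&& adj x y, x != w & y != w]] v r.
Proof.
rewrite /Defs.away sym_connect_sym // => x y /=.
by rewrite adj_sym andbA andbAC -andbA.
Qed.

Lemma away_adj v w : away v w -> adj v w.
Proof. by case/andP. Qed.

Lemma away_side v w : away v w -> side w v r.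
Proof.
rewrite awayE => /andP[vw /connectP[p pp ->]]; rewrite adj_sym in vw.
have main : forall x, side w v x ->
    path [rel x y | [&& adj x y, x != w & y != w]] x p -> side w v (last x p).
  elim: p {pp} => //= y p IHp x sx /andP[/and3P[xy xw yw] py].
  by apply: IHp py; apply: side_step sx.
exact: (main _ (side_self vw) pp).
Qed.

Lemma first_step v : v != r -> exists2 u, adj v u &
  connect [rel x y | [&& adj x y, x != v & y != v]] u r.
Proof.
move=> vr; have /connectP[p0 pp0 rE] := adj_conn v r.
case/shortenP: pp0 rE => p pp up _ rE.
case: p pp up rE => [_ _ rE|u p /= /andP[vu pu] /andP[vp _] rE].
  by rewrite rE eqxx in vr.
exists u => //; apply/connectP; exists p => //.
elim: p u pu vp {vu rE} => //= y p IHp u /andP[uy py].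
rewrite inE negb_or => /andP[vu vyp].
rewrite uy (IHp _ py vyp) /= andbT eq_sym vu.
by move: vyp; rewrite inE negb_or eq_sym => /andP[].
Qed.

Lemma away_parent v : v != r -> exists u, away u v.
Proof.
by move=> /first_step[u vu ur]; exists u; rewrite awayE adj_sym vu.
Qed.

Lemma away_uniq u u' v : away u v -> away u' v -> u = u'.
Proof.
move=> h h'; apply: (side_inj (v := v) (x := r)); rewrite ?away_side //.
  by rewrite adj_sym (away_adj h).
by rewrite adj_sym (away_adj h').
Qed.

Lemma away_root u : ~~ away u r.
Proof.
apply/negP=> h; have := away_side h; apply/negP/side_irr.
by rewrite adj_sym (away_adj h).
Qed.

(** Follow a simple path from v to r: either it avoids w, or its part after w
avoids v. *)
Lemma away_orient v w : adj v w -> away v w (+) away w v.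
Proof.
move=> vw; have wv : adj w v by rewrite adj_sym.
have [h1|h1] := boolP (away v w).
  by apply/negP=> h2; apply: side_opp vw (away_side h2) (away_side h1).
rewrite addFb.
have /connectP[p0 pp0 rE] := adj_conn v r.
case/shortenP: pp0 rE => p pp up _ rE.
have vne : v != w by apply: contraTneq vw => ->; rewrite adj_irr.
have [wp|wp] := boolP (w \in p); last first.
  case/negP: h1; rewrite awayE vw /=; apply/connectP; exists p => //.
  elim: p v pp wp vne {up rE vw wv} => //= y p IHp v /andP[vy py].
  rewrite inE negb_or => /andP[wy wp] vw.
  have yw : y != w by rewrite eq_sym.
  by rewrite vy vw yw IHp.
rewrite awayE wv /=; case/splitPr: wp pp up rE => p1 p2.
rewrite cat_path /= last_cat /= mem_cat inE negb_or cat_uniq.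
move=> /and3P[_ _ p2p] /andP[/andP[_ /norP[_ vp2]] _] rE.
apply/connectP; exists p2 => //.
have wv' : w != v by rewrite eq_sym.
elim: p2 w p2p vp2 wv' {rE vw wv h1 vne} => //= y q IHq w /andP[wy py].
rewrite inE negb_or => /andP[vy vp] wv.
have yv : y != v by rewrite eq_sym.
by rewrite wy wv yv IHq.
Qed.

Lemma sides_rooted : rooted adj r.
Proof.
by split; [exact: away_orient | exact: away_uniq | exact: away_root | exact: away_parent].
Qed.

End Orientation.

Section DynkinTrees.
Variable n : nat.
Implicit Types v w x y : 'I_n.

(** The connected component of w after the removal of v, for w adjacent to v. *)
Definition sideA v w x : bool :=
  ((w < v) && (x < v) || ~~ (w < v) && (v < x))%N.
Definition sideD v w x : bool :=
  [|| ((v < n - 3)%N && sideA v w x),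
      ((v == n - 3 :> nat) && ((w < n - 3) && (x < n - 3) || ~~ (w < n - 3) && (x == w :> nat)))%N
    | ((n - 3 < v) && (x != v :> nat))%N].

Lemma adjAE v w : Dynkin_A n v w = adjA n v w.
Proof. by rewrite /Dynkin_A /adjA !ltn_ord !andbT. Qed.

Lemma Dynkin_A_sym : symmetric (Dynkin_A n).
Proof. by move=> v w; rewrite /Dynkin_A orbC. Qed.
Lemma Dynkin_D_sym : symmetric (Dynkin_D n).
Proof. by move=> v w; rewrite /Dynkin_D orbC. Qed.

Lemma conn_to (adj : rel 'I_n) v0 : symmetric adj ->
  (forall v, v != v0 -> exists2 w, adj v w & (w < v)%N \/ w = v0) ->
  forall x y, connect adj x y.
Proof.
move=> sadj step; have to0 v : connect adj v v0.
  have [k] := ubnP (v : nat); elim: k v => // k IHk v vk.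
  have [->|/step[w vw [wv|wv]]] := eqVneq v v0; first exact: connect0.
    by apply: connect_trans (connect1 vw) (IHk _ _); lia.
  by rewrite -wv; apply: connect1.
move=> x y; apply: connect_trans (to0 x) _.
by rewrite (sym_connect_sym sadj) to0.
Qed.

Lemma Dynkin_A_rooted r : rooted (Dynkin_A n) r.
Proof.
have irr : irreflexive (Dynkin_A n) by move=> v; rewrite /Dynkin_A; lia.
have conn x y : connect (Dynkin_A n) x y.
  have n0 : (0 < n)%N by case: x => i; lia.
  apply: (conn_to (v0 := Ordinal n0) Dynkin_A_sym) => v v0.
  have vn : (v.-1 < n)%N by have := ltn_ord v; lia.
  have v0' : (0 < v)%N by move: v0; rewrite -val_eqE /=; lia.
  by exists (Ordinal vn); [rewrite /Dynkin_A /=; lia | left => /=; lia].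
have s1 v w : Dynkin_A n v w -> sideA v w w by rewrite /Dynkin_A /sideA; lia.
have s2 v w x y : Dynkin_A n v w -> Dynkin_A n x y -> x != v -> y != v ->
  sideA v w x -> sideA v w y by rewrite -!val_eqE /Dynkin_A /sideA /=; lia.
have s3 v w w' x : Dynkin_A n v w -> Dynkin_A n v w' -> sideA v w x -> sideA v w' x -> w = w'.
  by rewrite /Dynkin_A /sideA => *; apply: val_inj => /=; lia.
have s4 v w x : Dynkin_A n v w -> sideA v w x -> sideA w v x -> False.
  by rewrite /Dynkin_A /sideA; lia.
have s5 v w : Dynkin_A n v w -> ~~ sideA v w v by rewrite /sideA; lia.
exact: (sides_rooted r Dynkin_A_sym irr conn s1 s2 s3 s4 s5).
Qed.

Lemma Dynkin_D_rooted r : (4 <= n)%N -> rooted (Dynkin_D n) r.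
Proof.
move=> n4.
have irr : irreflexive (Dynkin_D n) by move=> v; rewrite /Dynkin_D; lia.
have conn x y : connect (Dynkin_D n) x y.
  have n0 : (0 < n)%N by lia.
  apply: (conn_to (v0 := Ordinal n0) Dynkin_D_sym) => v v0.
  have v0' : (0 < v)%N by move: v0; rewrite -val_eqE /=; lia.
  have vn : ((if v.+1 == n then v.-2 else v.-1) < n)%N.
    by have := ltn_ord v; case: ifP; lia.
  exists (Ordinal vn); last by left => /=; case: ifP; lia.
  by rewrite /Dynkin_D /=; case: ifP; have := ltn_ord v; lia.
have vn (v : 'I_n) := ltn_ord v.
have s1 v w : Dynkin_D n v w -> sideD v w w.
  by have := vn v; have := vn w; rewrite /Dynkin_D /sideD /sideA; lia.
have s2 v w x y : Dynkin_D n v w -> Dynkin_D n x y -> x != v -> y != v ->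
  sideD v w x -> sideD v w y.
  have := vn v; have := vn w; have := vn x; have := vn y.
  by rewrite -!val_eqE /Dynkin_D /sideD /sideA /=; lia.
have s3 v w w' x : Dynkin_D n v w -> Dynkin_D n v w' -> sideD v w x -> sideD v w' x -> w = w'.
  have := vn v; have := vn w; have := vn x; have := vn w'.
  by rewrite /Dynkin_D /sideD /sideA => *; apply: val_inj => /=; lia.
have s4 v w x : Dynkin_D n v w -> sideD v w x -> sideD w v x -> False.
  have := vn v; have := vn w; have := vn x.
  by rewrite /Dynkin_D /sideD /sideA; lia.
have s5 v w : Dynkin_D n v w -> ~~ sideD v w v.
  by have := vn v; have := vn w; rewrite /Dynkin_D /sideD /sideA; lia.
exact: (sides_rooted r Dynkin_D_sym irr conn s1 s2 s3 s4 s5).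
Qed.

End DynkinTrees.

(** * Ordered children and circle products *)

Section Subsequences.
Variables (R : pzRingType) (T : eqType) (F : T -> R).

Fixpoint subs (s : seq T) : seq (seq T) :=
  if s is x :: s' then [seq x :: u | u <- subs s'] ++ subs s' else [:: [::]].

Lemma mem_subs s u : (u \in subs s) = subseq u s.
Proof.
elim: s u => [|x s IHs] u /=; first by rewrite inE.
rewrite mem_cat IHs; case: u => [|y u].
  by rewrite sub0seq orbT.
case: eqP => [->|/eqP xy].
  apply/orP/idP=> [[/mapP[v +[->]]|]|h].
  - by rewrite IHs.
  - by move=> h; apply: subseq_trans h; apply: subseq_cons.
  by left; apply/mapP; exists u; rewrite ?IHs.
rewrite orbC; case: (subseq _ _) => //=; apply/negP => /mapP[v _ [yx]].
by rewrite yx eqxx in xy.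
Qed.

Lemma uniq_subs s : uniq s -> uniq (subs s).
Proof.
elim: s => //= x s IHs /andP[xs us]; rewrite cat_uniq IHs // andbT.
rewrite map_inj_uniq ?IHs //=; last by move=> u v [].
apply/hasPn => u; rewrite mem_subs => su; apply/mapP => -[v _ uE].
by have := mem_subseq su (x := x); rewrite uE mem_head => /(_ isT); apply/negP.
Qed.

(** Expansion of the product of the 1 + F x. *)
Lemma sum_subs s :
  \sum_(u <- subs s) \prod_(x <- u) F x = 1 + bigcirc true (map F s).
Proof.
elim: s => [|x s IHs] /=; first by rewrite big_seq1 big_nil addr0.
rewrite big_cat big_map /=; under eq_bigr do rewrite big_cons.
rewrite -mulr_sumr IHs /circ mulr1n.
move: (bigcirc _ _) => b; ncring.
Qed.

End Subsequences.

Lemma sorted_strict (T : eqType) (lt : rel T) (s : seq T) :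
  uniq s -> sorted (fun x y => (x == y) || lt x y) s -> sorted lt s.
Proof.
elim: s => //= x s IHs /andP[xs us]; case: s IHs xs us => //= y s IHs.
rewrite inE negb_or => /andP[/negPf xy _] us; rewrite xy /= => /andP[-> ys].
exact: IHs.
Qed.

Section Children.
Variables (V : finType) (adj : rel V) (r : V) (lt : V -> rel V).
Hypothesis adj_rooted : rooted adj r.
Hypothesis adj_sym : symmetric adj.
Hypothesis lt_order : child_order adj r lt.
Local Notation away := (away adj r).

(** The reflexive closure of lt is total on the children, as sorting requires. *)
Definition children v : seq V :=
  sort (fun x y => (x == y) || lt v x y) [seq w <- enum V | away v w].
Definition parents v : seq V := [seq u <- enum V | away u v].

Lemma mem_children v w : (w \in children v) = away v w.
Proof. by rewrite mem_sort mem_filter mem_enum andbT. Qed.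

Lemma mem_parents v w : (w \in parents v) = away w v.
Proof. by rewrite mem_filter mem_enum andbT. Qed.

Lemma uniq_children v : uniq (children v).
Proof. by rewrite sort_uniq filter_uniq ?enum_uniq. Qed.

Lemma sorted_children v : sorted (lt v) (children v).
Proof.
have [_ _ tot] := lt_order v.
apply: sorted_strict (uniq_children v) _.
apply: (sort_sorted_in (P := mem (away v))); last first.
  by apply/allP => w; rewrite mem_filter => /andP[].
move=> x y xv yv; have [->|xy] := eqVneq x y => //.
by rewrite /= tot.
Qed.

Lemma parents_cases v : (parents v = [::] /\ forall u, ~~ away u v) \/
  exists2 u, parents v = [:: u] & forall w, away w v = (w == u).
Proof.
have [_ uniq_par _ _] := adj_rooted.
have up : uniq (parents v) by rewrite filter_uniq ?enum_uniq.
case pE : (parents v) => [|u s]; [left | right].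
  by split=> // u; rewrite -mem_parents pE.
have uv : away u v by rewrite -mem_parents pE mem_head.
have wE w : away w v = (w == u).
  by apply/idP/eqP=> [wv|->//]; apply: uniq_par wv uv.
exists u => //; case: s pE => // w s pE.
have : w == u by rewrite -wE -mem_parents pE !inE eqxx orbT.
by move: up; rewrite pE /= inE => /andP[+ _] => /[swap] /eqP ->; rewrite eqxx.
Qed.

Definition nbrs v := parents v ++ children v.
Definition has_parent v := parents v != [::].

Lemma perm_nbrs v : perm_eq (nbrs v) [seq w <- enum V | adj v w].
Proof.
have [orient _ _ _] := adj_rooted.
apply: uniq_perm; [|exact/filter_uniq/enum_uniq|].
  rewrite cat_uniq uniq_children (filter_uniq _ (enum_uniq _)) andbT andTb.
  apply/hasPn => w; rewrite mem_children mem_parents => vw.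
  have vw' : adj v w by case/andP: vw.
  by have := orient _ _ vw'; rewrite vw.
move=> w; rewrite mem_cat mem_children mem_parents mem_filter mem_enum andbT.
apply/orP/idP => [[/andP[+ _]|/andP[]]//|vw]; first by rewrite adj_sym.
by have := orient _ _ vw; case: (away v w); [right | left].
Qed.

Lemma vrel_nbrs (H : pzRingType) q (F : V -> H) v :
  vrel q F (nbrs v) (has_parent v) <->
  bigcirc q (map F (children v)) = \sum_(u | away u v) F u.
Proof.
rewrite /nbrs /has_parent; case: (parents_cases v) => [[-> h]|[u -> h]] /=.
  by rewrite big_pred0 // => u; apply/negbTE.
by rewrite (big_pred1 u).
Qed.

Lemma bigcirc0 (H : pzRingType) (T : Type) (F : T -> H) s :
  bigcirc false (map F s) = \sum_(x <- s) F x.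
Proof.
elim: s => [|x s IHs] /=; first by rewrite big_nil.
by rewrite big_cons IHs /circ mulr0n addr0.
Qed.

Lemma sum_children (H : pzRingType) (F : V -> H) v :
  bigcirc false (map F (children v)) = \sum_(w | away v w) F w.
Proof.
rewrite bigcirc0 (perm_big [seq w <- enum V | away v w]); last by rewrite perm_sort.
by rewrite big_filter big_enum_cond.
Qed.

(** The increasing sequences of children are the nonempty subsequences of the
sorted list of all children, so the sum in the differential of LCA is the
expansion of a circle product. *)
Lemma sum_tuples (H : pzRingType) (F : V -> H) v :
  \sum_(1 <= i < #|V|.+1) \sum_(w : i.-tuple V | sorted (lt v) w && all (away v) w)
      \prod_(x <- w) F x = bigcirc true (map F (children v)).
Proof.
have [irr tr _] := lt_order v.
apply: (addrI 1); rewrite -sum_subs.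
pose tups (i : nat) : seq (i.-tuple V) :=
  [seq w <- enum {: i.-tuple V} | sorted (lt v) (tval w) && all (away v) (tval w)].
pose L := [seq tval w | i <- index_iota 1 #|V|.+1, w <- tups i].
have -> : \sum_(1 <= i < #|V|.+1) \sum_(w : i.-tuple V | sorted (lt v) w && all (away v) w)
      \prod_(x <- w) F x = \sum_(s <- L) \prod_(x <- s) F x.
  rewrite big_allpairs_dep; apply: eq_bigr => i _.
  by rewrite big_filter big_enum_cond.
have memL s : (s \in L) = [&& s != [::], sorted (lt v) s, all (away v) s & (size s <= #|V|)%N].
  apply/allpairsPdep/idP => [[i [w [+ + ->]]]|/and4P[s0 ss sa sz]].
    rewrite mem_index_iota mem_filter => /andP[i0 iV] /andP[/andP[-> ->] _].
    by rewrite size_tuple -ltnS iV -size_eq0 size_tuple -lt0n i0.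
  exists (size s), (in_tuple s); split=> //.
    by rewrite mem_index_iota ltnS sz lt0n size_eq0 s0.
  by rewrite mem_filter mem_enum inE andbT /= ss sa.
have P : perm_eq (subs (children v)) ([::] :: L).
  apply: uniq_perm.
  - exact/uniq_subs/uniq_children.
  - rewrite /= memL eqxx /=; apply: allpairs_uniq_dep.
    + exact: iota_uniq.
    + by move=> i _; rewrite filter_uniq ?enum_uniq.
    move=> [i w] [j u] _ _ /= wu; have ij : i = j by rewrite -(size_tuple w) wu size_tuple.
    by case: j / ij u wu => u wu; congr Tagged; apply: val_inj.
  move=> s; rewrite mem_subs inE memL.
  have [->|s0] /= := eqVneq s [::]; first by rewrite sub0seq.
  apply/idP/and3P => [sub|[ss sa _]].
    have sa : all (away v) s.
      by apply/allP => w /(mem_subseq sub); rewrite mem_children.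
    split=> //; last first.
      by rewrite -(card_uniqP (subseq_uniq sub (uniq_children v))) max_card.
    apply: subseq_sorted_in sub (sorted_children v).
    by move=> x y z; rewrite !mem_children; apply: tr.
  have -> : s = [seq w <- children v | w \in s]; last exact: filter_subseq.
  have ca : all (away v) (children v) by apply/allP => w; rewrite mem_children.
  apply: (@irr_sorted_eq_in _ (lt v)) => //.
  - by move=> y x z ys xs zs; apply: tr (allP sa _ ys) (allP sa _ xs) (allP sa _ zs).
  - by move=> x xs; apply: irr (allP sa _ xs).
  - by apply: (sorted_filter_in tr) => //; apply: sorted_children.
  move=> w; rewrite mem_filter mem_children; case: (boolP (w \in s)) => //= ws.
  by rewrite (allP sa).
by rewrite (perm_big _ P) big_cons big_nil.
Qed.

End Children.

(** * The arrows of the two quivers *)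

Section Ginz.
Variables (K : fieldType) (V : finType) (adj : rel V) (r : V).
Hypothesis adj_rooted : rooted adj r.
Hypothesis adj_sym : symmetric adj.
Local Notation away := (away adj r).
Local Notation G := (ginz_quiver adj r).
Local Notation e := (pidem K G).

Lemma away_antisym v w : away v w -> away w v = false.
Proof.
move=> vw; have [orient _ _ _] := adj_rooted.
by have := orient _ _ (away_adj vw); rewrite vw => /negbTE.
Qed.

(** The counterpart of [lca_c]: the arrow from v to w, be it some g or some g^*. *)
Definition gz_c (w v : V) : pathalg K G :=
  if insub (v, w) is Some g then ginz_g K g
  else if insub (w, v) is Some g then ginz_g' K g else 0.

Lemma gz_c_g (g : tree_arrow adj r) : gz_c (val g).2 (val g).1 = ginz_g K g.
Proof. by rewrite /gz_c -surjective_pairing valK. Qed.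

Lemma gz_c_g' (g : tree_arrow adj r) : gz_c (val g).1 (val g).2 = ginz_g' K g.
Proof.
rewrite /gz_c insubF /=; last by apply: away_antisym; apply: (valP g).
by rewrite -surjective_pairing valK.
Qed.

Variant gz_spec w v : pathalg K G -> Prop :=
| GzG (g : tree_arrow adj r) of val g = (v, w) : gz_spec w v (ginz_g K g)
| GzG' (g : tree_arrow adj r) of val g = (w, v) : gz_spec w v (ginz_g' K g)
| Gz0 of ~~ adj w v : gz_spec w v 0.

Lemma gz_cP w v : gz_spec w v (gz_c w v).
Proof.
rewrite /gz_c; case: insubP => [g _ gE|/= h1]; first exact: GzG.
case: insubP => [g _ gE|/= h2]; first exact: GzG'.
apply: Gz0; apply/negP=> wv; have [orient _ _ _] := adj_rooted.
by have := orient _ _ wv; rewrite (negPf h1) (negPf h2).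
Qed.

Lemma gz_c_l w v : e w * gz_c w v = gz_c w v.
Proof.
case: gz_cP => [g gE|g gE|_]; last by rewrite mulr0.
- have -> : w = (val g).2 by rewrite gE.
  exact: (@pidem_wbase K V G (val g).1 [:: inl (inl g)]).
have -> : w = (val g).1 by rewrite gE.
exact: (@pidem_wbase K V G (val g).2 [:: inl (inr g)]).
Qed.

Lemma gz_c_r w v : gz_c w v * e v = gz_c w v.
Proof.
case: gz_cP => [g gE|g gE|_]; last by rewrite mul0r.
- have -> : v = (val g).1 by rewrite gE.
  exact: (@wbase_pidem K V G (val g).1 [:: inl (inl g)]).
have -> : v = (val g).2 by rewrite gE.
exact: (@wbase_pidem K V G (val g).2 [:: inl (inr g)]).
Qed.

Lemma gz_c_homog w v : pahomog 0 (gz_c w v).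
Proof.
case: gz_cP => [g _|g _|_]; last exact: pahomog0.
- exact: (@pahomog_pgen K V G).
exact: (@pahomog_pgen K V G).
Qed.

Lemma gz_c_deep w v : deep 1 (gz_c w v).
Proof. by case: gz_cP => [g _|g _|_]; [apply: deep_pgen.. | apply: deep0]. Qed.

Lemma gz_c0 w v : ~~ adj w v -> gz_c w v = 0.
Proof.
by move=> wv; case: gz_cP => // g gE; case/negP: wv; have := away_adj (valP g);
  rewrite gE //= adj_sym.
Qed.

Lemma gz_delta v : ginz_delta K (inr v : arrow G) =
  \sum_(w | away v w) gz_c v w * gz_c w v - \sum_(u | away u v) gz_c v u * gz_c u v.
Proof.
rewrite /= /ginz_dh mulr_sumr mulr_suml.
pose l x y := gz_c x y * gz_c y x.
have gE (g : tree_arrow adj r) :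
    e v * (ginz_g' K g * ginz_g K g - ginz_g K g * ginz_g' K g) * e v =
    (if (val g).1 == v then l v (val g).2 else 0) -
    (if (val g).2 == v then l v (val g).1 else 0).
  rewrite mulrBr mulrBl -!gz_c_g -!gz_c_g'.
  have ll x y : e v * l x y * e v = if x == v then l v y else 0.
    rewrite /l -(gz_c_l x) -(gz_c_r y x) !mulrA pidemM eq_sym; case: eqP => [<-|xv]; last first.
      by rewrite !mul0r.
    by rewrite -!mulrA pidemM eqxx gz_c_r mulrA gz_c_l.
  by rewrite -!/(l _ _) !ll.
rewrite (eq_bigr _ (fun g _ => gE g)) sumrB.
have sumE (F : V * V -> pathalg K G) : \sum_(g : tree_arrow adj r) F (val g) =
    \sum_x \sum_(y | away x y) F (x, y).
  rewrite -(big_sub (fun p : V * V => away p.1 p.2) F) pair_big_dep /=.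
  by apply: eq_big => [[]|[]].
rewrite (sumE (fun p => if p.1 == v then l v p.2 else 0)) /=.
rewrite (sumE (fun p => if p.2 == v then l v p.1 else 0)) /=; congr (_ - _).
  rewrite (bigD1 v) //= [X in _ + X]big1 ?addr0.
    by apply: eq_bigr => y _; rewrite eqxx.
  by move=> x /negPf xv; apply: big1 => y _; rewrite xv.
rewrite [RHS]big_mkcond; apply: eq_bigr => x _; rewrite big_mkcond (bigD1 v) //= eqxx.
by rewrite [X in _ + X]big1 ?addr0 // => y /negPf ->; case: ifP.
Qed.

Lemma ginz_deg (a : arrow G) : adeg a = 0 \/ adeg a = -1.
Proof. by case: a => [a|v]; [left | right]. Qed.

Lemma ginz_delta_deep (a : arrow G) : deep 2 (ginz_delta K a).
Proof.
case: a => [a|v]; first exact: deep0.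
by rewrite gz_delta; apply: deepB; apply: deep_sum => w _; apply: (@deepM _ _ _ 1 1);
  apply: gz_c_deep.
Qed.

End Ginz.

Section Lca.
Variables (K : fieldType) (V : finType) (adj : rel V) (r : V) (lt : V -> rel V).
Hypothesis adj_rooted : rooted adj r.
Hypothesis adj_sym : symmetric adj.
Hypothesis lt_order : child_order adj r lt.
Local Notation away := (away adj r).
Local Notation L := (lca_quiver adj r).
Local Notation lc := (lca_c adj r K).

Lemma lca_c_adj (p : {p : V * V | adj p.1 p.2}) : lc (val p).1 (val p).2 = pgen K (inr p : arrow L).
Proof. by rewrite /lca_c -surjective_pairing valK. Qed.

Lemma lca_c0 w v : ~~ adj w v -> lc w v = 0.
Proof. by move=> wv; rewrite /lca_c insubF //; apply: negbTE. Qed.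

Lemma lca_c_deep w v : deep 1 (lc w v).
Proof. by rewrite /lca_c; case: insubP => [p _ _|_]; [apply: deep_pgen | apply: deep0]. Qed.

Lemma lca_deltaE v : lca_delta K lt (inl v : arrow L) =
  bigcirc true [seq lc v w * lc w v | w <- children adj r lt v]
  - \sum_(u | away u v) lc v u * lc u v.
Proof.
rewrite /= /lca_D addrC (sum_tuples lt_order (fun w => lc v w * lc w v)).
by [].
Qed.

Lemma lca_deg_cases (a : arrow L) : adeg a = 0 \/ adeg a = -1.
Proof. by case: a => [a|v]; [right | left]. Qed.

Lemma bigcirc_deep (Q : gquiver V) (F : V -> pathalg K Q) m s :
  (forall w, deep m (F w)) -> deep m (bigcirc true (map F s)).
Proof.
move=> hF; elim: s => [|x s IHs] /=; first exact: deep0.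
by apply: deepD; [apply: deepD | apply: deepMr].
Qed.

Lemma lca_delta_deep (a : arrow L) : deep 2 (lca_delta K lt a).
Proof.
case: a => [v|a]; last exact: deep0.
have ll v' w : deep 2 (lc v' w * lc w v').
  by apply: (@deepM _ _ _ 1 1); apply: lca_c_deep.
by rewrite lca_deltaE; apply: deepB; [apply: bigcirc_deep | apply: deep_sum].
Qed.

End Lca.

Section Relabel.
Variables (K : fieldType) (V : finType) (adj : rel V) (r : V).
Hypothesis adj_rooted : rooted adj r.
Hypothesis adj_sym : symmetric adj.
Local Notation away := (away adj r).
Local Notation G := (ginz_quiver adj r).
Local Notation L := (lca_quiver adj r).

(** The last branch is not reached on rooted trees. *)
Definition l2g (a : arrow L) : arrow G :=
  match a : lca_arrow adj with
  | inl v => inr v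
  | inr p => if insub ((val p).2, (val p).1) is Some g then inl (inl g)
             else if insub (val p) is Some g then inl (inr g) else inr r
  end.

Lemma adj_away1 (g : tree_arrow adj r) : adj (val g).2 (val g).1.
Proof. by rewrite adj_sym; apply: away_adj (valP g). Qed.
Lemma adj_away2 (g : tree_arrow adj r) : adj (val g).1 (val g).2.
Proof. exact: away_adj (valP g). Qed.

Definition g2l (a : arrow G) : arrow L :=
  match a : ginz_arrow adj r with
  | inl (inl g) => inr (exist (fun p : V * V => adj p.1 p.2) ((val g).2, (val g).1) (adj_away1 g))
  | inl (inr g) => inr (exist (fun p : V * V => adj p.1 p.2) ((val g).1, (val g).2) (adj_away2 g))
  | inr v => inl v
  end.

Lemma g2lK : cancel g2l l2g.
Proof.
move=> [[g|g]|v] //=.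
  by rewrite -surjective_pairing valK.
rewrite insubF /=; last by apply: (away_antisym adj_rooted); apply: (valP g).
by rewrite -surjective_pairing valK.
Qed.

Lemma l2gK : cancel l2g g2l.
Proof.
move=> [v|p] //=; case: insubP => [g _ gE|h1] /=.
  by congr inr; apply: val_inj; rewrite /= gE /=; case: (val p).
case: insubP => [g _ gE|h2] /=.
  by congr inr; apply: val_inj; rewrite /= gE /=; case: (val p).
have [orient _ _ _] := adj_rooted.
by have := orient _ _ (valP p); rewrite /= in h1; rewrite (negPf h1) (negPf h2).
Qed.

Lemma l2g_src a : asrc (l2g a) = asrc a.
Proof.
case: a => [v|p] //=; case: insubP => [g _ gE|h1] /=; first by rewrite gE.
case: insubP => [g _ gE|h2] /=; first by rewrite gE.
have [orient _ _ _] := adj_rooted.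
by have := orient _ _ (valP p); rewrite /= in h1; rewrite (negPf h1) (negPf h2).
Qed.

Lemma l2g_tgt a : atgt (l2g a) = atgt a.
Proof.
case: a => [v|p] //=; case: insubP => [g _ gE|h1] /=; first by rewrite gE.
case: insubP => [g _ gE|h2] /=; first by rewrite gE.
have [orient _ _ _] := adj_rooted.
by have := orient _ _ (valP p); rewrite /= in h1; rewrite (negPf h1) (negPf h2).
Qed.

Lemma l2g_deg a : adeg (l2g a) = adeg a.
Proof.
case: a => [v|p] //=; case: insubP => [g _ gE|h1] //=.
case: insubP => [g _ gE|h2] //=.
have [orient _ _ _] := adj_rooted.
by have := orient _ _ (valP p); rewrite /= in h1; rewrite (negPf h1) (negPf h2).
Qed.

Lemma l2g_gen p : pgen K (l2g (inr p)) = gz_c K adj r (val p).1 (val p).2.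
Proof.
rewrite /gz_c /l2g; case: insubP => [g _ gE|h1] //.
by rewrite -surjective_pairing; case: insubP => [g _ gE|h2] //;
  have [orient _ _ _] := adj_rooted;
  have := orient _ _ (valP p); rewrite /= in h1; rewrite (negPf h1) (negPf h2).
Qed.

End Relabel.

(** * Passage between path algebras and rings *)

Lemma dead_of_nil (K : fieldType) (V : finType) (Q : gquiver V) (H : pzRingType)
    (pi : {rmorphism pathalg K Q -> H}) (S : seq H) :
  nilS S -> (forall a : arrow Q, adeg a = 0 -> pi (pgen K a) \in S) ->
  exists N, forall v s, is_word v s -> size s = N -> (forall a : arrow Q, a \in s -> adeg a = 0) ->
    pi (wbase K v s) = 0.
Proof.
move=> [N nS] aS; exists N => v s vs sN s0.
have -> : pi (wbase K v s) = (\prod_(x <- [seq pi (pgen K a) | a <- s]) x) * pi (pidem K Q v).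
  elim: s vs {sN s0} => [|a s IHs] vs; first by rewrite big_nil mul1r.
  have /andP[_ vs'] := vs.
  by rewrite (wbase_cons K vs) rmorphM /= big_cons IHs // mulrA.
rewrite nS ?mul0r ?size_map // => x /mapP[a /s0 a0 ->]; exact: aS.
Qed.

Section HigherLift.
Variables (K : fieldType) (V : finType) (Q : gquiver V) (H : pzRingType).
Variables (pi : {rmorphism pathalg K Q -> H}).
Hypothesis pi_lift : forall u, exists2 x, pahomog 0 x & pi x = u.
Variables (c : nat -> nat -> H).
Hypothesis c_lift : forall i j, exists x, [/\ pahomog 0 x, deep 1 x & pi x = c i j].

Lemma higher_lift z : higher c z -> exists x, [/\ pahomog 0 x, deep 2 x & pi x = z].
Proof.
have h00 (x y : pathalg K Q) : pahomog 0 x -> pahomog 0 y -> pahomog 0 (x * y).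
  by move=> hx hy; rewrite -[0]addr0; apply: pahomogM.
elim=> [|_ _ _ [x [hx dx <-]] _ [y [hy dy <-]]|u i j v k l w].
- by exists 0; split; [apply: pahomog0 | apply: deep0 | rewrite rmorph0].
- by exists (x + y); split; [apply: pahomogD | apply: deepD | rewrite rmorphD].
have [u' hu <-] := pi_lift u; have [v' hv <-] := pi_lift v; have [w' hw <-] := pi_lift w.
have [x [hx dx <-]] := c_lift i j; have [y [hy dy <-]] := c_lift k l.
exists (u' * x * v' * y * w'); split; last by rewrite !rmorphM.
  by do !apply: (h00) => //.
apply: deepMr; apply: (@deepM _ _ _ 1 1) => //; apply: deepMr; exact: deepMl.
Qed.
End HigherLift.

Section NatExt.
Variables (n : nat) (H : pzRingType).

(** Identities indexed by vertices become identities indexed by natural numbers. *)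
Definition natext (c : 'I_n -> 'I_n -> H) (i j : nat) : H :=
  if insub i is Some v then if insub j is Some w then c v w else 0 else 0.
Definition natext1 (e : 'I_n -> H) (i : nat) : H := if insub i is Some v then e v else 0.

Lemma natextE c (v w : 'I_n) : natext c v w = c v w.
Proof. by rewrite /natext !valK. Qed.
Lemma natext1E e (v : 'I_n) : natext1 e v = e v.
Proof. by rewrite /natext1 valK. Qed.

Variant natext_spec (c : 'I_n -> 'I_n -> H) (i j : nat) : H -> Prop :=
| NatextIn (v w : 'I_n) of i = v & j = w : natext_spec c i j (c v w)
| NatextOut of (n <= i)%N || (n <= j)%N : natext_spec c i j 0.

Lemma natextP c i j : natext_spec c i j (natext c i j).
Proof.
rewrite /natext; case: insubP => [v _ vE|]; last first.
  by rewrite -leqNgt => h; apply: NatextOut; rewrite h.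
case: insubP => [w _ wE|]; first exact: NatextIn.
by rewrite -leqNgt => h; apply: NatextOut; rewrite h orbT.
Qed.

End NatExt.

Lemma vrel_map (T U : Type) (g : T -> U) (H : pzRingType) q (f : U -> H) s par :
  vrel q f (map g s) par = vrel q (f \o g) s par.
Proof. by case: par => /=; [case: s => //= x s|]; rewrite (map_comp f g). Qed.

Section Shape.
Variables (n : nat) (adj : rel 'I_n) (adjN : rel nat) (r : 'I_n) (lt : 'I_n -> rel 'I_n).
Hypothesis adjE : forall v w : 'I_n, adj v w = adjN v w.
Hypothesis adj_rooted : rooted adj r.
Hypothesis adj_sym : symmetric adj.

Definition shapeN (i : nat) : seq nat * bool :=
  if insub i is Some v then (map val (nbrs adj r lt v), has_parent adj r v) else ([::], false).

Lemma shapeNE (v : 'I_n) : shapeN v = (map val (nbrs adj r lt v), has_parent adj r v).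
Proof. by rewrite /shapeN valK. Qed.

Lemma shapeN_shaped : shaped adjN n shapeN.
Proof.
move=> i ni; have -> : i = val (Ordinal ni) by [].
rewrite shapeNE /=; apply: perm_trans (perm_map _ (perm_nbrs lt adj_rooted adj_sym _)) _.
rewrite -(val_enum_ord n) filter_map.
rewrite [X in perm_eq _ (map _ X)](eq_filter (a2 := adj (Ordinal ni))) //.
Qed.

Lemma shapeN_vrel (H : pzRingType) q (c : 'I_n -> 'I_n -> H) :
  (forall v, bigcirc q [seq c v w * c w v | w <- children adj r lt v] =
     \sum_(u | away adj r u v) c v u * c u v) <->
  (forall i, (i < n)%N -> vrel q (loop (natext c) i) (shapeN i).1 (shapeN i).2).
Proof.
have E (v : 'I_n) : vrel q (loop (natext c) v) (shapeN v).1 (shapeN v).2 <->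
    bigcirc q [seq c v w * c w v | w <- children adj r lt v] =
     \sum_(u | away adj r u v) c v u * c u v.
  rewrite -(vrel_nbrs lt adj_rooted) shapeNE /= vrel_map.
  have lE : loop (natext c) v \o val =1 (fun w => c v w * c w v).
    by move=> w; rewrite /= /loop !natextE.
  rewrite /vrel; case: has_parent; last by rewrite (eq_map lE).
  by case: (nbrs _ _ _ _) => //= u s; rewrite (eq_map lE) /loop !natextE.
split=> h => [i ni|v]; first by apply/(E (Ordinal ni)).
by apply/E/h/ltn_ord.
Qed.

Lemma shapeN_root i : (i < n)%N -> (shapeN i).2 = (i != r :> nat).
Proof.
move=> ni; have -> : i = val (Ordinal ni) by []; rewrite shapeNE /= /has_parent.
have [_ _ root par] := adj_rooted.
have [iE|ir] := eqVneq (Ordinal ni) r.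
  have -> : (i != r) = false by rewrite -iE eqxx.
  apply/negbTE; rewrite negbK iE; case pE : (parents _ _ _) => [|u s] //.
  by have := root u; rewrite -mem_parents pE mem_head.
have -> : i != r by rewrite -val_eqE in ir.
have [u uv] := par _ ir; apply/eqP => p0.
by have := mem_parents adj r (Ordinal ni) u; rewrite p0 uv.
Qed.

End Shape.

(** * Construction of the quasi-isomorphism *)

Section Shallow.
Variables (K : fieldType) (V : finType) (Q : gquiver V).
Local Notation A := (pathalg K Q).
Implicit Types (x y z : A).

Definition shallow m x : Prop := forall p, p \in msupp x -> (size (pword p) <= m)%N.

Lemma shallowP m x : shallow m x <-> forall p, x@_p != 0 -> (size (pword p) <= m)%N.
Proof. by split=> h p; have := h p; rewrite mcoeff_neq0. Qed.

Lemma shallow0 m : shallow m 0.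
Proof. by move=> p; rewrite msupp0. Qed.

Lemma shallowL m c x y : shallow m x -> shallow m y -> shallow m (c *: x + y).
Proof.
move=> /shallowP hx /shallowP hy; apply/shallowP => p.
rewrite mcoeffD mcoeffZ; have [/eqP x0|/hx//] := boolP (x@_p == 0).
by rewrite x0 mulr0 add0r => /hy.
Qed.

Lemma shallowD m x y : shallow m x -> shallow m y -> shallow m (x + y).
Proof. by move=> hx hy; rewrite -[x]scale1r; apply: shallowL. Qed.

Lemma shallowN m x : shallow m x -> shallow m (- x).
Proof. by move=> hx; rewrite -scaleN1r -[_ *: _]addr0; apply/shallowL/shallow0. Qed.

Lemma shallow_sum m (I : Type) (r : seq I) (P : pred I) (F : I -> A) :
  (forall j, P j -> shallow m (F j)) -> shallow m (\sum_(j <- r | P j) F j).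
Proof. exact: (big_ind _ (shallow0 m) (@shallowD m)). Qed.

Lemma shallow_word m v s : (size s <= m)%N -> shallow m (wbase K v s : A).
Proof.
move=> sm; have [vs|/(wbase0 K)->] := boolP (is_word v s); last exact: shallow0.
by move=> p; rewrite (wbaseE K vs) => /(fsubsetP msuppU_le); rewrite inE => /eqP ->.
Qed.

Lemma shallow_ind m x (S : A -> Prop) : shallow m x ->
  S 0 -> (forall c y z, S y -> S z -> S (c *: y + z)) ->
  (forall v s, is_word v s -> (size s <= m)%N -> S (wbase K v s)) -> S x.
Proof. by move=> hx S0 SP Sw; apply: supp_ind => // v s vs /hx; apply: Sw. Qed.

Lemma shallowM m n x y : shallow m x -> shallow n y -> shallow (m + n)%N (x * y).
Proof.
move=> hx hy; apply: (shallow_ind (S := fun x => shallow (m + n)%N (x * y)) hx).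
- by rewrite mul0r; apply: shallow0.
- by move=> c x1 x2 h1 h2; rewrite mulrDl -scalerAl; apply: shallowL.
move=> v s vs ms; apply: (shallow_ind (S := fun y => shallow (m + n)%N (wbase K v s * y)) hy).
- by rewrite mulr0; apply: shallow0.
- by move=> c x1 x2 h1 h2; rewrite mulrDr -scalerAr; apply: shallowL.
move=> w t wt nt; rewrite wbaseM //; case: ifP => _; last exact: shallow0.
by apply: shallow_word; rewrite size_cat leq_add.
Qed.

Lemma shallow_deep m x : shallow m x -> deep m.+1 x -> x = 0.
Proof.
move=> hs hd; apply/malgP => p; rewrite mcoeff0; apply/eqP/negPn/negP => px.
by have := (deepP _ _).1 hd p px; have := (shallowP _ _).1 hs p px; lia.
Qed.

Definition short : A -> A := lext (fun p => if (size (pword p) <= 1)%N then pbase K p else 0).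
HB.instance Definition _ := GRing.Linear.on short.

Lemma short_word v s : is_word v s ->
  short (wbase K v s) = if (size s <= 1)%N then wbase K v s else 0.
Proof. by move=> vs; rewrite (wbaseE K vs) /short lextU. Qed.

Lemma short_homog i x : pahomog i x -> pahomog i (short x).
Proof.
move=> hx; apply: (homog_ind (S := fun x => pahomog i (short x)) hx).
- by rewrite linear0; apply: pahomog0.
- by move=> c y z hy hz; rewrite linearP; apply: pahomogL.
move=> v s vs <-; rewrite short_word //; case: ifP => _; last exact: pahomog0.
exact: pahomog_wbase.
Qed.

Lemma short_deep x : deep 2 (x - short x).
Proof.
elim/pathalg_ind: x => [|c y z hy hz|v s vs].
- by rewrite linear0 subrr; apply: deep0.
- by rewrite linearP /= opprD addrACA -scalerN -scalerDr; apply: deepL.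
rewrite short_word //; case: ifP => h; first by rewrite subrr; apply: deep0.
by rewrite subr0; apply: deep_word; rewrite ltnNge h.
Qed.

Variable delta : arrow Q -> A.
Hypothesis deltaE : delta_bimod delta.
Hypothesis delta_deep : forall a, deep 2 (delta a).
Hypothesis delta_shallow : forall a, shallow 2 (delta a).

(** Paths of length at most 1 have coboundaries of length at most 2, so the short
part of y does not contribute to D y. *)
Lemma improve i y : pahomog i y -> deep 3 (qfree_diff delta y) ->
  exists y', [/\ pahomog i y', deep 2 y' & qfree_diff delta y' = qfree_diff delta y].
Proof.
move=> hy dy; exists (y - short y); split.
- by apply/pahomogD/pahomogN/short_homog.
- exact: short_deep.
rewrite linearB /=; suff -> : qfree_diff delta (short y) = 0 by rewrite subr0.
apply: (@shallow_deep 2).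
  elim/pathalg_ind: {hy dy} y => [|c y z hy hz|v s vs].
  - by rewrite !linear0; apply: shallow0.
  - by rewrite !linearP; apply: shallowL.
  rewrite short_word //; case: ifP => h; last by rewrite linear0; apply: shallow0.
  case: s vs h => [|a []] // vs _; first by rewrite qfree_diff_pidem; apply: shallow0.
  have -> : v = asrc a by move: vs => /= /andP[/eqP].
  by rewrite qfree_diff_pgen.
rewrite -[short y](subKr y) linearB /=; apply: deepB => //.
exact: (diff_deepS delta_deep (@short_deep y)).
Qed.

End Shallow.

Section Assembly.
Variables (K : fieldType) (n : nat) (adj : rel 'I_n) (adjN : rel nat).
Variables (r : 'I_n) (lt : 'I_n -> rel 'I_n).
Hypothesis adjE : forall v w : 'I_n, adj v w = adjN v w.
Hypothesis adj_rooted : rooted adj r.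
Hypothesis adj_sym : symmetric adj.
Hypothesis lt_order : child_order adj r lt.
Local Notation sh := (shapeN adj r lt).
Local Notation away := (away adj r).
Local Notation G := (ginz_quiver adj r).
Local Notation L := (lca_quiver adj r).
Local Notation gz := (gz_c K adj r).
Local Notation lc := (lca_c adj r K).

(** The two inputs that depend on the type of the tree: nilpotency of the arrows,
and deformation of the Ginzburg arrows. *)
Hypothesis Hnil : forall (H : pzRingType) q (c : nat -> nat -> H) s,
  (forall i j k l, j <> k -> c i j * c k l = 0) -> (forall i j, ~~ adjN i j -> c i j = 0) ->
  shaped adjN n s -> (forall i, (i < n)%N -> vrel q (loop c i) (s i).1 (s i).2) ->
  nilS (arrows_from n c 0).
Hypothesis Hdef : forall (H : pzRingType) (sc : K -> H) (c : nat -> nat -> H) (e : nat -> H),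
  (forall a b, sc (a + b) = sc a + sc b) -> sc 1 = 1 -> (forall a x, sc a * x = x * sc a) ->
  (forall i j, e i * c i j = c i j /\ c i j * e j = c i j) ->
  (forall i j k l, j <> k -> c i j * c k l = 0) -> (forall i j, ~~ adjN i j -> c i j = 0) ->
  (forall i, (i < n)%N -> vrel false (loop c i) (sh i).1 (sh i).2) ->
  exists X : nat -> nat -> H,
  [/\ forall i j, e i * X i j * e j = X i j,
      forall i j, higher c (X i j - c i j)
    & forall i, (i < n)%N -> vrel true (loop X i) (sh i).1 (sh i).2].

Lemma natext_orth (H : pzRingType) (c : 'I_n -> 'I_n -> H) :
  (forall v w x y, w <> x -> c v w * c x y = 0) ->
  forall i j k l, j <> k -> natext c i j * natext c k l = 0.
Proof.
move=> orth i j k l; case: natextP => [v w _ ->|_]; last by rewrite mul0r.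
case: natextP => [x y -> _|_]; last by rewrite mulr0.
by move=> wx; apply: orth => h; apply: wx; rewrite h.
Qed.

Lemma natext_adj (H : pzRingType) (c : 'I_n -> 'I_n -> H) :
  (forall v w, ~~ adj v w -> c v w = 0) ->
  forall i j, ~~ adjN i j -> natext c i j = 0.
Proof.
move=> c0 i j; case: natextP => // v w -> -> vw; apply: c0.
by rewrite adjE.
Qed.

Lemma natext_in (H : pzRingType) (c : 'I_n -> 'I_n -> H) v w :
  c v w \in arrows_from n (natext c) 0.
Proof.
by apply/arrows_fromP; exists (val v), (val w); rewrite natextE !ltn_ord.
Qed.

Lemma ginz_H0 : exists (H : pzRingType) (pi : {rmorphism pathalg K G -> H}),
  [/\ forall x, pahomog 0 x -> (pi x = 0 <-> exists2 w, pahomog (-1) w & x = qfree_diff (ginz_delta K) w),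
      forall u, exists2 x, pahomog 0 x & pi x = u,
      forall c x, pi (c *: 1) * pi x = pi x * pi (c *: 1)
    & forall i, (i < n)%N -> vrel false (loop (natext (fun v w => pi (gz v w))) i) (sh i).1 (sh i).2].
Proof.
have [H [pi [piE piS piC]]] := H0_ring (@ginz_delta_bimod _ adj r K)
  (@ginz_delta_deg _ adj r K) (@ginz_deg _ adj r).
exists H, pi; split=> //; apply/shapeN_vrel => // v.
rewrite sum_children; apply/eqP; rewrite -subr_eq0.
have : pi (ginz_delta K (inr v : arrow G)) = 0.
  apply/piE; first exact: (@ginz_delta_deg _ adj r K (inr v)).
  exists (pgen K (inr v : arrow G)); first exact: pahomog_pgen.
  by rewrite qfree_diff_pgen //; apply: ginz_delta_bimod.
rewrite gz_delta // rmorphB !rmorph_sum /= => /eqP.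
by under eq_bigr do rewrite rmorphM; under [X in _ - X]eq_bigr do rewrite rmorphM.
Qed.

Lemma lca_H0 : exists (H : pzRingType) (pi : {rmorphism pathalg K L -> H}),
  (forall x, pahomog 0 x -> (pi x = 0 <-> exists2 w, pahomog (-1) w & x = qfree_diff (lca_delta K lt) w))
  /\ forall i, (i < n)%N -> vrel true (loop (natext (fun v w => pi (lc v w))) i) (sh i).1 (sh i).2.
Proof.
have [H [pi [piE piS piC]]] := H0_ring (@lca_delta_bimod _ adj r K lt)
  (@lca_delta_deg _ adj r K lt) (@lca_deg_cases _ adj r).
exists H, pi; split=> //; apply/shapeN_vrel => // v.
apply/eqP; rewrite -subr_eq0.
have : pi (lca_delta K lt (inl v : arrow L)) = 0.
  apply/piE; first exact: (@lca_delta_deg _ adj r K lt (inl v)).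
  exists (pgen K (inl v : arrow L)); first exact: pahomog_pgen.
  by rewrite qfree_diff_pgen //; apply: lca_delta_bimod.
rewrite lca_deltaE // rmorphB !rmorph_sum /= => /eqP.
have circE s : pi (bigcirc true [seq lc v w * lc w v | w <- s]) =
    bigcirc true [seq pi (lc v w) * pi (lc w v) | w <- s].
  elim: s => [|w s IHs] /=; first by rewrite rmorph0.
  by rewrite /circ !mulr1n !rmorphD !rmorphM /= IHs.
by rewrite circE; under [X in _ - X]eq_bigr do rewrite rmorphM.
Qed.

Lemma pi_orth (Q : gquiver 'I_n) (H : pzRingType) (pi : {rmorphism pathalg K Q -> H})
    (c : 'I_n -> 'I_n -> pathalg K Q) :
  (forall v w, pidem K Q v * c v w = c v w) -> (forall v w, c v w * pidem K Q w = c v w) ->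
  forall v w x y, w <> x -> pi (c v w) * pi (c x y) = 0.
Proof.
move=> cl cr v w x y /eqP/negPf wx.
by rewrite -(cr v) -(cl x) -rmorphM -mulrA (mulrA (pidem _ _ _)) pidemM wx mul0r mulr0 rmorph0.
Qed.

Lemma ginz_dead : exists N, forall v (s : seq (arrow G)), is_word v s -> size s = N ->
  (forall a, a \in s -> adeg a = 0) ->
  exists2 w, pahomog (-1) w & wbase K v s = qfree_diff (ginz_delta K) w.
Proof.
have [H [pi [piE _ _ rels]]] := ginz_H0.
have nS : nilS (arrows_from n (natext (fun v w => pi (gz v w))) 0).
  apply: Hnil rels; [|apply: natext_adj|exact: shapeN_shaped].
  - by apply/natext_orth/pi_orth => [v w|v w]; [apply: gz_c_l | apply: gz_c_r].
  by move=> v w vw; rewrite gz_c0 // rmorph0.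
have [|N hN] := dead_of_nil (pi := pi) nS.
  move=> [[g|g]|v] // _.
    by rewrite -[pgen _ _]/(ginz_g K g) -(gz_c_g K g); exact: (natext_in (fun v w => pi (gz v w))).
  rewrite -[pgen _ _]/(ginz_g' K g) -(gz_c_g' K adj_rooted g).
  exact: (natext_in (fun v w => pi (gz v w))).
exists N => v s vs sN s0; apply/piE; last exact: hN.
exact: word_homog0.
Qed.

Lemma lca_dead : exists N, forall v (s : seq (arrow L)), is_word v s -> size s = N ->
  (forall a, a \in s -> adeg a = 0) ->
  exists2 w, pahomog (-1) w & wbase K v s = qfree_diff (lca_delta K lt) w.
Proof.
have [H [pi [piE rels]]] := lca_H0.
have nS : nilS (arrows_from n (natext (fun v w => pi (lc v w))) 0).
  apply: Hnil rels; [|apply: natext_adj|exact: shapeN_shaped].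
  - by apply/natext_orth/pi_orth => [v w|v w]; [apply: lca_c_l | apply: lca_c_r].
  by move=> v w vw; rewrite lca_c0 // rmorph0.
have [|N hN] := dead_of_nil (pi := pi) nS.
  move=> [v|p] // _.
  by rewrite -lca_c_adj; exact: (natext_in (fun v w => pi (lc v w))).
exists N => v s vs sN s0; apply/piE; last exact: hN.
exact: word_homog0.
Qed.

(** Lifts of the deformed arrows from H^0 to the path algebra. *)
Lemma deform_ginz : exists X : 'I_n -> 'I_n -> pathalg K G,
  [/\ forall v w, pidem K G v * X v w = X v w,
      forall v w, X v w * pidem K G w = X v w,
      forall v w, pahomog 0 (X v w),
      forall v w, deep 2 (gz v w - X v w) &
      forall v, exists2 y, pahomog (-1) y &
        bigcirc true [seq X v w * X w v | w <- children adj r lt v] -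
        \sum_(u | away u v) X v u * X u v = qfree_diff (ginz_delta K) y].
Proof.
have [H [pi [piE piS piC rels]]] := ginz_H0.
pose c := natext (fun v w => pi (gz v w)).
pose e := natext1 (fun v => pi (pidem K G v)).
have [||||||X [Xe Xh Xrel]] := @Hdef H (fun a => pi (a *: 1)) c e _ _ _ _ _ _ rels.
- by move=> a b; rewrite scalerDl rmorphD.
- by rewrite scale1r rmorph1.
- by move=> a u; have [x _ <-] := piS u.
- move=> i j; rewrite /c; case: natextP => [v w -> ->|_]; last by rewrite mulr0 mul0r.
  by split; rewrite /e natext1E -rmorphM ?gz_c_l ?gz_c_r.
- by apply/natext_orth/pi_orth => [v w|v w]; [apply: gz_c_l | apply: gz_c_r].
- by apply: natext_adj => v w vw; rewrite gz_c0 // rmorph0.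
have c_lift i j : exists x, [/\ pahomog 0 x, deep 1 x & pi x = c i j].
  rewrite /c; case: natextP => [v w _ _|_].
    by exists (gz v w); split; [apply: gz_c_homog | apply: gz_c_deep |].
  by exists 0; split; [apply: pahomog0 | apply: deep0 | apply: rmorph0].
have zex (p : 'I_n * 'I_n) : exists x, [/\ pahomog 0 x, deep 2 x &
    pi x = X p.1 p.2 - c p.1 p.2] by apply: higher_lift.
have {zex} [z hz] := fin_all_exists zex.
pose Y v w := pidem K G v * (gz v w + z (v, w)) * pidem K G w.
have YE v w : Y v w = gz v w + pidem K G v * z (v, w) * pidem K G w.
  by rewrite /Y mulrDr mulrDl gz_c_l // gz_c_r //.
have hY v w : pahomog 0 (Y v w).
  rewrite -[0]/(0 + 0 + 0 : int); apply/pahomogM/pahomog_pidem/pahomogM.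
    exact: pahomog_pidem.
  by apply: pahomogD; [apply: gz_c_homog | case: (hz (v, w))].
have piY v w : pi (Y v w) = X v w.
  have [_ _ zE] := hz (v, w); rewrite /Y !rmorphM rmorphD /= zE /c natextE.
  by rewrite (addrC (pi _)) subrK -[RHS]Xe /e !natext1E.
have Yl v w : pidem K G v * Y v w = Y v w by rewrite /Y !mulrA pidemM eqxx.
have Yr v w : Y v w * pidem K G w = Y v w by rewrite /Y -!mulrA pidemM eqxx.
have dY v w : deep 2 (gz v w - Y v w).
  rewrite YE opprD addNKr; apply/deepN/deepMr/deepMl.
  by case: (hz (v, w)).
clearbody Y; exists Y; split=> // v; set R := _ - _.
have hM v1 w1 v2 w2 : pahomog 0 (Y v1 w1 * Y v2 w2).
  by rewrite -[0]/(0 + 0 : int); apply: pahomogM.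
have hR : pahomog 0 R.
  rewrite /R; apply: pahomogD; last by apply/pahomogN/pahomog_sum => u _; apply: hM.
  elim: (children _ _ _ _) => [|x s IHs] /=; first exact: pahomog0.
  rewrite /circ mulr1n; do ![apply: pahomogD] => //.
  by rewrite -[X in pahomog X]/(0 + 0 : int); apply: pahomogM.
suff piR : pi R = 0 by have [w hw RE] := (piE R hR).1 piR; exists w.
have := Xrel v (ltn_ord v); rewrite shapeNE /= vrel_map (vrel_nbrs lt adj_rooted) => Xv.
have circE s : pi (bigcirc true [seq Y v w * Y w v | w <- s]) =
    bigcirc true (map (loop X v \o val) s).
  elim: s => [|w s IHs] /=; first by rewrite rmorph0.
  by rewrite /circ !mulr1n !rmorphD !rmorphM /= IHs !piY.
rewrite /R rmorphB circE Xv rmorph_sum /= -sumrB big1 // => u _.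
by rewrite rmorphM !piY subrr.
Qed.

Definition l_arrow_image (X : 'I_n -> 'I_n -> pathalg K G) (h : 'I_n -> pathalg K G)
    (a : arrow L) : pathalg K G :=
  match a : lca_arrow adj with inl v => h v | inr p => X (val p).1 (val p).2 end.

(** The arrows c_wv are mapped to the deformed arrows X w v.  The LCA relation
R v between these is a coboundary, and c_v must go to some h v with D (h v) = R v.
Since R v agrees with d h_v up to paths of length 3, [improve] allows to take for
h v the generator h_v plus longer paths, so that f has the leading terms required
by [f_inj_coh] and [f_surj_coh]. *)
Lemma lca_ginz_quasi_iso :
  exists f : {lrmorphism LCA adj r K lt -> Ginzburg adj r K}, quasi_iso f.
Proof.
have [X [Xl Xr hX dX relX]] := deform_ginz.
pose R v := bigcirc true [seq X v w * X w v | w <- children adj r lt v] -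
        \sum_(u | away u v) X v u * X u v.
have X1 v w : deep 1 (X v w).
  rewrite -[X v w](subKr (gz v w)); apply: deepB; first exact: gz_c_deep.
  by apply: deep_mono (dX v w) _.
have loop3 v w : deep 3 (X v w * X w v - gz v w * gz w v).
  have -> : X v w * X w v - gz v w * gz w v =
      (- (gz v w - X v w)) * X w v + gz v w * (- (gz w v - X w v)).
    by rewrite !opprB mulrBl mulrBr addrA subrK.
  apply: deepD; first exact: (@deepM _ _ _ 2 1 _ _ (deepN (dX v w)) (X1 w v)).
  by apply: (@deepM _ _ _ 1 2); [apply: gz_c_deep | apply: deepN].
have R3 v : deep 3 (R v - ginz_delta K (inr v : arrow G)).
  rewrite gz_delta // -(sum_children adj r lt (fun w => gz v w * gz w v)).
  have addBB (a b c d : pathalg K G) : (a - b) - (c - d) = (a - c) + (d - b).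
    by rewrite opprB addrACA [RHS]addrACA (addrC (- b)).
  rewrite /R addBB; apply: deepD; last first.
    by rewrite -sumrB; apply: deep_sum => u _; rewrite -opprB; apply/deepN/loop3.
  elim: (children _ _ _ _) => [|w s IHs] /=; first by rewrite subrr; apply: deep0.
  rewrite /circ mulr1n mulr0n addr0.
  have addBBB (a b c d f : pathalg K G) : (a + b + c) - (d + f) = (a - d) + (b - f) + c.
    by rewrite opprD addrAC addrACA.
  rewrite addBBB; apply: deepD; first by apply: deepD => //; apply: loop3.
  have l2 x : deep 2 (X v x * X x v) by apply: (@deepM _ _ _ 1 1).
  by apply: (@deepM _ _ _ 2 1) => //; apply: bigcirc_deep => x; apply: deep_mono (l2 x) _.
have d2E := @ginz_delta_bimod _ adj r K.
have d2h := @ginz_delta_deg _ adj r K.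
have d2Q := @ginz_deg _ adj r.
have Rl v : pidem K G v * R v = R v.
  rewrite /R mulrBr; congr (_ - _).
    elim: (children _ _ _ _) => [|w s IHs] /=; first by rewrite mulr0.
    by rewrite /circ !mulrDr IHs mulr1n !mulrA !Xl.
  by rewrite mulr_sumr; apply: eq_bigr => u _; rewrite mulrA Xl.
have Rr v : R v * pidem K G v = R v.
  rewrite /R mulrBl; congr (_ - _).
    elim: (children _ _ _ _) => [|w s IHs] /=; first by rewrite mul0r.
    by rewrite /circ !mulrDl mulr1n -!mulrA IHs !Xr.
  by rewrite mulr_suml; apply: eq_bigr => u _; rewrite -mulrA Xr.
have hex (v : 'I_n) : exists y, [/\ pahomog (-1) y, deep 2 y &
    qfree_diff (ginz_delta K) y = R v - ginz_delta K (inr v : arrow G)].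
  have [w hw wE] := relX v.
  have E : qfree_diff (ginz_delta K) (w - pgen K (inr v : arrow G)) =
      R v - ginz_delta K (inr v : arrow G).
    by rewrite linearB /= -wE qfree_diff_pgen.
  rewrite -E; apply: (improve d2E).
  - by apply: ginz_delta_deep.
  - move=> [a|u]; first exact: shallow0.
    have gs x y : shallow 1 (gz x y).
      by case: gz_cP => // [g _|g _|_]; [exact: shallow_word | exact: shallow_word | exact: shallow0].
    rewrite gz_delta //; apply: shallowD; last apply: shallowN;
      apply: shallow_sum => x _; exact: (@shallowM _ _ _ 1 1).
  - apply: pahomogD => //; apply: pahomogN; exact: (@pahomog_pgen K _ G (inr v)).
  by rewrite E.
have {hex} [y hy] := fin_all_exists hex.
pose h v := pgen K (inr v : arrow G) + pidem K G v * y v * pidem K G v.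
have genl v : pidem K G v * pgen K (inr v : arrow G) = pgen K (inr v : arrow G).
  exact: (@pidem_wbase K _ G v [:: inr v]).
have genr v : pgen K (inr v : arrow G) * pidem K G v = pgen K (inr v : arrow G).
  exact: (@wbase_pidem K _ G v [:: inr v]).
have hl v : pidem K G v * h v * pidem K G v = h v.
  rewrite /h mulrDr mulrDl genl genr !mulrA pidemM eqxx -!mulrA pidemM eqxx.
  by rewrite !mulrA.
have hh v : pahomog (-1) (h v).
  apply: pahomogD; first exact: (@pahomog_pgen K _ G (inr v)).
  have [h1 _ _] := hy v; rewrite -[-1 : int]/(0 + -1 + 0 : int).
  by apply/pahomogM/pahomog_pidem/pahomogM/h1/pahomog_pidem.
have Dh v : qfree_diff (ginz_delta K) (h v) = R v.
  have [h1 _ yE] := hy v; rewrite linearD /= qfree_diff_pgen // -mulrA.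
  have dE : pidem K G v * ginz_delta K (inr v : arrow G) * pidem K G v =
      ginz_delta K (inr v : arrow G) by exact: (d2E (inr v)).
  rewrite (diff_idem d2E d2h d2Q) (diff_mul1 d2E) // qfree_diff_pidem mulr0 subr0 yE.
  by rewrite mulrBl mulrBr Rr Rl mulrA dE addrC subrK.
pose phi := l_arrow_image X h.
have [|f [f_idem f_gen]] := @path_morphism K _ L (pathalg K G) (pidem K G) phi
   (@pidemM K _ G) (pidem_sum K G).
  move=> [v|p]; first exact: hl.
  by rewrite /= Xl Xr.
have f_h (a : arrow L) : pahomog (adeg a) (f (pgen K a)).
  by rewrite f_gen; case: a => [v|p]; [apply: hh | apply: hX].
have f_c v w : adj v w -> f (lc v w) = X v w.
  move=> vw; pose p : {p : 'I_n * 'I_n | adj p.1 p.2} := exist _ (v, w) vw.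
  by rewrite -[lc v w]/(lc (val p).1 (val p).2) lca_c_adj f_gen.
have d1E := @lca_delta_bimod _ adj r K lt.
have d1h := @lca_delta_deg _ adj r K lt.
have f_d (a : arrow L) : f (lca_delta K lt a) = qfree_diff (ginz_delta K) (f (pgen K a)).
  rewrite f_gen; case: a => [v|p]; last first.
    by rewrite (linear0 f) /phi /= (diff_homog0 d2h d2Q).
  rewrite -[phi _]/(h v) Dh lca_deltaE // rmorphB /= rmorph_sum /= /R; congr (_ - _).
    have: all (away v) (children adj r lt v) by apply/allP => w; rewrite mem_children.
    elim: (children _ _ _ _) => [|w s IHs] /=; first by rewrite rmorph0.
    move=> /andP[/away_adj vw /IHs <-]; rewrite /circ !mulr1n !rmorphD !rmorphM /=.
    by rewrite !f_c // adj_sym.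
  by apply: eq_bigr => u /away_adj vu; rewrite rmorphM /= !f_c // adj_sym.
have f_lead (a : arrow L) : deep 2 (pgen K (l2g a) - f (pgen K a)).
  rewrite f_gen; case: a => [v|p]; last by rewrite l2g_gen //; apply: dX.
  rewrite -[phi _]/(h v) /h opprD addNKr; apply/deepN/deepMr/deepMl.
  by case: (hy v).
have f_diff := pathmor_diff d1E d2E f_idem f_h f_d.
have f_homog d x : pahomog d x -> pahomog d (f x) by move=> hx; apply: (pathmor_homog f_idem f_h hx).
have [N1 dead1] := lca_dead.
have [N2 dead2] := ginz_dead.
exists f; split.
- by split.
- move=> i x [hx Dx]; exact: (f_inj_coh (l2gK adj_rooted adj_sym) (g2lK adj_rooted adj_sym)
    (l2g_src adj_rooted) (l2g_tgt adj_rooted) (l2g_deg adj_rooted) f_idem f_lead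
    f_homog d1E d1h (@lca_delta_square _ adj r K lt) (@lca_deg_cases _ adj r)
    (fun a => @lca_delta_deep K _ adj r lt lt_order a)
    (fun a => @ginz_delta_deep K _ adj r adj_rooted a) dead1 f_diff hx Dx).
move=> i y0 [hx Dx]; exact: (f_surj_coh (l2gK adj_rooted adj_sym) (g2lK adj_rooted adj_sym)
    (l2g_src adj_rooted) (l2g_tgt adj_rooted) (l2g_deg adj_rooted) f_idem f_lead
    f_homog d1E d1h (@lca_delta_square _ adj r K lt) d2E d2h (@ginz_delta_square _ adj r K)
    (@lca_deg_cases _ adj r) (fun a => @lca_delta_deep K _ adj r lt lt_order a)
    (fun a => @ginz_delta_deep K _ adj r adj_rooted a) dead1 dead2 f_diff hx Dx).
Qed.

End Assembly.

Lemma typeA_quasi_iso (K : fieldType) n (r : 'I_n) (lt : 'I_n -> rel 'I_n) :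
  child_order (Dynkin_A n) r lt ->
  exists f : {lrmorphism LCA (Dynkin_A n) r K lt -> Ginzburg (Dynkin_A n) r K}, quasi_iso f.
Proof.
move=> lt_order; have rooted_A := @Dynkin_A_rooted n r.
apply: (lca_ginz_quasi_iso (adjN := adjA n)) => //; first exact: adjAE.
- exact: Dynkin_A_sym.
- by move=> H q c s orth adj0 shA rels; apply: (A_nil orth rels adj0 shA).
move=> H sc c e scD sc1 scC ce orth adj0 rels.
apply: (typeA_deform (r := r) ce orth adj0 _ rels) => [|i ni]; last exact: shapeN_root.
by apply: shapeN_shaped => //; [apply: adjAE | apply: Dynkin_A_sym].
Qed.

Lemma typeD_quasi_iso (K : fieldType) n (r : 'I_n) (lt : 'I_n -> rel 'I_n) :
  (4 <= n)%N -> child_order (Dynkin_D n) r lt -> 2%N \notin [pchar K] ->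
  exists f : {lrmorphism LCA (Dynkin_D n) r K lt -> Ginzburg (Dynkin_D n) r K}, quasi_iso f.
Proof.
move=> n4 lt_order char2; have rooted_D := @Dynkin_D_rooted n r n4.
have two0 : 2%:R != 0 :> K by move: char2; rewrite inE.
apply: (lca_ginz_quasi_iso (adjN := adjD n)) => //.
- exact: Dynkin_D_sym.
- by move=> H q c s orth adj0 shD rels; apply: (D_nil orth rels n4 adj0 shD).
move=> H sc c e scD sc1 scC ce orth adj0 rels.
apply: (typeD_deform (h := sc 2%:R^-1) n4 _ _ ce orth adj0 _ rels) => //.
  have E : 2%:R^-1 + 2%:R^-1 = 1 :> K by rewrite -mulr2n -[LHS]mulr_natr mulVf.
  by rewrite -scD E.
by apply: shapeN_shaped => //; apply: Dynkin_D_sym.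
Qed.

(** * The correspondence induced by a zigzag *)

Section Correspondence.
Variables (K : fieldType) (V : finType).
Implicit Types A B C : dgAlg K V.

(** The graph, on cocycles of degree 0, of the isomorphism H^0(A) -> H^0(B)
induced by a zigzag of quasi-isomorphisms.  Unlike maps, relations compose with
quasi-isomorphisms in either direction. *)
Record H0corr A B (rho : A -> B -> Prop) : Prop := H0Corr {
  corr_cocycle : forall x y, rho x y -> dg_cocycle 0 x /\ dg_cocycle 0 y;
  corr_lin : forall a x x' y y', rho x y -> rho x' y' -> rho (a *: x + x') (a *: y + y');
  corr_mul : forall x x' y y', rho x y -> rho x' y' -> rho (x * x') (y * y');
  corr_idem : forall v, rho (dg_idem v) (dg_idem v);
  corr_total : forall x, dg_cocycle 0 x -> exists y, rho x y;
  corr_onto : forall y, dg_cocycle 0 y -> exists x, rho x y;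
  corr_cob : forall x y, rho x y -> dg_coboundary 0 x <-> dg_coboundary 0 y
}.

Lemma cocycleL A a (x y : A) : dg_cocycle 0 x -> dg_cocycle 0 y -> dg_cocycle 0 (a *: x + y).
Proof.
move=> [hx dx] [hy dy]; split; first exact: dg_homogP.
by rewrite linearP dx dy /= scaler0 addr0.
Qed.

Lemma cocycleM A (x y : A) : dg_cocycle 0 x -> dg_cocycle 0 y -> dg_cocycle 0 (x * y).
Proof.
move=> [hx dx] [hy dy]; split; first by rewrite -[0]addr0; apply: dg_homogM.
by rewrite (dg_leibniz _ hx) dx dy mul0r !mulr0 addr0.
Qed.

Lemma coboundary0 A : dg_coboundary 0 (0 : A).
Proof. by exists 0; [apply: dg_homog0 | rewrite linear0]. Qed.

Lemma coboundaryL A a (x y : A) :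
  dg_coboundary 0 x -> dg_coboundary 0 y -> dg_coboundary 0 (a *: x + y).
Proof.
move=> [u hu ->] [w hw ->]; exists (a *: u + w); first exact: dg_homogP.
by rewrite linearP.
Qed.

Lemma coboundaryD A (x y : A) :
  dg_coboundary 0 x -> dg_coboundary 0 y -> dg_coboundary 0 (x + y).
Proof. by move=> hx hy; rewrite -[x]scale1r; apply: coboundaryL. Qed.

Lemma coboundaryN A (x : A) : dg_coboundary 0 x -> dg_coboundary 0 (- x).
Proof. by move=> hx; rewrite -scaleN1r -[_ *: _]addr0; apply/coboundaryL/coboundary0. Qed.

Lemma coboundary_mull A (x y : A) :
  dg_coboundary 0 x -> dg_cocycle 0 y -> dg_coboundary 0 (x * y).
Proof.
move=> [u hu ->] [hy dy]; exists (u * y); first by rewrite -[0 - 1]addr0; apply: dg_homogM.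
by rewrite (dg_leibniz _ hu) dy !mulr0 addr0.
Qed.

Lemma coboundary_mulr A (x y : A) :
  dg_cocycle 0 x -> dg_coboundary 0 y -> dg_coboundary 0 (x * y).
Proof.
move=> [hx dx] [u hu ->]; exists (x * u); first by rewrite -[0 - 1]add0r; apply: dg_homogM.
by rewrite (dg_leibniz _ hx) dx mul0r add0r expr0 mul1r.
Qed.

Lemma cohomM A (x x' y y' : A) : dg_cocycle 0 x -> dg_cocycle 0 y' ->
  dg_coboundary 0 (x - y) -> dg_coboundary 0 (x' - y') -> dg_coboundary 0 (x * x' - y * y').
Proof.
move=> zx zy' xy xy'.
have -> : x * x' - y * y' = x * (x' - y') + (x - y) * y'.
  by rewrite mulrBr mulrBl addrA subrK.
by apply: coboundaryD; [apply: coboundary_mulr | apply: coboundary_mull].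
Qed.

Lemma morph_cocycle A B (f : {lrmorphism A -> B}) x :
  dg_morphism f -> dg_cocycle 0 x -> dg_cocycle 0 (f x).
Proof.
move=> [_ fh fd] [hx dx]; split; first exact: fh.
by rewrite -fd dx (linear0 f).
Qed.

Lemma morph_coboundary A B (f : {lrmorphism A -> B}) x :
  dg_morphism f -> dg_coboundary 0 x -> dg_coboundary 0 (f x).
Proof. by move=> [_ fh fd] [u hu ->]; exists (f u); [apply: fh | rewrite fd]. Qed.

Lemma cohomL A a (x x' y y' : A) :
  dg_coboundary 0 (x - y) -> dg_coboundary 0 (x' - y') ->
  dg_coboundary 0 (a *: x + x' - (a *: y + y')).
Proof.
by move=> h h'; rewrite opprD addrACA -scalerBr; apply: coboundaryL.
Qed.

Lemma cocycle_idem A v : dg_cocycle 0 (dg_idem v : A).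
Proof. by split; [apply: dg_homog_idem | apply: dg_diff_idem]. Qed.

Lemma corr_id A : H0corr (fun x y : A => dg_cocycle 0 x /\ x = y).
Proof.
split=> [x y [zx <-]|a x x' y y' [zx <-] [zx' <-]|x x' y y' [zx <-] [zx' <-]|v|x zx|x zx|x y [_ <-]] //.
- by split=> //; apply: cocycleL.
- by split=> //; apply: cocycleM.
- by split=> //; apply: cocycle_idem.
- by exists x.
by exists x.
Qed.

Lemma corr_sym A B (rho : A -> B -> Prop) : H0corr rho -> H0corr (fun y x => rho x y).
Proof.
move=> hr; split.
- by move=> y x /(corr_cocycle hr) [].
- by move=> a y y' x x'; apply: (corr_lin hr).
- by move=> y y' x x'; apply: (corr_mul hr).
- exact: (corr_idem hr).
- exact: (corr_onto hr).
- exact: (corr_total hr).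
by move=> y x /(corr_cob hr) [].
Qed.

Lemma corr_comp A B C (rho : A -> B -> Prop) (sigma : B -> C -> Prop) :
  H0corr rho -> H0corr sigma -> H0corr (fun x z => exists2 y, rho x y & sigma y z).
Proof.
move=> hr hs; split.
- by move=> x z [y /(corr_cocycle hr) [zx _] /(corr_cocycle hs) [_ zz]].
- move=> a x x' z z' [y xy yz] [y' xy' yz']; exists (a *: y + y').
    exact: (corr_lin hr).
  exact: (corr_lin hs).
- move=> x x' z z' [y xy yz] [y' xy' yz']; exists (y * y'); first exact: (corr_mul hr).
  exact: (corr_mul hs).
- by move=> v; exists (dg_idem v); [apply: (corr_idem hr) | apply: (corr_idem hs)].
- move=> x /(corr_total hr) [y xy].
  have [z yz] := corr_total hs (corr_cocycle hr xy).2.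
  by exists z, y.
- move=> z /(corr_onto hs) [y yz].
  have [x xy] := corr_onto hr (corr_cocycle hs yz).1.
  by exists x, y.
by move=> x z [y /(corr_cob hr) -> /(corr_cob hs)].
Qed.

Lemma corr_quasi_iso A B (f : {lrmorphism A -> B}) : quasi_iso f ->
  H0corr (fun x y => [/\ dg_cocycle 0 x, dg_cocycle 0 y & dg_coboundary 0 (y - f x)]).
Proof.
move=> [fm f_inj f_surj]; have [f_e _ _] := fm; split.
- by move=> x y [].
- move=> a x x' y y' [zx zy xy] [zx' zy' xy']; split; try exact: cocycleL.
  by rewrite (linearP f); apply: cohomL.
- move=> x x' y y' [zx zy xy] [zx' zy' xy']; split; try exact: cocycleM.
  by rewrite rmorphM; apply: cohomM => //; apply: morph_cocycle.
- move=> v; split; try exact: cocycle_idem.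
  by rewrite f_e subrr; apply: coboundary0.
- move=> x zx; exists (f x); split=> //; first exact: morph_cocycle.
  by rewrite subrr; apply: coboundary0.
- by move=> y zy; have [x zx xy] := f_surj _ _ zy; exists x.
move=> x y [zx zy xy]; split=> [bx|by_].
  by rewrite -[y](subrK (f x)); apply: coboundaryD => //; apply: morph_coboundary.
apply: f_inj => //; rewrite -[f x](subKr y).
by apply: coboundaryD => //; apply: coboundaryN.
Qed.

Lemma quasi_isomorphic_corr A B : quasi_isomorphic A B ->
  exists rho : A -> B -> Prop, H0corr rho.
Proof.
elim=> {B} [|B C f _ [rho hr] /corr_quasi_iso hf|B C f _ [rho hr] /corr_quasi_iso/corr_sym hf].
- by exists (fun x y => dg_cocycle 0 x /\ x = y); apply: corr_id.
- by eexists; apply: corr_comp hr hf.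
by eexists; apply: corr_comp hr hf.
Qed.

End Correspondence.

Section FromCorrespondence.
Variables (K : fieldType) (V : finType) (adj : rel V) (r : V) (lt : V -> rel V).
Hypothesis adj_rooted : rooted adj r.
Hypothesis adj_sym : symmetric adj.
Hypothesis lt_order : child_order adj r lt.
Local Notation away := (away adj r).
Local Notation G := (ginz_quiver adj r).
Local Notation L := (lca_quiver adj r).
Local Notation gz := (gz_c K adj r).
Local Notation lc := (lca_c adj r K).
Local Notation D := (qfree_diff (ginz_delta K)).

Lemma adj_irr v : adj v v = false.
Proof.
apply/negP => vv; have [orient _ _ _] := adj_rooted.
by have := orient _ _ vv; rewrite addbb.
Qed.

Lemma gz_arrow (a : arrow G) : adeg a = 0 -> pgen K a = gz (atgt a) (asrc a).
Proof.
case: a => [[g|g]|v] // _.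
  by rewrite -[pgen _ _]/(ginz_g K g) -(gz_c_g K g).
by rewrite -[pgen _ _]/(ginz_g' K g) -(gz_c_g' K adj_rooted g).
Qed.

Lemma idem_gz w v x y :
  pidem K G w * gz x y * pidem K G v = if (w == x) && (y == v) then gz w v else 0.
Proof.
rewrite -(gz_c_l K adj_rooted x) -(gz_c_r K adj_rooted x y) !mulrA pidemM.
have [<-|_] := eqVneq w x; last by rewrite !mul0r.
rewrite -mulrA pidemM; have [<-|_] := eqVneq y v; last by rewrite mulr0.
by rewrite gz_c_l // gz_c_r.
Qed.

(** The only path of length at most 1 and degree 0 between two distinct vertices
is the arrow, if there is one. *)
Lemma gz_lead w v x : w != v -> pahomog 0 x ->
  exists k, deep 2 (pidem K G w * x * pidem K G v - k *: gz w v).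
Proof.
move=> wv hx; apply: (homog_ind (S := fun x => exists k,
    deep 2 (pidem K G w * x * pidem K G v - k *: gz w v)) hx).
- by exists 0; rewrite scale0r mulr0 mul0r subrr; apply: deep0.
- move: (gz w v) => g c y z [k hk] [l hl]; exists (c * k + l).
  have -> : (c * k + l) *: g = c *: (k *: g) + l *: g by rewrite scalerDl scalerA.
  move: (k *: g) (l *: g) hk hl => g1 g2 hk hl.
  rewrite mulrDr mulrDl -scalerAr -scalerAl.
  by rewrite opprD addrACA -scalerBr; apply: deepL.
move=> u [|a [|b s]] us s0; last first.
- by exists 0; rewrite scale0r subr0; apply/deepMr/deepMl/deep_word.
- have a0 : adeg a = 0 by rewrite -s0 big_seq1.
  have -> : wbase K u [:: a] = pgen K a by move: us => /= /andP[/eqP <-].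
  rewrite gz_arrow // idem_gz; case: ifP => _.
    by exists 1; rewrite scale1r subrr; apply: deep0.
  by exists 0; rewrite scale0r subrr; apply: deep0.
exists 0; rewrite scale0r subr0 -[wbase K u [::]]/(pidem K G u) -mulrA !pidemM.
case: (u =P v) => [->|_]; last by rewrite mulr0; apply: deep0.
by rewrite pidemM (negPf wv); apply: deep0.
Qed.

Lemma gz_not_deep w v : adj w v -> ~ deep 2 (gz w v).
Proof.
move=> wv; have wE (a : arrow G) : ~ deep 2 (pgen K a).
  move/deepP => /(_ (@QPath _ G (asrc a, [:: a]) _)) h; move: h.
  rewrite /pgen wbaseE /= ?eqxx // => vs h.
  have := h vs; rewrite /pbase /= mcoeffUU oner_neq0 => /(_ isT).
  by [].
by case: gz_cP => // [g _|g _|/negP]; [apply: wE | apply: wE | ].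
Qed.

Lemma coboundary_deep x : dg_coboundary 0 (x : Ginzburg adj r K) -> deep 2 x.
Proof.
move=> [y hy ->]; apply: diff_deepS; first by move=> a; apply: ginz_delta_deep.
apply: (homog_ind (S := deep 1) hy); [exact: deep0 | by move=> *; apply: deepL |].
by move=> v [|a s] vs; [rewrite big_nil | move=> _; apply: deep_word].
Qed.

Variable rho : LCA adj r K lt -> Ginzburg adj r K -> Prop.
Hypothesis rho_corr : H0corr rho.

Lemma rho0 : rho 0 0.
Proof.
have h := corr_idem rho_corr r.
by have := corr_lin rho_corr (-1) h h; rewrite !scaleN1r !addNr.
Qed.

Lemma rhoD x x' y y' : rho x y -> rho x' y' -> rho (x + x') (y + y').
Proof. by move=> h h'; have := corr_lin rho_corr 1 h h'; rewrite !scale1r. Qed.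

Lemma rhoN x y : rho x y -> rho (- x) (- y).
Proof. by move=> h; have := corr_lin rho_corr (-1) h rho0; rewrite !scaleN1r !addr0. Qed.

Lemma rho_sum (P : pred V) F F' : (forall u, P u -> rho (F u) (F' u)) ->
  rho (\sum_(u | P u) F u) (\sum_(u | P u) F' u).
Proof. by move=> h; apply: (big_ind2 rho) => //; [exact: rho0 | move=> x1 x2 y1 y2 h1 h2; exact: rhoD]. Qed.

Lemma corr_arrows : exists (X : V -> V -> pathalg K G) (k : V -> V -> K),
  [/\ forall w v, rho (lc w v) (X w v),
      forall w v, pidem K G w * X w v = X w v /\ X w v * pidem K G v = X w v,
      forall w v, pahomog 0 (X w v)
    & forall w v, deep 2 (X w v - k w v *: gz w v)].
Proof.
have ex (p : V * V) : exists xk : pathalg K G * K,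
    [/\ rho (lc p.1 p.2) xk.1, pidem K G p.1 * xk.1 = xk.1 /\ xk.1 * pidem K G p.2 = xk.1,
     pahomog 0 xk.1 & deep 2 (xk.1 - xk.2 *: gz p.1 p.2)].
  case: p => w v /=; have [->|wv] := eqVneq w v.
    exists (0, 0) => /=; rewrite mulr0 mul0r scale0r subrr lca_c0 ?adj_irr //.
    by split=> //; [apply: rho0 | apply: pahomog0 | apply: deep0].
  have zc : dg_cocycle 0 (lc w v : LCA adj r K lt).
    by split; [apply: lca_c_homog | apply: lca_c_closed].
  have [x rx] := corr_total rho_corr zc.
  have [_ [hx _]] := corr_cocycle rho_corr rx.
  have [k hk] := gz_lead wv hx.
  exists (pidem K G w * x * pidem K G v, k); split=> //=.
  - rewrite -(lca_c_l adj r K w v) -(lca_c_r adj r K w v) mulrA.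
    by do ![apply: (corr_mul rho_corr)] => //; apply: (corr_idem rho_corr).
  - by rewrite !mulrA pidemM eqxx -!mulrA pidemM eqxx.
  by rewrite -[0]/(0 + 0 + 0 : int); apply/pahomogM/pahomog_pidem/pahomogM/hx/pahomog_pidem.
have {ex} [f hf] := fin_all_exists ex.
exists (fun w v => (f (w, v)).1), (fun w v => (f (w, v)).2).
by split=> w v; have [] := hf (w, v).
Qed.

(** If k w v vanished, then no element in the image of the correspondence would
involve the arrow from v to w, because the images of longer paths consist of
paths of length at least 2.  But the correspondence is onto. *)
Lemma corr_deform : exists (X : V -> V -> pathalg K G) (k : V -> V -> K),
  [/\ forall w v, pidem K G w * X w v = X w v /\ X w v * pidem K G v = X w v,
      forall w v, pahomog 0 (X w v),
      forall w v, deep 2 (X w v - k w v *: gz w v),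
      forall w v, adj w v -> k w v != 0
    & forall v, exists2 y, pahomog (-1) y &
        bigcirc true [seq X v w * X w v | w <- children adj r lt v] -
        \sum_(u | away u v) X v u * X u v = D y].
Proof.
have [X [k [rX Xlr hX dX]]] := corr_arrows.
exists X, k; split=> // [w v wv|v]; last first.
  have cob : dg_coboundary 0 (lca_delta K lt (inl v : arrow L) : LCA adj r K lt).
    exists (pgen K (inl v : arrow L)); first exact: pahomog_pgen.
    by rewrite -[RHS]/(qfree_diff _ _) qfree_diff_pgen //; apply: lca_delta_bimod.
  apply: (corr_cob rho_corr _).1 cob; rewrite lca_deltaE //.
  have rXX x y z t : rho (lc x y * lc z t) (X x y * X z t) by apply: (corr_mul rho_corr).
  apply: rhoD; last by apply/rhoN/rho_sum.
  elim: (children _ _ _ _) => [|w s IHs] /=; first exact: rho0.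
  rewrite /circ !mulr1n; do ![apply: rhoD] => //.
  exact: (corr_mul rho_corr).
apply/negP => /eqP k0; have XL1 x y : deep 1 (X x y).
  have := dX x y; rewrite -{2}[X x y](subrK (k x y *: gz x y)) => h.
  by apply: deepD; [apply: deep_mono h _ | apply/deepZ/gz_c_deep].
have Xwv : deep 2 (X w v) by have := dX w v; rewrite k0 scale0r subr0.
have wnv : w != v by apply: contraTneq wv => ->; rewrite adj_irr.
have words u (s : seq (arrow L)) : is_word u s -> (forall a, a \in s -> adeg a = 0) ->
    exists2 y, rho (wbase K u s) y & deep (size s) y.
  elim: s => [|a s IHs] us s0.
    by exists (pidem K G u); [apply: (corr_idem rho_corr) | apply: deep_any].
  have /andP[_ us'] := us; have [|y ry dy] := IHs us'.
    by move=> b bs; apply: s0; rewrite inE bs orbT.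
  have := s0 a (mem_head _ _); case: a {s0} us => [//|p] us _.
  exists (X (val p).1 (val p).2 * y); last exact: (@deepM _ _ _ 1).
  by rewrite (wbase_cons K us) -lca_c_adj; apply: (corr_mul rho_corr).
have all_deep x : pahomog 0 x ->
    exists2 y, rho x y & deep 2 (pidem K G w * y * pidem K G v).
  move=> hx; apply: (homog_ind (S := fun x =>
     exists2 y, rho x y & deep 2 (pidem K G w * y * pidem K G v)) hx).
  - by exists 0; [apply: rho0 | rewrite mulr0 mul0r; apply: deep0].
  - move=> c y z [y' ry hy] [z' rz hz]; exists (c *: y' + z'); first exact: (corr_lin rho_corr).
    by rewrite mulrDr mulrDl -scalerAr -scalerAl; apply: deepL.
  move=> u s us s0; have {}s0 := word_deg0 (@lca_deg_cases _ adj r) s0.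
  case: s us s0 => [|a [|b s]] us s0.
  - exists (pidem K G u); first exact: (corr_idem rho_corr).
    rewrite -mulrA !pidemM; case: (u =P v) => [->|_]; last by rewrite mulr0; apply: deep0.
    by rewrite pidemM (negPf wnv); apply: deep0.
  - have := s0 a (mem_head _ _); case: a {s0} us => [//|p] us _.
    have -> : wbase K u [:: inr p : arrow L] = pgen K (inr p : arrow L).
      by move: us => /= /andP[/eqP <-].
    rewrite -lca_c_adj; exists (X (val p).1 (val p).2) => //.
    case: (val p) => w' v' /=; have [|] := boolP ((w == w') && (v' == v)).
      by case/andP=> [/eqP <- /eqP ->]; apply/deepMr/deepMl.
    rewrite -(Xlr _ _).1 -(Xlr _ _).2 !mulrA pidemM.
    have [<-|_ _] := eqVneq w w'; last by rewrite !mul0r; apply: deep0.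
    rewrite -!mulrA pidemM => /negPf /= ->.
    by rewrite !mulr0; apply: deep0.
  have [y ry dy] := words _ _ us s0; exists y => //.
  by apply/deepMr/deepMl/(deep_mono dy).
have zc : dg_cocycle 0 (gz w v : Ginzburg adj r K).
  split; first exact: gz_c_homog.
  apply: (diff_homog0 (@ginz_delta_deg _ adj r K) (@ginz_deg _ adj r)); exact: gz_c_homog.
have [x rx] := corr_onto rho_corr zc; have [[hx _] _] := corr_cocycle rho_corr rx.
have [y ry dy] := all_deep x hx.
have r0 := rhoD rx (rhoN ry); rewrite subrr in r0.
have cob0 : dg_coboundary 0 (0 : LCA adj r K lt) by apply: coboundary0.
have d2 := coboundary_deep ((corr_cob rho_corr r0).1 cob0).
apply: (gz_not_deep wv).
have -> : gz w v = pidem K G w * (gz w v - y) * pidem K G v + pidem K G w * y * pidem K G v.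
  by rewrite mulrBr mulrBl gz_c_l // gz_c_r // subrK.
by apply: deepD => //; apply/deepMr/deepMl.
Qed.

End FromCorrespondence.

(** * The trace in characteristic two *)

Section Trace.
Variables (K : fieldType) (V : finType) (Q : gquiver V) (t : V).
Local Notation A := (pathalg K Q).

Definition star (a : arrow Q) : bool :=
  (adeg a == 0) && ((asrc a == t) || (atgt a == t)).
Definition leaf (a : arrow Q) : V := if asrc a == t then atgt a else asrc a.

(** All conditions are invariant under rotation of the closed path s. *)
Definition circuit (v : V) (s : seq (arrow Q)) : bool :=
  [&& word_tgt v s == v, size s == 4, all star s & (1 < size (undup (map leaf s)))%N].

(** For K of characteristic 2 and t of valence three, this is the trace form of
the preprojective algebra of type D_4 spanned by t and its neighbours,
concentrated on paths of length 4. *)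
Definition tr : A -> K^o :=
  lext (fun p => (circuit (psrc p) (pword p))%:R : K^o).
HB.instance Definition _ := GRing.Linear.on tr.

Lemma tr0 : tr 0 = 0.
Proof. exact: linear0. Qed.

Lemma trL c x y : tr (c *: x + y) = c * tr x + tr y.
Proof. exact: linearP. Qed.

Lemma tr_word v s : is_word v s -> tr (wbase K v s) = (circuit v s)%:R.
Proof. by move=> vs; rewrite (wbaseE K vs) /tr lextU. Qed.

Lemma tr_deep x : deep 5 x -> tr x = 0.
Proof.
move=> hx; apply: (deep_ind (S := fun x => tr x = 0) hx); first exact: linear0.
  by move=> c y z hy hz; rewrite linearP /= hy hz scaler0 addr0.
move=> v s vs s5; rewrite tr_word // /circuit.
by case: eqP => //= _; case: eqP => // s4; move: s5; rewrite s4.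
Qed.

Lemma tr_mulC x y : tr (x * y) = tr (y * x).
Proof.
elim/pathalg_ind: x => [|c x z hx hz|v s vs]; first by rewrite mul0r mulr0.
  by rewrite mulrDl mulrDr -scalerAl -scalerAr !linearP /= hx hz.
elim/pathalg_ind: y => [|c x z hx hz|w u wu]; first by rewrite mul0r mulr0.
  by rewrite mulrDl mulrDr -scalerAl -scalerAr !linearP /= hx hz.
rewrite !wbaseM //; case: (v =P word_tgt w u) => [vE|vN]; case: (w =P word_tgt v s) => [wE|wN].
- rewrite !tr_word ?is_word_cat -?vE -?wE //; congr (_%:R).
  rewrite /circuit !word_tgt_cat -vE -wE -vE !eqxx !size_cat addnC !all_cat.
  rewrite (andbC (all _ s)) !map_cat.
  have -> // : size (undup (map leaf s ++ map leaf u)) = size (undup (map leaf u ++ map leaf s)).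
  by apply/perm_size/perm_undup/perm_mem; rewrite perm_catC.
- rewrite /= tr0 tr_word ?is_word_cat -?vE // /circuit word_tgt_cat -vE.
  by case: eqP => // /esym /wN.
- rewrite /= tr0 tr_word ?is_word_cat -?wE // /circuit word_tgt_cat -wE.
  by case: eqP => // /esym /vN.
by rewrite !tr0.
Qed.

Variable delta : arrow Q -> A.
Hypotheses (deltaE : delta_bimod delta) (delta_hom : delta_deg delta).
Hypothesis Qdeg : forall a : arrow Q, adeg a = 0 \/ adeg a = -1.
Hypothesis tr_delta : forall a y, adeg a = -1 -> tr (delta a * y) = 0.

(** A coboundary is a combination of terms x * delta a * y, and the trace allows
to rotate delta a to the front. *)
Lemma tr_diff z w : pahomog (-1) w -> tr (z * qfree_diff delta w) = 0.
Proof.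
move=> hw; apply: (homog_ind (S := fun w => tr (z * qfree_diff delta w) = 0) hw).
- by rewrite linear0 mulr0 linear0.
- move=> c x y hx hy; rewrite linearP mulrDr -scalerAr linearP /=.
  by rewrite hx hy scaler0 addr0.
move=> v s; elim: s z => [|a s IHs] z vs; first by rewrite big_nil.
have /andP[_ vs'] := vs; rewrite big_cons (wbase_cons K vs).
case: (Qdeg a) => a0; rewrite a0.
  rewrite add0r => s1; rewrite (diff_mul0 deltaE delta_hom Qdeg); last first.
    by rewrite -a0; apply: pahomog_pgen.
  by rewrite mulrA IHs.
move=> h; have s0 : \sum_(b <- s) adeg b = 0 by apply: (addrI (-1)); rewrite h addr0.
rewrite (diff_mul1 deltaE); last by rewrite -a0; apply: pahomog_pgen.
rewrite (diff_homog0 delta_hom Qdeg (x := wbase K v s)); last first.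
  by rewrite -s0; apply: pahomog_wbase.
by rewrite mulr0 subr0 qfree_diff_pgen // tr_mulC -mulrA tr_delta.
Qed.

End Trace.

Section GinzburgTrace.
Variables (K : fieldType) (V : finType) (adj : rel V) (r : V) (t : V).
Hypothesis adj_rooted : rooted adj r.
Hypothesis adj_sym : symmetric adj.
Hypothesis char2 : 2%N \in [pchar K].
Local Notation away := (away adj r).
Local Notation G := (ginz_quiver adj r).
Local Notation gz := (gz_c K adj r).
Local Notation D := (qfree_diff (ginz_delta K)).
Local Notation tr := (@tr K V G t).

Lemma gz_pgen w v : adj w v ->
  exists a : arrow G, [/\ gz w v = pgen K a, asrc a = v, atgt a = w & adeg a = 0].
Proof.
move=> wv; case: gz_cP => // [g gE|g gE|/negP//].
  by exists (inl (inl g)); split=> //=; rewrite gE.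
by exists (inl (inr g)); split=> //=; rewrite gE.
Qed.

Lemma arrow_adj (a : arrow G) : adeg a = 0 -> adj (atgt a) (asrc a).
Proof.
case: a => [[g|g]|v] // _; first by rewrite adj_sym; apply: (away_adj (valP g)).
exact: (away_adj (valP g)).
Qed.

Lemma tr_loop_word v u w (s : seq (arrow G)) : adj v u -> is_word w s ->
  tr (gz v u * gz u v * wbase K w s) =
  ([&& w == v, word_tgt w s == v, size s == 2, all (star t) s, (v == t) || (u == t)
    & let l := if v == t then u else v in
      (1 < size (undup [:: l, l & map (leaf t) s]))%N])%:R.
Proof.
move=> vu ws; have [a [-> sa ta da]] := gz_pgen vu.
have [|b [-> sb tb db]] := @gz_pgen u v; first by rewrite adj_sym.
rewrite -mulrA pgen_word // sb eq_sym; have [tE|_] := eqVneq (word_tgt w s) v; last first.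
  by rewrite mulr0 tr0 andbF.
have wbs : is_word w (b :: s) by apply/andP; split=> //; rewrite sb tE.
have wabs : is_word w (a :: b :: s) by apply/andP; split=> //; rewrite sa -[word_tgt _ _]/(atgt b) tb.
rewrite pgen_word // sa -[word_tgt _ _]/(atgt b) tb eqxx tr_word //.
have stA : star t a = (v == t) || (u == t) by rewrite /star da sa ta eqxx orbC.
have stB : star t b = (v == t) || (u == t) by rewrite /star db sb tb eqxx.
congr (_%:R); rewrite /circuit -[word_tgt _ _]/(atgt a) ta (eq_sym v w) /= !eqSS stA stB.
have [vut|] := boolP ((v == t) || (u == t)); last by rewrite !andbF.
have [-> ->] : leaf t a = (if v == t then u else v) /\ leaf t b = (if v == t then u else v).
  rewrite /leaf sa sb ta tb; case: (eqVneq v t) vut => [->|_]; last by move=> /eqP ->; rewrite eqxx.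
  by case: eqP => [->|].
by [].
Qed.

Lemma delta_char2 v (F : V -> K) :
  \sum_(w | away v w) F w - \sum_(u | away u v) F u = \sum_(u | adj v u) F u.
Proof.
rewrite oppr_pchar2 // (bigID (away v) (adj v)) /=.
have [orient _ _ _] := adj_rooted; congr (_ + _); apply: eq_bigl => u.
  by rewrite andb_idl // => /away_adj.
apply/idP/andP => [uv|[vu]]; last by move: (orient _ _ vu); case: (away v u).
by rewrite adj_sym (away_adj uv) (away_antisym adj_rooted uv).
Qed.

Hypothesis deg3 : #|[pred u | adj t u]| = 3%N.

(** There are two such neighbours, and 2 = 0. *)
Lemma sum_others l : adj t l -> \sum_(u | adj t u) (u != l)%:R = 0 :> K.
Proof.
move=> tl; rewrite -natr_sum -big_mkcondr /= sum1_card.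
have -> : #|[pred u | adj t u & u != l]| = 2%N; last by rewrite pcharf0.
have := cardD1 l [pred u | adj t u]; rewrite deg3 inE tl add1n => -[E].
by rewrite [RHS]E; apply: eq_card => u; rewrite !inE andbC.
Qed.

(** At t, a closed path through the neighbour l is completed to a circuit by the
closed paths through each of the two other neighbours, and 1 + 1 = 0.  At a
neighbour v of t, the completed path visits no other neighbour of t, or leaves
the star of t. *)
Lemma tr_ginz_delta (a : arrow G) y : adeg a = -1 -> tr (ginz_delta K a * y) = 0.
Proof.
case: a => [//|v] _; elim/pathalg_ind: y => [|c x y hx hy|w s ws].
- by rewrite mulr0 tr0.
- by rewrite mulrDr -scalerAr trL hx hy mulr0 addr0.
rewrite gz_delta // mulrBl !mulr_suml linearB /= !(linear_sum tr) /=.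
pose F u := tr (gz v u * gz u v * wbase K w s).
transitivity (\sum_(u | adj v u) F u); first exact: (delta_char2 v F).
rewrite /F {F}.
under eq_bigr => u vu do rewrite tr_loop_word //.
have [wv|_] := eqVneq w v; last by rewrite big1.
have [tv|_] := eqVneq (word_tgt w s) v; last by rewrite big1.
have [s2|_] := eqVneq (size s) 2%N; last by rewrite big1.
have [sS|_] := boolP (all (star t) s); last by rewrite big1.
case: s ws tv s2 sS => [|b [|a []]] // /and3P[/eqP ab aw _] tv _ /and3P[sb sa _].
have ba : asrc b = atgt a by exact: ab.
have bv : atgt b = v by exact: tv.
have sav : asrc a = v by rewrite -wv; apply/eqP.
have da : adeg a = 0 by case/andP: sa => /eqP.
have [vt|vt] := eqVneq v t.
  have la : leaf t a = atgt a by rewrite /leaf sav vt eqxx.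
  have lb : leaf t b = atgt a.
    by rewrite /leaf ba; case: eqP => // E; rewrite E bv vt.
  have tl : adj t (atgt a).
    by rewrite adj_sym -vt -sav; apply: arrow_adj.
  rewrite vt -[RHS](sum_others tl); apply: eq_bigr => u _; rewrite /= la lb.
  by rewrite !inE !eqxx orbb /=; case: (_ == _).
rewrite big1 // => u vu; have [ut|] := eqVneq u t => //=.
have ta : atgt a = t by case/andP: sa => _; rewrite sav (negPf vt) => /eqP.
by rewrite /leaf sav (negPf vt) ba ta eqxx bv !inE !eqxx.
Qed.

Lemma tr_far u z : u != t -> ~~ adj u t -> tr (pidem K G u * z) = 0.
Proof.
move=> ut uNt; elim/pathalg_ind: z => [|c x y hx hy|w s ws].
- by rewrite mulr0 tr0.
- by rewrite mulrDr -scalerAr trL hx hy mulr0 addr0.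
rewrite pidem_word //; case: eqP => [uE|_]; last exact: tr0.
rewrite tr_word // /circuit; case: s ws uE => [|a s] ws uE; first by rewrite andbF.
suff /negPf sa : ~~ star t a by rewrite /= sa !andbF.
apply/negP => /andP[/eqP a0 /orP[]/eqP aE].
  by have := arrow_adj a0; rewrite -[atgt a]uE aE (negPf uNt).
by move: ut; rewrite uE -[word_tgt _ _]/(atgt a) aE eqxx.
Qed.

End GinzburgTrace.

(** * The obstruction in characteristic two *)

Section Obstruction.
Variables (K : fieldType) (V : finType) (adj : rel V) (r : V) (lt : V -> rel V) (t : V).
Hypothesis adj_rooted : rooted adj r.
Hypothesis adj_sym : symmetric adj.
Hypothesis char2 : 2%N \in [pchar K].
Hypothesis deg3 : #|[pred u | adj t u]| = 3%N.
Hypothesis adj_tri : forall w u, adj t w -> adj w u -> ~~ adj u t.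
Local Notation away := (away adj r).
Local Notation G := (ginz_quiver adj r).
Local Notation gz := (gz_c K adj r).
Local Notation D := (qfree_diff (ginz_delta K)).
Local Notation tr := (@tr K V G t).

Variables (X : V -> V -> pathalg K G) (k : V -> V -> K).
Hypothesis X_e : forall w v, pidem K G w * X w v = X w v /\ X w v * pidem K G v = X w v.
Hypothesis dX : forall w v, deep 2 (X w v - k w v *: gz w v).
Hypothesis k_neq0 : forall w v, adj w v -> k w v != 0.
Hypothesis X_rel : forall v, exists2 y, pahomog (-1) y &
  bigcirc true [seq X v w * X w v | w <- children adj r lt v] -
    \sum_(u | away u v) X v u * X u v = D y.

Lemma trD x y : tr (x + y) = tr x + tr y.
Proof. exact: linearD. Qed.

Lemma trB x y : tr (x - y) = tr x - tr y.
Proof. exact: linearB. Qed.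

Lemma tr_sum (I : Type) (s : seq I) (P : pred I) F :
  tr (\sum_(i <- s | P i) F i) = \sum_(i <- s | P i) (tr (F i) : K).
Proof. exact: linear_sum. Qed.

Lemma tr_cob z y : pahomog (-1) y -> tr (z * D y) = 0.
Proof.
apply: (tr_diff (@ginz_delta_bimod _ adj r K) (@ginz_delta_deg _ adj r K) (@ginz_deg _ adj r)).
by move=> a x a1; apply: tr_ginz_delta.
Qed.

Lemma tr_farX w u z : u != t -> ~~ adj u t -> tr (X w u * z) = 0.
Proof.
by move=> ut uNt; rewrite -(X_e w u).2 -mulrA tr_mulC -mulrA tr_far.
Qed.

Lemma tr_far_circ w s z : t \notin s -> (forall u, u \in s -> ~~ adj u t) ->
  tr (z * bigcirc true [seq X w u * X u w | u <- s]) = 0.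
Proof.
elim: s => [|u s IHs] in z *; first by rewrite mulr0 tr0.
rewrite inE negb_or eq_sym => /andP[ut ts] far /=.
have uNt := far u (mem_head _ _).
rewrite /circ mulr1n !mulrDr !trD IHs //; last first.
  by move=> v vs; apply: far; rewrite inE vs orbT.
by do ![rewrite tr_mulC -!mulrA tr_farX // ?add0r].
Qed.

Lemma tr_nbr_circ w s : uniq s -> (forall u, u \in s -> u != t -> ~~ adj u t) ->
  tr (bigcirc true [seq X w u * X u w | u <- s]) =
  if t \in s then tr (X w t * X t w) else 0.
Proof.
elim: s => [|u s IHs] /=; first by rewrite tr0.
move=> /andP[us s_uniq] far; have {}IHs := IHs s_uniq.
rewrite /circ mulr1n !trD inE; have [tu|tu] := eqVneq t u.
  have ts : t \notin s by rewrite tu.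
  have fars v : v \in s -> ~~ adj v t.
    move=> vs; apply: far; first by rewrite inE vs orbT.
    by apply: contraNneq ts => <-.
  have -> := tr_far_circ w (X w u * X u w) ts fars.
  by have := tr_far_circ w 1 ts fars; rewrite mul1r => ->; rewrite !addr0 tu.
rewrite eq_sym in tu; have uNt := far u (mem_head _ _) tu.
rewrite -!mulrA !(tr_farX w _ tu uNt) addr0 [LHS]add0r IHs // => v vs; apply: far.
by rewrite inE vs orbT.
Qed.

(** The relation at w expresses the closed path at w through t, up to sign, by a
coboundary and products that pass through vertices far from t; the trace of all
of these vanishes. *)
Lemma tr_nbr_loop w : adj t w -> tr (X t w * X w t) = 0.
Proof.
move=> tw; have wt : adj w t by rewrite adj_sym.
have [orient _ _ _] := adj_rooted.
rewrite tr_mulC; have [y hy yE] := X_rel w.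
have := tr_cob 1 hy; rewrite -yE mul1r trB tr_nbr_circ; first last.
- by move=> u; rewrite mem_children => /away_adj wu _; apply: adj_tri wu.
- exact: uniq_children.
rewrite mem_children tr_sum.
have far u : away u w -> u != t -> tr (X w u * X u w) = 0.
  move=> /away_adj uw ut; apply: tr_farX => //; apply: (adj_tri tw).
  by rewrite adj_sym.
have := orient _ _ wt; have [wt'|wt'] := boolP (away w t) => /= tw'.
  rewrite big1 ?subr0 // => u uw; apply: far => //.
  by apply: contraNneq tw' => <-.
rewrite (bigD1 t) //= big1 => [|u /andP[uw ut]]; last exact: far.
by rewrite addr0 sub0r => /eqP; rewrite oppr_eq0 => /eqP.
Qed.

Local Notation L := (fun w => X t w * X w t).
Local Notation N := (fun w => gz t w * gz w t).
Local Notation p := (fun w => k t w * k w t).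

Lemma N_deep w : deep 2 (N w).
Proof. by apply: (@deepM _ _ _ 1 1); apply: gz_c_deep. Qed.

Lemma X_deep v w : deep 1 (X v w).
Proof.
have := @dX v w; rewrite -{2}[X v w](subrK (k v w *: gz v w)) => h.
by apply: deepD; [apply: deep_mono h _ | apply/deepZ/gz_c_deep].
Qed.

Lemma L_deep w : deep 2 (L w).
Proof. by apply: (@deepM _ _ _ 1 1); apply: X_deep. Qed.

Lemma L_lead w : deep 3 (L w - p w *: N w).
Proof.
have -> : L w - p w *: N w = X t w * (X w t - k w t *: gz w t) +
   (X t w - k t w *: gz t w) * (k w t *: gz w t).
  rewrite mulrBr mulrBl addrA subrK -!scalerAl -!scalerAr scalerA.
  by [].
apply: deepD; first by apply: (@deepM _ _ _ 1 2) => //; apply: X_deep.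
by apply: (@deepM _ _ _ 2 1) => //; apply/deepZ/gz_c_deep.
Qed.

Lemma tr_lead x y a b x' y' : deep 2 y -> deep 2 x' ->
  deep 3 (x - a *: x') -> deep 3 (y - b *: y') -> tr (x * y) = a * b * tr (x' * y').
Proof.
move=> dy dx' hx hy.
have -> : x * y = (a * b) *: (x' * y') + ((x - a *: x') * y + (a *: x') * (y - b *: y')).
  have <- : (a *: x') * (b *: y') = (a * b) *: (x' * y').
    by rewrite -scalerAr -scalerAl scalerA mulrC.
  move: (a *: x') (b *: y') => u w.
  by rewrite mulrBl mulrBr subrKA addrC subrK.
rewrite trL [X in _ + X](@tr_deep _ _ _ t) ?addr0 //.
apply: deepD; first exact: (@deepM _ _ _ 3 2).
by apply: (@deepM _ _ _ 2 3) => //; apply: deepZ.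
Qed.

Lemma tr_NN w u : adj t w -> adj t u -> tr (N w * N u) = (w != u)%:R.
Proof.
move=> tw tu; have [a [aE sa ta da]] := gz_pgen K adj_rooted tu.
have [|b [bE sb tb db]] := @gz_pgen K _ _ _ adj_rooted u t; first by rewrite adj_sym.
have ab : is_word t [:: a; b].
  by apply/and3P; split=> //; rewrite ?sa ?sb // -[word_tgt _ _]/(atgt b) tb.
have -> : gz t u * gz u t = wbase K t [:: a; b].
  by rewrite (wbase_cons K ab) -aE bE /pgen sb.
rewrite tr_loop_word //; congr (_%:R); rewrite -[word_tgt _ _]/(atgt a) ta /= !eqxx /=.
have -> : star t a by rewrite /star da ta !eqxx orbT.
have -> : star t b by rewrite /star db sb !eqxx.
have -> : leaf t a = u by rewrite /leaf sa ta; case: eqP.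
have -> : leaf t b = u by rewrite /leaf sb eqxx.
by rewrite !inE !eqxx orbb /=; case: (_ == _).
Qed.

Lemma tr_LL w u : adj t w -> adj t u -> tr (L w * L u) = p w * p u * (w != u)%:R.
Proof.
move=> tw tu; rewrite -tr_NN //; apply: tr_lead; [exact: L_deep | exact: N_deep | |]; exact: L_lead.
Qed.

Lemma tr_LN w j : adj t w -> adj t j -> tr (L w * N j) = p w * (w != j)%:R.
Proof.
move=> tw tj; rewrite -tr_NN // -[p w]mulr1; apply: tr_lead; [exact: N_deep..| |].
  exact: L_lead.
by rewrite scale1r subrr; apply: deep0.
Qed.

Lemma circ_lead s : deep 4 (bigcirc true [seq L w | w <- s] - \sum_(w <- s) L w).
Proof.
elim: s => [|w s IHs] /=; first by rewrite big_nil subrr; apply: deep0.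
rewrite big_cons /circ mulr1n.
move: IHs; set B := bigcirc _ _; set S := \sum_(w <- s) _ => IHs.
have lw := @L_deep w; rewrite /= in lw *; move: (X t w * X w t) lw => l lw.
rewrite opprD addrACA (addrC l) addrK addrA addrAC.
apply: deepD => //; apply: (@deepM _ _ _ 2 2) => //.
by apply: (bigcirc_deep (F := L)) => u; apply: L_deep.
Qed.

Lemma tr_circ_mul x s : deep 2 x ->
  tr (bigcirc true [seq L w | w <- s] * x) = \sum_(w <- s) (tr (L w * x) : K).
Proof.
move=> dx; rewrite -[bigcirc _ _](subrK (\sum_(w <- s) L w)) mulrDl trD tr_deep.
  by rewrite [LHS]add0r mulr_suml tr_sum.
by apply: deep_mono (@deepM _ _ _ 4 2 _ _ (@circ_lead s) dx) _.
Qed.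

(** The trace of the relation at t times N j only sees the quadratic leading
terms, and equals the sum of the p w over the neighbours w other than j. *)
Lemma sum_p j : adj t j -> \sum_(w | adj t w) p w = p j.
Proof.
move=> tj; have [y hy yE] := X_rel t.
have := tr_cob (N j) hy; rewrite tr_mulC -yE mulrBl trB tr_circ_mul; last exact: N_deep.
rewrite mulr_suml tr_sum.
have -> : \sum_(w <- children adj r lt t) (tr (L w * N j) : K) = \sum_(w | away t w) (tr (L w * N j) : K).
  rewrite (perm_big [seq w <- enum V | away t w]); last by rewrite perm_sort.
  by rewrite big_filter big_enum_cond.
rewrite [LHS](delta_char2 adj_rooted adj_sym char2 t (fun w => tr (L w * N j) : K)).
rewrite (bigD1 j) //= tr_LN // eqxx mulr0 [LHS]add0r => E.
rewrite (bigD1 j) //= -[RHS]addr0; congr (_ + _).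
transitivity (\sum_(i | adj t i && (i != j)) (tr (X t i * X i t * (gz t j * gz j t)) : K)); last exact: E.
by apply: eq_bigr => i /andP[ti ij]; rewrite tr_LN // ij mulr1.
Qed.

(** By [tr_nbr_loop] only the products of two distinct closed paths contribute,
and by [sum_p] their contributions are equal. *)
Lemma tr_circ s j : adj t j -> uniq s -> (forall w, w \in s -> adj t w) ->
  tr (bigcirc true [seq L w | w <- s]) = 'C(size s, 2)%:R * p j ^+ 2.
Proof.
move=> tj; elim: s => [|w s IHs] /= s_uniq ts; first by rewrite tr0 mul0r.
have tw := ts w (mem_head _ _); have [ws {}s_uniq] := andP s_uniq.
have {}ts u : u \in s -> adj t u by move=> us; apply: ts; rewrite inE us orbT.
rewrite /circ mulr1n !trD tr_nbr_loop // [X in X + _]add0r IHs // binS bin1 natrD mulrDl.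
congr (_ + _); rewrite tr_mulC tr_circ_mul; last exact: L_deep.
have E u : u \in s -> tr (L u * L w) = p j ^+ 2 :> K.
  move=> us; have tu := ts u us; rewrite tr_LL // -(sum_p tu) -(sum_p tw) (sum_p tj).
  by case: eqP us => [->|]; rewrite ?(negPf ws) // mulr1.
rewrite (eq_big_seq _ E) big_const_seq count_predT iter_addr_0.
exact/esym/mulr_natl.
Qed.

(** Among the neighbours of t at most one is the parent, so t has two or three
children, and both 'C(2, 2) and 'C(3, 2) are odd. *)
Lemma obstruction : False.
Proof.
have [j tj] : exists j, adj t j.
  have /card_gt0P[j] : (0 < #|[pred u | adj t u]|)%N by rewrite deg3.
  by exists j.
have [y hy yE] := X_rel t; have := tr_cob 1 hy; rewrite mul1r -yE trB tr_sum.
rewrite [X in _ - X]big1 => [|u ut]; last first.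
  by apply: tr_nbr_loop; rewrite adj_sym (away_adj ut).
rewrite [LHS]subr0 (tr_circ tj) ?uniq_children => [/eqP|//|w]; last first.
  by rewrite mem_children => /away_adj.
have pj : p j != 0 by rewrite mulf_neq0 // k_neq0 // adj_sym.
rewrite mulf_eq0 expf_eq0 (negPf pj) orbF => /eqP C0.
have sz : (size (parents adj r t) + size (children adj r lt t) = 3)%N.
  rewrite -size_cat (perm_size (perm_nbrs lt adj_rooted adj_sym t)).
  by rewrite -deg3 -sum1_size big_filter big_enum_cond sum1_card.
have : size (children adj r lt t) \in [:: 2; 3]%N.
  by case: (parents_cases adj_rooted t) sz => [[-> _]|[u -> _]] /= E; rewrite !inE; lia.
by rewrite !inE => /orP[] /eqP sE; move/eqP: C0; rewrite sE -(dvdn_pcharf char2).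
Qed.

End Obstruction.

Lemma typeD_not_quasi_isomorphic (K : fieldType) n (r : 'I_n) (lt : 'I_n -> rel 'I_n) :
  (4 <= n)%N -> child_order (Dynkin_D n) r lt -> 2%N \in [pchar K] ->
  ~ quasi_isomorphic (LCA (Dynkin_D n) r K lt) (Ginzburg (Dynkin_D n) r K).
Proof.
move=> n4 lt_order char2 /quasi_isomorphic_corr [rho rho_corr].
have rooted_D := @Dynkin_D_rooted n r n4.
have sym_D := @Dynkin_D_sym n.
have [X [k [X_e _ dX k_neq0 X_rel]]] := corr_deform rooted_D lt_order rho_corr.
have tn : (n - 3 < n)%N by lia.
have an : (n - 4 < n)%N by lia.
have bn : (n - 2 < n)%N by lia.
have cn : (n - 1 < n)%N by lia.
pose t := Ordinal tn; pose s := [:: Ordinal an; Ordinal bn; Ordinal cn].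
apply: (obstruction (t := t) rooted_D sym_D char2 _ _ X_e dX k_neq0 X_rel).
  have /card_uniqP s3 : uniq s by rewrite /= !inE -!val_eqE /=; lia.
  rewrite -[RHS]s3; apply: eq_card => u; rewrite !inE -!val_eqE /Dynkin_D /=.
  have := ltn_ord u; lia.
move=> w u; have := ltn_ord u; have := ltn_ord w; rewrite /Dynkin_D /=; lia.
Qed.

Theorem theorem13 (K : fieldType) (n : nat) :
  (forall (r : 'I_n) (lt : 'I_n -> rel 'I_n),
     child_order (Dynkin_A n) r lt ->
     exists f : {lrmorphism LCA (Dynkin_A n) r K lt
                         -> Ginzburg (Dynkin_A n) r K},
       quasi_iso f)
  /\
  (forall (r : 'I_n) (lt : 'I_n -> rel 'I_n),
     (4 <= n)%N -> child_order (Dynkin_D n) r lt ->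
     (2%N \notin [pchar K] ->
        exists f : {lrmorphism LCA (Dynkin_D n) r K lt
                            -> Ginzburg (Dynkin_D n) r K},
          quasi_iso f)
     /\
     (2%N \in [pchar K] ->
        ~ quasi_isomorphic (LCA (Dynkin_D n) r K lt)
                           (Ginzburg (Dynkin_D n) r K))).
Proof.
split=> [r lt lt_order|r lt n4 lt_order]; first exact: typeA_quasi_iso.
split=> char2; first exact: typeD_quasi_iso.
exact: typeD_not_quasi_isomorphic.
Qed.
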